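(* Let $r$ be a scoring rule. If there is a constant $z$ such that every scoring vector produced by $r$ for more than $z$ candidates is different from $(0,\dots,0)$, $(1,0,\dots,0)$, $(1,\dots,1,0)$ and $(2,1,\dots,1,0)$, then Possible Winner for $r$ is NP-complete.
   Context: A scoring rule $r$ is a sequence of scoring vectors $s_1,s_2,\dots$, where $s_m=(\alpha_1,\dots,\alpha_m)$ is the vector for $m$ candidates, consists of integers $\alpha_1\ge\dots\ge\alpha_m$, and is computable in time polynomial in $m$; vectors are normalized so that $\alpha_m=0$ and no integer greater than one divides all score values. In a linear order (vote) the candidate at position $j$ gets $\alpha_j$ points; a candidate's score in a profile is the sum over votes. Possible Winner for $r$: given a set $C$ of $m$ candidates, a list of partial votes on $C$ (transitive antisymmetric relations) and $c\in C$, decide whether the partial votes can be extended to linear orders so that $c$ has maximum total score under $s_m$ (the result also holds for the unique-winner variant). *)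

(* Defs.v *)
From mathcomp Require Import all_boot all_order all_algebra.
Set Implicit Arguments.
Unset Strict Implicit.
Unset Printing Implicit Defensive.
Import GRing.Theory.

Inductive move := MoveL | MoveR | MoveN.

(* A tape alphabet consists of the blank [None], the two bits, and finitely
   many auxiliary symbols. *)
Definition symbol (X : finType) : Type := option (bool + X).

(* Tape 0 is the input/output tape. *)
Record machine := Machine {
  state : finType;
  aux : finType;
  work_tapes : nat;
  start : state;
  halting : pred state;
  delta : state -> work_tapes.+1.-tuple (symbol aux) ->
          state * work_tapes.+1.-tuple (symbol aux * move)
}.

(* [(l, r)] is a two-way infinite tape: the head scans the first symbol of [r],
   [l] lists the cells to the left of the head, nearest first, and all cells
   beyond the two lists are blank. *)
Definition tape (X : finType) : Type := (seq (symbol X) * seq (symbol X))%type.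

Definition tape_of (X : finType) (w : seq bool) : tape X :=
  ([::], [seq Some (inl b) | b <- w]).

Definition scan (X : finType) (t : tape X) : symbol X := head None t.2.

Definition act (X : finType) (t : tape X) (a : symbol X * move) : tape X :=
  let: (l, r) := (t.1, a.1 :: behead t.2) in
  match a.2 with
  | MoveL => (behead l, head None l :: r)
  | MoveR => (head None r :: l, behead r)
  | MoveN => (l, r)
  end.

(* The output is the longest word of bits starting at the head. *)
Fixpoint leading_bits (X : finType) (r : seq (symbol X)) : seq bool :=
  if r is Some (inl b) :: r' then b :: leading_bits r' else [::].

Definition config (M : machine) : Type :=
  (state M * (work_tapes M).+1.-tuple (tape (aux M)))%type.

Definition init (M : machine) (w : seq bool) : config M :=
  (start M, [tuple tape_of (aux M) (if i == ord0 then w else [::])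
            | i < (work_tapes M).+1]).

(* Halting configurations are fixed points, so the state after [t] steps also
   records any earlier halt. *)
Definition step (M : machine) (c : config M) : config M :=
  if halting c.1 then c else
  let d := delta c.1 (map_tuple (@scan (aux M)) c.2) in
  (d.1, [tuple act (tnth c.2 i) (tnth d.2 i) | i < (work_tapes M).+1]).

Definition output (M : machine) (c : config M) : seq bool :=
  leading_bits (tnth c.2 ord0).2.

Definition outputs_within (M : machine) (w : seq bool) (t : nat)
    (v : seq bool) : Prop :=
  let c := iter t (@step M) (init M w) in halting c.1 /\ output c = v.

Definition polytime (A B : Type) (encA : A -> seq bool) (encB : B -> seq bool)
    (f : A -> B) : Prop :=
  exists (M : machine) (p : {poly nat}), forall a : A,
    outputs_within M (encA a) p.[size (encA a)]%R (encB (f a)).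

(* Self-delimiting code: every bit is preceded by [true], and [false] ends the
   word. *)
Definition delim (w : seq bool) : seq bool :=
  flatten [seq [:: true; b] | b <- w] ++ [:: false].

Definition enc_pair (xy : seq bool * seq bool) : seq bool :=
  delim xy.1 ++ xy.2.

Definition enc_bool (b : bool) : seq bool := [:: b].

Definition language : Type := seq bool -> Prop.

Definition in_NP (L : language) : Prop :=
  exists (V : seq bool * seq bool -> bool) (q : {poly nat}),
    polytime enc_pair enc_bool V /\
    forall x, L x <-> exists2 y, size y <= q.[size x]%R & V (x, y).

Definition reduces (L1 L2 : language) : Prop :=
  exists2 f : seq bool -> seq bool,
    polytime id id f & forall x, L1 x <-> L2 (f x).

Definition NP_hard (L : language) : Prop :=
  forall L', in_NP L' -> reduces L' L.

Definition NP_complete (L : language) : Prop := in_NP L /\ NP_hard L.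

Definition unary (n : nat) : seq bool := nseq n true.

(* Little-endian, without leading zeros: [up_log 2 n.+1] is the bit length of
   [n], and [binary 0 = [::]]. *)
Definition binary (n : nat) : seq bool :=
  mkseq (fun i => odd (n %/ 2 ^ i)) (up_log 2 n.+1).

Definition enc_scores (s : seq nat) : seq bool :=
  flatten [seq delim (binary a) | a <- s].

(* A non-increasing vector of integers ending with 0 has entries in [nat].
   The zero vector is exempt from the divisibility normalization, as every
   integer divides all its entries.  Time polynomial in [m] amounts to an input
   [m] written in unary. *)
Record scoring_rule := ScoringRule {
  svec :> forall m : nat, m.-tuple nat;
  svec_noninc : forall m, sorted geq (svec m);
  svec_last : forall m, last 0 (svec m) = 0;
  svec_normal : forall m d, 1 < d -> all (dvdn d) (svec m) ->
    svec m = nseq m 0 :> seq nat;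
  svec_polytime : polytime unary enc_scores (fun m => svec m : seq nat)
}.

Definition partial_vote (C : finType) (R : rel C) : Prop :=
  transitive R /\ antisymmetric R.

(* [L a b] reads: [a] is ranked at least as high as [b]. *)
Definition linear_vote (C : finType) (L : rel C) : Prop :=
  [/\ total L, transitive L & antisymmetric L].

(* The 0-based position of [a], hence an index into the scoring vector. *)
Definition position (C : finType) (L : rel C) (a : C) : nat :=
  #|[set b | L b a & b != a]|.

Definition total_score (C : finType) (n : nat) (s : seq nat)
    (P : 'I_n -> rel C) (a : C) : nat :=
  \sum_(i < n) nth 0 s (position (P i) a).

Record pw_instance := PWInstance {
  ncand : nat;
  nvotes : nat;
  votes : 'I_nvotes -> rel 'I_ncand;
  votes_partial : forall i, partial_vote (votes i);
  cand : 'I_ncand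
}.

Definition possible_winner (r : scoring_rule) (I : pw_instance) : Prop :=
  exists P : 'I_(nvotes I) -> rel 'I_(ncand I),
    (forall i, linear_vote (P i) /\ subrel (votes i) (P i)) /\
    forall a, total_score (r (ncand I)) P a
              <= total_score (r (ncand I)) P (cand I).

(* Each vote is written as its adjacency matrix, row by row.  The number of
   votes is determined by the length of the word, as [0 < ncand I]. *)
Definition enc_instance (I : pw_instance) : seq bool :=
  delim (unary (ncand I)) ++ delim (unary (cand I)) ++
  flatten [seq [seq votes i a b | a <- enum 'I_(ncand I),
                                  b <- enum 'I_(ncand I)]
          | i <- enum 'I_(nvotes I)].

Definition PossibleWinner (r : scoring_rule) : language :=
  fun w => exists2 I : pw_instance, w = enc_instance I & possible_winner r I.

(* Main.v *)
(** Membership: the completed votes are the certificate; scores are written in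
    binary, and two totals are compared by propagating, from the least
    significant digit on, the halved difference of their digit sums.

    Hardness: in a Cook-Levin tableau whose columns are taken relative to the
    head, every entry is a variable with finitely many values and every
    forbidden local pattern is a clause saying "not all of these wires", a wire
    being a variable with one of its values.  This is turned into a flow of
    points.  A drop [s_h > s_(h+1)] of the scoring vector lets a vote in which
    two adjacent candidates are incomparable pass [s_h - s_(h+1)] points from
    one candidate to the other.  Further votes, all rotations of a base order,
    give everybody the same score, and the distinguished candidate never moves;
    since the deviations from the common score sum to zero, it wins iff all of
    them vanish, i.e. iff the flow is conserved.  Each variable has a source,
    whose points leave through one of its wires, and each clause has a source,
    whose points must leave through the crossing of one of its literals.  A
    crossing is a single vote that can transmit the flow of the wire or that of
    the clause, but not both.  It needs a second drop, next after the first, or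
    a single drop with equal scores on both sides of it, which is what the
    exclusion of [(0,...,0)], [(1,0,...,0)] and [(1,...,1,0)] provides. *)

Require Import Defs.
From mathcomp Require Import all_boot all_order all_algebra.
From mathcomp Require Import zify ring lra.
From Stdlib Require Import FunctionalExtensionality.
Set Implicit Arguments.
Unset Strict Implicit.
Unset Printing Implicit Defensive.

(** * Programs on string registers *)

(** The scoring rule is given only through a machine computing it, so neither the reduction nor the
    verifier is one closed program: each runs a program, then that machine, then another program
    ([tm_sandwich]). Programs work on trees and write numbers in unary, whereas scores may be
    exponentially large. Scores therefore stay binary words: the reduction only asks where
    neighbouring entries differ, never by how much, and the verifier compares totals digit by digit.
    That the amounts [p] and [q] of the two drops are arbitrary is also the difficulty of the flow
    argument. If they agree, conservation at single nodes lets points of a clause turn into points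
    of a wire. A global count forbids it: the clauses are fed exactly what the sink [cTq] demands,
    at no crossing does more leave for [cTq] than came in from the clause, so the two agree at every
    crossing ([Z_eq_G]). In the tableau the head stays in the middle column, so no head position is
    encoded; in exchange the determined part of a row shrinks by one column on either side per step,
    which the width [T + T.+1] just allows. *)

Inductive tree := Leaf | Node of tree & tree.

(** A prefix code: no end marker is needed, and the code of a pair is [true] followed by the codes
    of its components. A component is recovered by counting the subtrees still to be read. *)
Fixpoint code (t : tree) : seq bool :=
  if t is Node a b then true :: code a ++ code b else [:: false].

Definition store := nat -> seq bool.
Definition update (s : store) i w : store := fun j => if j == i then w else s j.

Inductive prog :=
| Skip
| Push of nat & bool
| Pop of nat
| Seq of prog & prog
| Case of nat & prog & prog & prog
| While of nat & prog & prog.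

(** The costs are the numbers of machine instructions in the code produced by [assemble]: a push
    takes two, and a branch on a bit pays for the test and for a jump at its end. There is no rule
    for popping an empty register, so every execution comes with the proof that none occurs. *)
Inductive exec : prog -> store -> nat -> store -> Prop :=
| ESkip s : exec Skip s 0 s
| EPush i b s : exec (Push i b) s 2 (update s i (b :: s i))
| EPop i b w s : s i = b :: w -> exec (Pop i) s 1 (update s i w)
| ESeq p q s t s' t' s'' : exec p s t s' -> exec q s' t' s'' ->
    exec (Seq p q) s (t + t') s''
| ECaseT i p1 p0 pe w s t s' : s i = true :: w -> exec p1 s t s' ->
    exec (Case i p1 p0 pe) s t.+2 s'
| ECaseF i p1 p0 pe w s t s' : s i = false :: w -> exec p0 s t s' ->
    exec (Case i p1 p0 pe) s t.+2 s'
| ECaseE i p1 p0 pe s t s' : s i = [::] -> exec pe s t s' ->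
    exec (Case i p1 p0 pe) s t.+1 s'
| EWhileT i p1 p0 w s t s' t' s'' : s i = true :: w -> exec p1 s t s' ->
    exec (While i p1 p0) s' t' s'' -> exec (While i p1 p0) s (t.+2 + t') s''
| EWhileF i p1 p0 w s t s' t' s'' : s i = false :: w -> exec p0 s t s' ->
    exec (While i p1 p0) s' t' s'' -> exec (While i p1 p0) s (t.+2 + t') s''
| EWhileE i p1 p0 s : s i = [::] -> exec (While i p1 p0) s 1 s.

Definition run p s T s' := exists2 t, t <= T & exec p s t s'.

Lemma run_weak p s T T' s' : run p s T s' -> T <= T' -> run p s T' s'.
Proof. by case=> t tT e le; exists t => //; apply: leq_trans le. Qed.

Lemma run_seq p q s s' s'' T1 T2 T : run p s T1 s' -> run q s' T2 s'' ->
  T1 + T2 <= T -> run (Seq p q) s T s''.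
Proof.
case=> t tT e [t' tT' e'] le; exists (t + t'); last exact: ESeq e e'.
by apply: leq_trans le; apply: leq_add.
Qed.

(** No more bits are pushed than time is spent; hence every time bound also bounds the size of the
    result, which is how the arguments of subsequent calls are bounded. *)
Lemma exec_size p s t s' : exec p s t s' -> forall i, size (s' i) <= size (s i) + t.
Proof.
elim=> {p s t s'} => //=; try by move=> *; rewrite ?addn0; lia.
- by move=> i b s j; rewrite /update; case: eqP => [->|_] /=; lia.
- by move=> i b w s e j; rewrite /update; case: eqP => [->|_]; rewrite ?e /=; lia.
- by move=> p q s t s' t' s'' _ h1 _ h2 i; have := h1 i; have := h2 i; lia.
- by move=> i p1 p0 pe w s t s' _ _ h j; have := h j; lia.
- by move=> i p1 p0 pe w s t s' _ _ h j; have := h j; lia.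
- by move=> i p1 p0 pe s t s' _ _ h j; have := h j; lia.
- by move=> i p1 p0 w s t s' t' s'' _ _ h1 _ h2 j; have := h1 j; have := h2 j; lia.
- by move=> i p1 p0 w s t s' t' s'' _ _ h1 _ h2 j; have := h1 j; have := h2 j; lia.
Qed.

(* [stack s b ws] is the store [s] below register [b], followed by the contents
   [ws] and then by empty registers: registers from [b] on form a stack. *)
Definition stack (s : store) b (ws : seq (seq bool)) : store :=
  fun j => if j < b then s j else nth [::] ws (j - b).

Lemma stack_get s b ws i : stack s b ws (b + i) = nth [::] ws i.
Proof. by rewrite /stack ltnNge leq_addr /= addKn. Qed.

Lemma stack_upd s b ws i w :
  update (stack s b ws) (b + i) w = stack s b (set_nth [::] ws i w).
Proof.
apply: functional_extensionality => j; rewrite /update /stack.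
case: eqP => [->|ne]; first by rewrite ltnNge leq_addr /= addKn nth_set_nth /= eqxx.
case: ltnP => // le; rewrite nth_set_nth /=; case: eqP => // e; lia.
Qed.

Lemma stack_shift s b ws vs :
  stack (stack s b ws) (b + size ws) vs = stack s b (ws ++ vs).
Proof.
apply: functional_extensionality => j; rewrite /stack nth_cat.
case: (ltnP j b) => h.
  by rewrite ltn_addr.
have -> : (j < b + size ws) = (j - b < size ws) by lia.
by case: ltnP => // _; rewrite subnDA.
Qed.

Definition mv i j := While i (Seq (Pop i) (Push j true)) (Seq (Pop i) (Push j false)).

Lemma exec_mv s i j w : i != j -> s i = w ->
  run (mv i j) s (5 * size w + 1) (update (update s i [::]) j (catrev w (s j))).
Proof.
move=> ij; elim: w s => [|b w IH] s e.
  exists 1 => //=; suff -> : update (update s i [::]) j (s j) = s by apply: EWhileE.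
  by apply: functional_extensionality => k; rewrite /update; case: eqP => [->//|_]; case: eqP => [->|].
pose s1 := update (update s i w) j (b :: s j).
have [|t tT e1] := IH s1; first by rewrite /s1 /update (negbTE ij) eqxx.
exists (5 + t); first by rewrite /=; lia.
have -> : update (update s i [::]) j (catrev (b :: w) (s j)) =
          update (update s1 i [::]) j (catrev w (s1 j)).
  apply: functional_extensionality => k; rewrite /s1 /update /= eqxx.
  by case: eqP => // _; case: eqP.
have es : exec (Seq (Pop i) (Push j b)) s 3 s1.
  apply: (@ESeq _ _ _ 1 _ 2); first exact: EPop e.
  have -> : s1 = update (update s i w) j (b :: update s i w j).
    by rewrite /s1; congr (update _ _ (_ :: _)); rewrite /update eq_sym (negbTE ij).
  exact: EPush.
by case: b e {IH} @s1 es e1 => e s1 es e1; [apply: EWhileT e es e1|apply: EWhileF e es e1].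
Qed.

Definition mv2 i j k :=
  While i (Seq (Pop i) (Seq (Push j true) (Push k true)))
          (Seq (Pop i) (Seq (Push j false) (Push k false))).

Lemma exec_mv2 s i j k w : i != j -> i != k -> j != k -> s i = w ->
  run (mv2 i j k) s (7 * size w + 1)
   (update (update (update s i [::]) j (catrev w (s j))) k (catrev w (s k))).
Proof.
move=> ij ik jk; elim: w s => [|b w IH] s e.
  exists 1 => //=; suff -> : update (update (update s i [::]) j (s j)) k (s k) = s by apply: EWhileE.
  apply: functional_extensionality => l; rewrite /update; case: eqP => [->//|_].
  by case: eqP => [->//|_]; case: eqP => [->|].
pose s1 := update (update (update s i w) j (b :: s j)) k (b :: s k).
have [|t tT e1] := IH s1.
  by rewrite /s1 /update (negbTE ij) (negbTE ik) eqxx.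
exists (7 + t); first by rewrite /=; lia.
have -> : update (update (update s i [::]) j (catrev (b :: w) (s j))) k (catrev (b :: w) (s k)) =
          update (update (update s1 i [::]) j (catrev w (s1 j))) k (catrev w (s1 k)).
  apply: functional_extensionality => l; rewrite /s1 /update /= !eqxx (negbTE jk).
  by case: eqP => // _; case: eqP => // _; case: eqP.
have es : exec (Seq (Pop i) (Seq (Push j b) (Push k b))) s 5 s1.
  apply: (@ESeq _ _ _ 1 _ 4); first exact: EPop e.
  apply: (@ESeq _ _ _ 2 _ 2); first exact: EPush.
  have -> : s1 = update (update (update s i w) j (b :: update s i w j)) k
                (b :: update (update s i w) j (b :: update s i w j) k).
    rewrite /s1; congr (update (update _ _ (_ :: _)) _ (_ :: _)); rewrite /update.
      by rewrite eq_sym (negbTE ij).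
    by rewrite ![k == _]eq_sym (negbTE ik) (negbTE jk).
  exact: EPush.
by case: b e {IH} @s1 es e1 => e s1 es e1; [apply: EWhileT e es e1|apply: EWhileF e es e1].
Qed.

Definition clear i := While i (Pop i) (Pop i).

Lemma exec_clear s i w : s i = w ->
  run (clear i) s (3 * size w + 1) (update s i [::]).
Proof.
elim: w s => [|b w IH] s e.
  exists 1 => //=; suff -> : update s i [::] = s by apply: EWhileE.
  by apply: functional_extensionality => k; rewrite /update; case: eqP => [->|].
have [|t tT e1] := IH (update s i w); first by rewrite /update eqxx.
exists (3 + t); first by rewrite /=; lia.
have <- : update (update s i w) i [::] = update s i [::].
  by apply: functional_extensionality => k; rewrite /update; case: eqP.
have es : exec (Pop i) s 1 (update s i w) by apply: EPop e.
by case: b e {IH} => e; [apply: EWhileT e es e1|apply: EWhileF e es e1].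
Qed.

(** Register [c] counts in unary the subtrees still to be read: [true] opens a node and so replaces
    one pending subtree by two, [false] is a leaf and completes one. The bits read pile up reversed
    in [t]. *)
Definition take_loop i c t :=
  While c (Case i (Seq (Pop i) (Seq (Push t true) (Push c true)))
                  (Seq (Pop i) (Seq (Push t false) (Pop c))) Skip) Skip.
Definition take_tree i c t j := Seq (Push c true) (Seq (take_loop i c t) (mv t j)).

Lemma update_eq (s s' : store) i w : (forall j, j != i -> s j = s' j) -> s' i = w -> update s i w = s'.
Proof.
move=> h e; apply: functional_extensionality => j; rewrite /update.
by case: eqP => [->//|/eqP]; apply: h.
Qed.

(** The rest of the loop appears as a hypothesis because the loop does not stop between the two
    subtrees of a node: the run over the right subtree is the continuation needed for the left
    one. *)
Lemma exec_take_loop i c t x : i != c -> i != t -> c != t ->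
  forall s w u n T s', s i = code x ++ w -> s c = true :: nseq n true ->
    s t = u ->
  run (take_loop i c t) (update (update (update s i w) c (nseq n true)) t (catrev (code x) u))
    T s' -> run (take_loop i c t) s (9 * size (code x) + T) s'.
Proof.
move=> ic it ct; elim: x => [|a IHa b IHb] s w u n T s' ei ec et /=.
  case=> T' le e; exists (8 + T'); first lia.
  apply: (@EWhileT _ _ _ (nseq n true) _ 6) => //; last exact: e.
  apply: (@ECaseF _ _ _ _ w) => //.
  apply: (@ESeq _ _ _ 1 _ 3); first exact: EPop ei.
  apply: (@ESeq _ _ _ 2 _ 1); first exact: EPush.
  set s2 := (X in exec _ X).
  have -> : update (update (update s i w) c (nseq n true)) t (false :: u) = update s2 c (nseq n true).
    apply: functional_extensionality => k; rewrite /s2 /update.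
    case: (eqVneq k t) => [->|_]; last by case: eqP.
    by rewrite eq_sym (negbTE ct) eq_sym (negbTE it) et.
  by apply: (@EPop _ true); rewrite /s2 /update (negbTE ct) [c == i]eq_sym (negbTE ic) ec.
move=> R.
pose s1 := update (update (update s i (code a ++ code b ++ w)) c (nseq n.+2 true)) t (true :: u).
have R1 : run (take_loop i c t) s1 (9 * size (code a) + (9 * size (code b) + T)) s'.
  pose s2 := update (update (update s1 i (code b ++ w)) c (nseq n.+1 true)) t (catrev (code a) (true :: u)).
  have ti : (t == i) = false by rewrite eq_sym (negbTE it).
  have ci : (c == i) = false by rewrite eq_sym (negbTE ic).
  apply: (IHa s1 (code b ++ w) (true :: u) n.+1); rewrite /s1.
  - by rewrite /update (negbTE it) (negbTE ic) eqxx.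
  - by rewrite /update (negbTE ct) eqxx.
  - by rewrite /update eqxx.
  rewrite -/s1 -/s2; apply: (IHb s2 w (catrev (code a) (true :: u)) n); rewrite /s2.
  - by rewrite /update (negbTE it) (negbTE ic) eqxx.
  - by rewrite /update (negbTE ct) eqxx.
  - by rewrite /update eqxx.
  rewrite -/s2; set s3 := update _ _ _.
  suff -> : s3 = update (update (update s i w) c (nseq n true)) t (catrev (code a ++ code b) (true :: u)) by [].
  apply: functional_extensionality => k; rewrite /s3 /s2 /s1 /update.
  by case: (k == t); rewrite ?catrevE ?rev_cat ?catA //; case: (k == c); case: (k == i).
case: R1 => T' le e; exists (9 + T'); first by rewrite /= size_cat; lia.
apply: (@EWhileT _ _ _ (nseq n true) _ 7) => //; last exact: e.
rewrite /= -catA in ei.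
apply: (@ECaseT _ _ _ _ (code a ++ code b ++ w)) => //.
apply: (@ESeq _ _ _ 1 _ 4); first exact: EPop ei.
apply: (@ESeq _ _ _ 2 _ 2); first exact: EPush.
set s2 := (X in exec _ X).
have -> : s1 = update s2 c (true :: s2 c).
  apply: functional_extensionality => k; rewrite /s1 /s2 /update.
  rewrite (negbTE ct) [c == i]eq_sym (negbTE ic) ec [t == i]eq_sym (negbTE it) et.
  case: (eqVneq k t) => [->|_]; last by case: eqP.
  by rewrite eq_sym (negbTE ct).
exact: EPush.
Qed.

Lemma exec_take_tree s i c t j x w : uniq [:: i; c; t; j] ->
  s i = code x ++ w -> s c = [::] -> s t = [::] ->
  run (take_tree i c t j) s (14 * size (code x) + 10)
     (update (update s i w) j (code x ++ s j)).
Proof.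
rewrite /= !inE !negb_or => /and4P[/and3P[ic it ij] /andP[ct cj] tj _] ei ec et.
have ti : (t == i) = false by rewrite eq_sym (negbTE it).
have ci : (c == i) = false by rewrite eq_sym (negbTE ic).
pose s0 := update s c [:: true].
apply: (@run_seq _ _ _ s0 _ 2 (14 * size (code x) + 8)); last lia.
  by exists 2 => //; rewrite /s0 -ec; apply: EPush.
pose s1 := update (update (update s0 i w) c (nseq 0 true)) t (catrev (code x) [::]).
apply: (@run_seq _ _ _ s1 _ (9 * size (code x) + 1) (5 * size (code x) + 1)); last lia.
  apply: (@exec_take_loop i c t x ic it ct s0 w [::] 0).
  - by rewrite /s0 /update (negbTE ic).
  - by rewrite /s0 /update eqxx.
  - by rewrite /s0 /update eq_sym (negbTE ct).
  - by exists 1 => //; apply: EWhileE; rewrite /update (negbTE ct) eqxx.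
have := @exec_mv s1 t j (rev (code x)) tj; rewrite size_rev => H.
have {H} := H _.
have -> : update (update s1 t [::]) j (catrev (rev (code x)) (s1 j)) =
   update (update s i w) j (code x ++ s j).
  apply: functional_extensionality => k; rewrite /s1 /s0 /update.
  rewrite catrevE revK ![j == _]eq_sym (negbTE tj) (negbTE cj) (negbTE ij).
  case: eqP => // _; case: eqP => [->|_]; first by rewrite ti et.
  by case: eqP => [->|//]; rewrite ci ec.
by apply; rewrite /s1 /update eqxx catrevE cats0.
Qed.

Fixpoint pushs i (w : seq bool) : prog :=
  if w is b :: w' then Seq (pushs i w') (Push i b) else Skip.

Lemma exec_pushs i w s : run (pushs i w) s (2 * size w) (update s i (w ++ s i)).
Proof.
elim: w => [|b w IH] /=.
  exists 0 => //; suff -> : update s i (s i) = s by apply: ESkip.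
  exact: update_eq.
apply: (run_seq IH (s'' := update s i (b :: w ++ s i)) (T2 := 2)); last lia.
exists 2 => //.
have -> : update s i (b :: w ++ s i) = update (update s i (w ++ s i)) i (b :: update s i (w ++ s i) i).
  apply: functional_extensionality => k; rewrite /update eqxx; by case: eqP.
exact: EPush.
Qed.

Lemma run_caseT i p1 p0 pe w s T s' : s i = true :: w -> run p1 s T s' ->
    run (Case i p1 p0 pe) s (T + 2) s'.
Proof. by move=> e [t le x]; exists t.+2; [lia|apply: ECaseT e x]. Qed.

Lemma run_caseF i p1 p0 pe w s T s' : s i = false :: w -> run p0 s T s' ->
    run (Case i p1 p0 pe) s (T + 2) s'.
Proof. by move=> e [t le x]; exists t.+2; [lia|apply: ECaseF e x]. Qed.

(** * Functions computable in polynomial time *)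

(** The base is at least 2, so constants and sums are absorbed by raising [k], and the bound is
    monotone in both arguments. A single exponent thus stands for any polynomial bound. *)
Definition bound k n := (n + 2) ^ k.

Lemma bound_mono k m n : m <= n -> bound k m <= bound k n.
Proof. by case: k => // k h; rewrite /bound leq_exp2r // leq_add2r. Qed.

Definition poly_bounded (T : nat -> nat) := exists k, forall n, T n <= bound k n.

Lemma poly_bounded_bndk k : poly_bounded (bound k).
Proof. by exists k. Qed.

Lemma poly_bounded_const c : poly_bounded (fun _ => c).
Proof.
exists c => n; apply: leq_trans (ltnW (ltn_expl c (ltnSn 1))) _.
by rewrite /bound; case: c => // c; rewrite leq_exp2r // leq_addl.
Qed.

Lemma poly_bounded_id : poly_bounded (fun n => n).
Proof. by exists 1 => n; rewrite /bound expn1 leq_addr. Qed.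

Lemma bound_leq k l n : k <= l -> bound k n <= bound l n.
Proof. by move=> h; rewrite /bound leq_pexp2l // addn2. Qed.

Lemma poly_bounded_add T U : poly_bounded T -> poly_bounded U -> poly_bounded (fun n => T n + U n).
Proof.
case=> k hk [l hl]; exists (maxn k l).+1 => n.
have := leq_trans (hk n) (bound_leq n (leq_maxl k l)).
have := leq_trans (hl n) (bound_leq n (leq_maxr k l)).
have : 2 * bound (maxn k l) n <= bound (maxn k l).+1 n by rewrite /bound expnS leq_mul2r leq_addl orbT.
lia.
Qed.

Lemma poly_bounded_mul T U : poly_bounded T -> poly_bounded U -> poly_bounded (fun n => T n * U n).
Proof.
by case=> k hk [l hl]; exists (k + l) => n; rewrite /bound expnD; apply: leq_mul.
Qed.

Lemma poly_bounded_comp k U : poly_bounded U -> poly_bounded (fun n => bound k (U n)).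
Proof.
case=> l hl; exists (l.+2 * k) => n; apply: leq_trans (bound_mono k (hl n)) _.
rewrite /bound expnM; case: k => // k; rewrite leq_exp2r // !expnS.
have : 0 < (n + 2) ^ l by rewrite expn_gt0 addn2.
nia.
Qed.

Ltac poly_bound := repeat (cbv beta; lazymatch goal with
  | |- poly_bounded (fun n => n) => exact: poly_bounded_id
  | |- poly_bounded (fun _ => ?c) => exact: (poly_bounded_const c)
  | |- poly_bounded (bound ?k) => exact: (poly_bounded_bndk k)
  | |- poly_bounded (fun n => @?a n + @?b n) => apply: (@poly_bounded_add a b)
  | |- poly_bounded (fun n => @?a n * @?b n) => apply: (@poly_bounded_mul a b)
  | |- poly_bounded (fun n => bound ?k (@?a n)) => apply: (@poly_bounded_comp k a)
  end).

Class Enc (A : Type) := enc : A -> tree.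

Definition word_of {A} `{Enc A} (a : A) := code (enc a).
Definition csize {A} `{Enc A} (a : A) := size (word_of a).

(* The program works on a stack of registers from [b] on, so that it can be
   called with the registers below [b] in use. *)
Definition ptime {A B} `{Enc A} `{Enc B} (f : A -> B) := exists p k, forall s b a,
  run (p b) (stack s b [:: word_of a]) (bound k (csize a)) (stack s b [:: word_of (f a)]).

Lemma ptimeI A B `{Enc A} `{Enc B} (f : A -> B) p T : poly_bounded T ->
  (forall s b a, run (p b) (stack s b [:: word_of a]) (T (csize a)) (stack s b [:: word_of (f a)])) ->
  ptime f.
Proof.
by case=> k hk h; exists p, k => s b a; apply: run_weak (h s b a) (hk _).
Qed.

Lemma stack_eq s b ws vs : (forall i, nth [::] ws i = nth [::] vs i) ->
  stack s b ws = stack s b vs.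
Proof. by move=> h; apply: functional_extensionality => j; rewrite /stack h. Qed.

Lemma run_size s b w T v p : run p (stack s b [:: w]) T (stack s b [:: v]) ->
  size v <= size w + T.
Proof.
case=> t le /exec_size /(_ b); rewrite /stack ltnn subnn /=; lia.
Qed.

Lemma ptime_size A B `{Enc A} `{Enc B} (f : A -> B) : ptime f ->
  exists k, forall a, csize (f a) <= bound k (csize a).
Proof.
case=> p [k h]; have [l hl] : poly_bounded (fun n => n + bound k n) by poly_bound.
exists l => a; apply: leq_trans (hl _).
exact: run_size (h (fun _ => [::]) 0 a).
Qed.

(** [mv] reverses the word it moves; the detour through the empty register [t] restores the
    order. *)
Definition mov i j t := Seq (mv i t) (mv t j).

Lemma stack_push s b ws i x :
  run (Push (b + i) x) (stack s b ws) 2 (stack s b (set_nth [::] ws i (x :: nth [::] ws i))).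
Proof. by exists 2 => //; rewrite -stack_upd -(stack_get s b ws i); apply: EPush. Qed.

Lemma stack_pop s b ws i x w : nth [::] ws i = x :: w ->
  run (Pop (b + i)) (stack s b ws) 1 (stack s b (set_nth [::] ws i w)).
Proof. by exists 1 => //; rewrite -stack_upd; apply: (@EPop _ x); rewrite stack_get. Qed.

Lemma run_post p s T s' s'' : run p s T s' -> s' = s'' -> run p s T s''.
Proof. by move=> r <-. Qed.

Lemma nth_set (ws : seq (seq bool)) i x k :
  nth [::] (set_nth [::] ws i x) k = if k == i then x else nth [::] ws k.
Proof. by rewrite nth_set_nth. Qed.

Lemma stack_mv1 s b ws i j t : uniq [:: i; j; t] -> nth [::] ws t = [::] ->
  [/\ i != t, j != t, i != j & run (mv (b + i) (b + t)) (stack s b ws)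
    (5 * size (nth [::] ws i) + 1)
    (stack s b (set_nth [::] (set_nth [::] ws i [::]) t (rev (nth [::] ws i))))].
Proof.
rewrite /= !inE negb_or => /and3P[/andP[ij it] jt _] e; split => //.
apply: run_post; first by apply: exec_mv; rewrite ?eqn_add2l // stack_get.
by rewrite !stack_upd stack_get e catrevE cats0.
Qed.

Lemma stack_mov s b ws i j t : uniq [:: i; j; t] -> nth [::] ws t = [::] ->
  run (mov (b + i) (b + j) (b + t)) (stack s b ws) (10 * size (nth [::] ws i) + 2)
    (stack s b (set_nth [::] (set_nth [::] ws i [::]) j (nth [::] ws i ++ nth [::] ws j))).
Proof.
move=> u h; have [it jt ij h1] := stack_mv1 s b u h.
set w := nth _ _ i in h1 *; set ws1 := set_nth _ _ t _ in h1.
have := @exec_mv (stack s b ws1) (b + t) (b + j) (rev w).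
rewrite eqn_add2l eq_sym jt stack_get nth_set eqxx => /(_ isT erefl) h2.
apply: run_post (run_seq h1 h2 _) _; first by rewrite size_rev; lia.
rewrite !stack_upd stack_get catrevE revK !nth_set (negbTE jt) [j == i]eq_sym (negbTE ij).
apply: stack_eq => k; rewrite !nth_set.
have ti : (t == i) = false by rewrite eq_sym (negbTE it).
by case: eqP => // _; case: (eqVneq k t) => [->|ne]; rewrite ?ti ?h.
Qed.

Definition dup i j t := Seq (mv i t) (mv2 t i j).

Lemma stack_dup s b ws i j t : uniq [:: i; j; t] -> nth [::] ws t = [::] ->
  run (dup (b + i) (b + j) (b + t)) (stack s b ws) (12 * size (nth [::] ws i) + 2)
    (stack s b (set_nth [::] ws j (nth [::] ws i ++ nth [::] ws j))).
Proof.
move=> u h; have [it jt ij h1] := stack_mv1 s b u h.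
set w := nth _ _ i in h1 *; set ws1 := set_nth _ _ t _ in h1.
have := @exec_mv2 (stack s b ws1) (b + t) (b + i) (b + j) (rev w).
rewrite !eqn_add2l [t == j]eq_sym [t == i]eq_sym it jt ij stack_get nth_set eqxx.
move=> /(_ isT isT isT erefl) h2.
apply: run_post (run_seq h1 h2 _) _; first by rewrite size_rev; lia.
rewrite !stack_upd !stack_get !catrevE revK !nth_set (negbTE jt) (negbTE it) [j == i]eq_sym (negbTE ij) eqxx.
apply: stack_eq => k; rewrite !nth_set.
case: (eqVneq k j) => // _; case: (eqVneq k i) => [->|_]; first by rewrite cats0.
by case: eqP => // ->.
Qed.

Lemma stack_clear s b ws i :
  run (clear (b + i)) (stack s b ws) (3 * size (nth [::] ws i) + 1)
    (stack s b (set_nth [::] ws i [::])).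
Proof. by rewrite -stack_upd; apply: exec_clear; rewrite stack_get. Qed.

Lemma stack_take_tree s b ws i c t j x w : uniq [:: i; c; t; j] ->
  nth [::] ws i = code x ++ w -> nth [::] ws c = [::] -> nth [::] ws t = [::] ->
  run (take_tree (b + i) (b + c) (b + t) (b + j)) (stack s b ws) (14 * size (code x) + 10)
    (stack s b (set_nth [::] (set_nth [::] ws i w) j (code x ++ nth [::] ws j))).
Proof.
move=> u e ec et; rewrite -!stack_upd -(stack_get s b ws j); apply: exec_take_tree; rewrite ?stack_get //.
by have := u; rewrite -(map_inj_uniq (@addnI b)).
Qed.

Lemma stack_caseT s b ws i p1 p0 pe w T s' : nth [::] ws i = true :: w ->
  run p1 (stack s b ws) T s' -> run (Case (b + i) p1 p0 pe) (stack s b ws) (T + 2) s'.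
Proof. by move=> e; apply: (@run_caseT _ _ _ _ w); rewrite stack_get. Qed.

Lemma stack_caseF s b ws i p1 p0 pe w T s' : nth [::] ws i = false :: w ->
  run p0 (stack s b ws) T s' -> run (Case (b + i) p1 p0 pe) (stack s b ws) (T + 2) s'.
Proof. by move=> e; apply: (@run_caseF _ _ _ _ w); rewrite stack_get. Qed.

Lemma stack_call p s b ws T i w v : size ws = i ->
  (forall s' b', run (p b') (stack s' b' [:: w]) T (stack s' b' [:: v])) ->
  run (p (b + i)) (stack s b (rcons ws w)) T (stack s b (rcons ws v)).
Proof. by move=> <- h; rewrite -!cats1 -!stack_shift; apply: h. Qed.

Lemma stack_call0 (p : nat -> prog) s b w v T :
  (forall s' b', run (p b') (stack s' b' [:: w]) T (stack s' b' [:: v])) ->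
  run (p (b + 0)) (stack s b [:: w]) T (stack s b [:: v]).
Proof. by move=> h; rewrite addn0. Qed.

Ltac stack_eq_tac := apply: stack_eq => -[|[|[|[|[|[|[|[|?]]]]]]]] //=; rewrite ?nth_nil ?cats0 //.
(* Runs one part of a program and names the stack that it leaves. The times stay undetermined until
   the end, where their sum is compared with the bound. *)
Tactic Notation "stp" uconstr(ws) uconstr(lem) :=
  cbv beta; match goal with |- run _ (stack ?s ?b _) _ _ =>
   refine (@run_seq _ _ _ (stack s b ws) _ _ _ _ _ _ _);
     [ refine (run_post _ _); [ let l := open_constr:(lem) in eapply l => //= | stack_eq_tac ] | | ] end.

Ltac fin := match goal with
  | |- is_true (_ <= ?x) => is_evar x; exact: leqnn
  | |- is_true (_ <= _) => unfold csize, word_of in *; rewrite /= ?size_cat; lia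
  end.

Global Instance enc_unit : Enc unit := fun _ => Leaf.
Global Instance enc_bit : Enc bool := fun b => if b then Node Leaf Leaf else Leaf.
Fixpoint enc_nat_ (n : nat) : tree := if n is n'.+1 then Node Leaf (enc_nat_ n') else Leaf.
Global Instance enc_nat : Enc nat := enc_nat_.
Global Instance enc_prod A B `{Enc A} `{Enc B} : Enc (A * B) :=
  fun x => Node (enc x.1) (enc x.2).
Global Instance enc_seq A `{Enc A} : Enc (seq A) :=
  fix e s := if s is x :: s' then Node (enc x) (e s') else Leaf.

Lemma csize_prod A B `{Enc A} `{Enc B} (a : A) (c : B) : csize (a, c) = (csize a + csize c).+1.
Proof. by rewrite /csize /word_of /= size_cat. Qed.
Lemma csize_cons A `{Enc A} (a : A) s : csize (a :: s) = (csize a + csize s).+1.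
Proof. by rewrite /csize /word_of /= size_cat. Qed.
Lemma csize_nat (n : nat) : csize n = n.*2.+1.
Proof. by elim: n => //= n; rewrite /csize /word_of /= => ->; rewrite doubleS. Qed.

Section prim.
Context {A B C : Type} {eA : Enc A} {eB : Enc B} {eC : Enc C}.

Lemma ptime_id : ptime (fun x : A => x).
Proof. by exists (fun _ => Skip), 0 => s b a; exists 0 => //; apply: ESkip. Qed.

Lemma ptime_comp (g : B -> C) (f : A -> B) : ptime g -> ptime f -> ptime (fun x => g (f x)).
Proof.
case=> pg [kg hg] [pf [kf hf]].
apply: (@ptimeI _ _ _ _ _ (fun b => Seq (pf b) (pg b)) (fun n => bound kf n + bound kg (n + bound kf n))).
  poly_bound.
move=> s b a; apply: run_seq (hf s b a) (hg s b (f a)) _.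
by rewrite leq_add2l bound_mono // (run_size (hf s b a)).
Qed.

Lemma ptime_const (c : B) : ptime (fun _ : A => c).
Proof.
apply: (@ptimeI _ _ _ _ _ (fun b => Seq (clear (b + 0)) (pushs (b + 0) (word_of c)))
  (fun n => 3 * n + 1 + 2 * size (word_of c))); first by poly_bound.
move=> s b a; stp [:: [::]] stack_clear.
  by apply: run_post; [exact: exec_pushs|rewrite stack_upd stack_get /=; stack_eq_tac].
by rewrite leqnn.
Qed.

Lemma ptime_fst : ptime (fun x : A * B => x.1).
Proof.
apply: (@ptimeI _ _ _ _ _ (fun b => Seq (Pop (b + 0)) (Seq (take_tree (b + 0) (b + 2) (b + 3) (b + 1))
   (Seq (clear (b + 0)) (mov (b + 1) (b + 0) (b + 2)))))
  (fun n => 100 * n + 100)); first by poly_bound.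
move=> s b a.
stp [:: word_of a.1 ++ word_of a.2] stack_pop.
stp [:: word_of a.2; word_of a.1] (stack_take_tree).
stp [:: [::] ; word_of a.1] stack_clear.
apply: run_post; [ apply: stack_mov => //= | stack_eq_tac].
all: fin.
Qed.

Lemma ptime_snd : ptime (fun x : A * B => x.2).
Proof.
apply: (@ptimeI _ _ _ _ _ (fun b => Seq (Pop (b + 0)) (Seq (take_tree (b + 0) (b + 2) (b + 3) (b + 1))
   (clear (b + 1))))
  (fun n => 100 * n + 100)); first by poly_bound.
move=> s b a.
stp [:: word_of a.1 ++ word_of a.2] stack_pop.
stp [:: word_of a.2; word_of a.1] (stack_take_tree).
apply: run_post; [ apply: stack_clear => //= | stack_eq_tac].
all: fin.
Qed.

Lemma ptime_pair (f : A -> B) (g : A -> C) : ptime f -> ptime g -> ptime (fun x => (f x, g x)).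
Proof.
case=> pf [kf hf] [pg [kg hg]].
apply: (@ptimeI _ _ _ _ _ (fun b => Seq (dup (b + 0) (b + 1) (b + 2)) (Seq (pf (b + 1))
   (Seq (mov (b + 0) (b + 2) (b + 3)) (Seq (pg (b + 2)) (Seq (mov (b + 2) (b + 0) (b + 3))
   (Seq (mov (b + 1) (b + 0) (b + 2)) (Push (b + 0) true)))))))
  (fun n => 100 * (n + bound kf n + bound kg n + 1))); first by poly_bound.
move=> s b a.
have sf := run_size (hf s b a); have sg := run_size (hg s b a).
stp [:: word_of a; word_of a] stack_dup.
stp [:: word_of a; word_of (f a)] (@stack_call pf s b [:: word_of a] _ 1 _ _ erefl (fun s b => hf s b a)).
stp [:: [::]; word_of (f a); word_of a] stack_mov.
stp [:: [::]; word_of (f a); word_of (g a)] (@stack_call pg s b [:: [::]; word_of (f a)] _ 2 _ _ erefl (fun s b => hg s b a)).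
stp [:: word_of (g a); word_of (f a)] stack_mov.
stp [:: word_of (f a) ++ word_of (g a)] stack_mov.
apply: run_post; [ apply: stack_push | stack_eq_tac].
all: fin.
Qed.

End prim.

Lemma stack_whileT s b ws i p1 p0 w T s' T' s'' : nth [::] ws i = true :: w ->
  run p1 (stack s b ws) T s' -> run (While (b + i) p1 p0) s' T' s'' ->
  run (While (b + i) p1 p0) (stack s b ws) (T + 2 + T') s''.
Proof.
move=> e [t le x] [t' le' x']; exists (t.+2 + t'); first lia.
by apply: EWhileT x x'; rewrite stack_get e.
Qed.

Lemma stack_whileF s b ws i p1 p0 w T s' T' s'' : nth [::] ws i = false :: w ->
  run p0 (stack s b ws) T s' -> run (While (b + i) p1 p0) s' T' s'' ->
  run (While (b + i) p1 p0) (stack s b ws) (T + 2 + T') s''.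
Proof.
move=> e [t le x] [t' le' x']; exists (t.+2 + t'); first lia.
by apply: EWhileF x x'; rewrite stack_get e.
Qed.

Lemma stack_whileE s b ws i p1 p0 : nth [::] ws i = [::] ->
  run (While (b + i) p1 p0) (stack s b ws) 1 (stack s b ws).
Proof. by move=> e; exists 1 => //; apply: EWhileE; rewrite stack_get. Qed.

Lemma csize_catr A `{Enc A} (l1 l2 : seq A) : csize l2 <= csize (l1 ++ l2).
Proof. by elim: l1 => // c l1 IHl; rewrite cat_cons csize_cons; lia. Qed.

Lemma size_tsz A `{Enc A} (l : seq A) : size l < csize l.
Proof. by elim: l => // c l IHl; rewrite csize_cons /=; lia. Qed.

(** Polynomial time under a precondition: a fold may stay small only on those arguments which its
    context supplies. *)
Definition ptime_on A B `{Enc A} `{Enc B} (D : A -> Prop) (f : A -> B) := exists p k,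
  forall s b a, D a -> run (p b) (stack s b [:: word_of a]) (bound k (csize a)) (stack s b [:: word_of (f a)]).

Lemma ptime_onI A B `{Enc A} `{Enc B} (D : A -> Prop) (f : A -> B) p T : poly_bounded T ->
  (forall s b a, D a -> run (p b) (stack s b [:: word_of a]) (T (csize a)) (stack s b [:: word_of (f a)])) ->
  ptime_on D f.
Proof.
by case=> k hk h; exists p, k => s b a Da; apply: run_weak (h s b a Da) (hk _).
Qed.

Lemma ptime_on_comp A B C `{Enc A} `{Enc B} `{Enc C} (D : B -> Prop) (g : B -> C) (f : A -> B) :
  ptime_on D g -> ptime f -> (forall a, D (f a)) -> ptime (fun x => g (f x)).
Proof.
case=> pg [kg hg] [pf [kf hf]] hD.
apply: (@ptimeI _ _ _ _ _ (fun b => Seq (pf b) (pg b)) (fun n => bound kf n + bound kg (n + bound kf n))).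
  poly_bound.
move=> s b a; apply: run_seq (hf s b a) (hg s b (f a) (hD a)) _.
by rewrite leq_add2l bound_mono // (run_size (hf s b a)).
Qed.

Section lists.
Context {G A B : Type} {eG : Enc G} {eA : Enc A} {eB : Enc B}.

Lemma ptime_lcase_core (e0 : G -> B) (e1 : G * (A * seq A) -> B) : ptime e0 -> ptime e1 ->
  ptime (fun x : G * seq A => if x.2 is a :: l then e1 (x.1, (a, l)) else e0 x.1).
Proof.
case=> p0 [k0 h0] [p1 [k1 h1]].
apply: (@ptimeI _ _ _ _ _ (fun b => Seq (Pop (b + 0))
  (Seq (take_tree (b + 0) (b + 2) (b + 3) (b + 1))
  (Case (b + 0) (Seq (mov (b + 1) (b + 0) (b + 2)) (Seq (Push (b + 0) true) (p1 (b + 0))))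
    (Seq (clear (b + 0)) (Seq (mov (b + 1) (b + 0) (b + 2)) (p0 (b + 0)))) Skip)))
  (fun n => 100 * (n + 1) + bound k0 n + bound k1 n)); first by poly_bound.
move=> s b [g [|a l]].
- stp [:: word_of g ++ word_of ([::] : seq A)] stack_pop.
  stp [:: word_of ([::] : seq A); word_of g] stack_take_tree.
  apply: stack_caseF => //.
  stp [:: [::]; word_of g] stack_clear.
  stp [:: word_of g] stack_mov.
  apply: stack_call0 => s' b'; exact: h0.
  all: try fin.
  have : bound k0 (csize g) <= bound k0 (csize (g, [::] : seq A)).
    by apply: bound_mono; rewrite csize_prod; lia.
  rewrite csize_prod; unfold csize, word_of; rewrite /=; lia.
- stp [:: word_of g ++ word_of (a :: l)] stack_pop.
  stp [:: word_of (a :: l); word_of g] stack_take_tree.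
  apply: stack_caseT => //.
  stp [:: word_of g ++ word_of (a :: l)] stack_mov.
  stp [:: word_of (g, (a, l))] stack_push.
  apply: stack_call0 => s' b'; exact: h1.
  all: try fin.
Qed.

(** Iterating a polynomial-time function can blow up the accumulator exponentially, so a bound for
    all partial folds, in terms of the whole argument, is required in advance. *)
Lemma ptime_foldl_core (h : G * (B * A) -> B) k D : ptime h ->
  let f (x : G * (B * seq A)) := foldl (fun acc a => h (x.1, (acc, a))) x.2.1 x.2.2 in
  (forall g i l1 l2, D (g, (i, l1 ++ l2)) ->
    csize (f (g, (i, l1))) <= bound k (csize (g, (i, l1 ++ l2)))) -> ptime_on D f.
Proof.
case=> p [kh hp] f hb.
(* Counted from [b], register 0 holds the rest of the list, 1 the parameter, 2 the accumulator; in 3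
   the argument of [h] is assembled, and 4 and 5 are scratch. *)
pose body b := Seq (Pop (b + 0)) (Seq (take_tree (b + 0) (b + 4) (b + 5) (b + 3))
  (Seq (mov (b + 2) (b + 3) (b + 4)) (Seq (Push (b + 3) true)
  (Seq (dup (b + 1) (b + 3) (b + 4)) (Seq (Push (b + 3) true)
  (Seq (p (b + 3)) (mov (b + 3) (b + 2) (b + 4)))))))).
pose loop b := While (b + 0) (body b) (Pop (b + 0)).
pose TB n := 100 * (n + bound k n + 1) + bound kh (n + bound k n).
have hbody s b g acc a l n : csize acc <= bound k n -> csize (h (g, (acc, a))) <= bound k n ->
    csize g + csize (a :: l) < n ->
    run (body b) (stack s b [:: word_of (a :: l); word_of g; word_of acc]) (TB n)
      (stack s b [:: word_of l; word_of g; word_of (h (g, (acc, a)))]).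
  move=> s1 s2 s3; rewrite csize_cons in s3.
  have hle : bound kh (csize (g, (acc, a))) <= bound kh (n + bound k n).
    by apply: bound_mono; rewrite !csize_prod; lia.
  rewrite /body.
  stp [:: word_of a ++ word_of l; word_of g; word_of acc] stack_pop.
  stp [:: word_of l; word_of g; word_of acc; word_of a] stack_take_tree.
  stp [:: word_of l; word_of g; [::]; word_of acc ++ word_of a] stack_mov.
  stp [:: word_of l; word_of g; [::]; word_of (acc, a)] stack_push.
  stp [:: word_of l; word_of g; [::]; word_of g ++ word_of (acc, a)] stack_dup.
  stp [:: word_of l; word_of g; [::]; word_of (g, (acc, a))] stack_push.
  stp [:: word_of l; word_of g; [::]; word_of (h (g, (acc, a)))]
    (@stack_call p s b [:: word_of l; word_of g; [::]] _ 3 _ _ erefl (fun s b => hp s b _)).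
  apply: run_post; [ apply: stack_mov => //= | stack_eq_tac].
  all: try match goal with |- is_true (_ <= ?x) => is_evar x; exact: leqnn end.
  rewrite /TB; move: hle; set X := bound kh (csize (g, (acc, a))); set Y := bound kh _.
  move=> hle; fin.
have hloop s b g i l2 : forall l1, D (g, (i, l1 ++ l2)) -> let n := csize (g, (i, l1 ++ l2)) in
    run (loop b) (stack s b [:: word_of l2; word_of g; word_of (f (g, (i, l1)))])
      (size l2 * (TB n + 2) + 4) (stack s b [:: [::]; word_of g; word_of (f (g, (i, l1 ++ l2)))]).
  elim: l2 => [|a l2 IH] l1 Dl n.
    rewrite cats0 mul0n; apply: (@stack_whileF _ _ _ _ _ _ [::] 1 _ 1) => //.
      by apply: run_post; [apply: (@stack_pop _ _ _ _ false)|].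
    exact: stack_whileE.
  have {IH} := IH (rcons l1 a); rewrite cat_rcons -/n => /(_ Dl) IH.
  have e : h (g, (f (g, (i, l1)), a)) = f (g, (i, rcons l1 a)).
    by rewrite /f /= foldl_rcons.
  rewrite /= mulSn -addnA.
  apply: stack_whileT IH => //=.
  rewrite -e; apply: hbody.
  - exact: hb.
  - by rewrite e /n -cat_rcons; apply: hb; rewrite cat_rcons.
    by rewrite /n !csize_prod; have := @csize_catr _ eA l1 (a :: l2); lia.
apply: (@ptime_onI _ _ _ _ _ _ (fun b => Seq (Pop (b + 0))
  (Seq (take_tree (b + 0) (b + 4) (b + 5) (b + 1)) (Seq (Pop (b + 0))
  (Seq (take_tree (b + 0) (b + 4) (b + 5) (b + 2)) (Seq (loop b)
  (Seq (clear (b + 1)) (mov (b + 2) (b + 0) (b + 3))))))))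
  (fun n => 100 * (n + bound k n + 1) + n * (TB n + 2))); first by rewrite /TB; poly_bound.
move=> s b [g [i l]] Dl.
stp [:: word_of g ++ word_of (i, l)] stack_pop.
stp [:: word_of (i, l); word_of g] stack_take_tree.
stp [:: word_of i ++ word_of l; word_of g] stack_pop.
stp [:: word_of l; word_of g; word_of i] stack_take_tree.
have := hloop s b g i l [::]; rewrite cat0s => /(_ Dl) R.
stp [:: [::]; word_of g; word_of (f (g, (i, l)))] R.
stp [:: [::]; [::]; word_of (f (g, (i, l)))] stack_clear.
apply: run_post; [ apply: stack_mov => //= | stack_eq_tac].
all: try match goal with |- is_true (_ <= ?x) => is_evar x; exact: leqnn end.
have := hb g i l [::]; rewrite cats0 => /(_ Dl).
set n := csize (g, _) => hf.
have : size l <= n by rewrite /n !csize_prod; have := @size_tsz _ eA l; lia.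
rewrite -(leq_pmul2r (_ : 0 < TB n + 2)) ?addn2 //.
have : n = (csize g + (csize i + csize l).+1).+1 by rewrite /n !csize_prod.
rewrite /f /= in hf *; move: (foldl _ _ _) hf => r.
move: (n * _) (size l * _) (bound k n) => X Y Z; move: n => n.
unfold csize, word_of in *; rewrite /= ?size_cat. lia.
Qed.

End lists.

Section closure.
Context {G A B C : Type} {eG : Enc G} {eA : Enc A} {eB : Enc B} {eC : Enc C}.

Lemma ptime_ext (f f' : A -> B) : ptime f -> f =1 f' -> ptime f'.
Proof. by move=> h /functional_extensionality <-. Qed.

(** Different types may share their trees: a number is a list of units, a truth value such a list of
    length at most one, a nonempty list a pair. Facts about lists and pairs carry over without any
    program. *)
Lemma ptime_recode (f : A -> B) (f' : A -> C) :
  ptime f -> (forall a, enc (f' a) = enc (f a)) -> ptime f'.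
Proof. by case=> p [k h] e; exists p, k => s b a; rewrite /word_of e; apply: h. Qed.

End closure.

Section closure2.
Context {G A B C : Type} {eG : Enc G} {eA : Enc A} {eB : Enc B} {eC : Enc C}.

Lemma ptime_lcase (l : G -> seq A) (e0 : G -> B) (e1 : G -> A -> seq A -> B) :
  ptime l -> ptime e0 -> ptime (fun x : G * (A * seq A) => e1 x.1 x.2.1 x.2.2) ->
  ptime (fun g => match l g with [::] => e0 g | a :: s => e1 g a s end).
Proof.
move=> hl h0 h1; exact: (ptime_comp (ptime_lcase_core h0 h1) (ptime_pair ptime_id hl)).
Qed.

Lemma ptime_foldl (l : G -> seq A) (i : G -> B) (h : G -> B -> A -> B) :
  ptime l -> ptime i -> ptime (fun x : G * (B * A) => h x.1 x.2.1 x.2.2) ->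
  (exists k, forall g l1 l2, l g = l1 ++ l2 -> csize (foldl (h g) (i g) l1) <= bound k (csize g)) ->
  ptime (fun g => foldl (h g) (i g) (l g)).
Proof.
move=> hl hi hh [k hb].
have hc := @ptime_foldl_core _ _ _ _ _ _ _ k
  (fun x => x.2.1 = i x.1 /\ x.2.2 = l x.1) hh.
apply: (ptime_on_comp (hc _) (ptime_pair ptime_id (ptime_pair hi hl))) => //.
move=> g j l1 l2 /= [-> e]; apply: leq_trans (hb _ _ _ (esym e)) _.
by apply: bound_mono; rewrite csize_prod; lia.
Qed.

Lemma ptime_fst' (e : G -> A * B) : ptime e -> ptime (fun g => (e g).1).
Proof. exact: ptime_comp ptime_fst. Qed.
Lemma ptime_snd' (e : G -> A * B) : ptime e -> ptime (fun g => (e g).2).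
Proof. exact: ptime_comp ptime_snd. Qed.

Lemma ptime_cons (a : G -> A) (s : G -> seq A) : ptime a -> ptime s -> ptime (fun g => a g :: s g).
Proof. by move=> ha hs; apply: ptime_recode (ptime_pair ha hs) _. Qed.

End closure2.

Lemma enc_bool_nseq (b : bool) : enc b = enc (nseq b tt).
Proof. by case: b. Qed.
Lemma enc_nat_nseq (n : nat) : enc n = enc (nseq n tt).
Proof. by elim: n => //= n; rewrite /enc /= => ->. Qed.

Global Opaque ptime.
Ltac csize_lia := repeat match goal with |- context [@csize ?A ?e ?x] =>
  generalize (@csize A e x); intro end; lia.
(** Redefined below whenever new closure properties are available, so that [pt] keeps its name while
    its scope grows. *)
Ltac pt_hook := fail.
Ltac pt1 := cbv beta; lazymatch goal with
  | |- ptime (fun x => x) => exact: ptime_id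
  | |- ptime (fun _ => ?c) => exact: (ptime_const c)
  | |- ptime fst => exact: ptime_fst
  | |- ptime snd => exact: ptime_snd
  | |- ptime (fun g => (@?f g).1) => apply: (ptime_fst' (e := f))
  | |- ptime (fun g => (@?f g).2) => apply: (ptime_snd' (e := f))
  | |- ptime (fun g => (@?f g, @?h g)) => apply: (ptime_pair (f := f) (g := h))
  | |- ptime (fun g => @?f g :: @?h g) => apply: (ptime_cons (a := f) (s := h))
  | _ => first [assumption
     | match goal with H : ptime ?e |- ptime (fun x => ?e (@?f x)) => apply: (ptime_comp (g := e) (f := f) H) end
     | pt_hook]
  end.
Ltac pt := repeat pt1.

Lemma csize_cat {A} {eA : Enc A} (s t : seq A) : csize (s ++ t) + 1 = csize s + csize t.
Proof.
elim: s => [|a s IH]; first by rewrite cat0s addnC.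
by rewrite cat_cons !csize_cons !addSn -!addnA IH.
Qed.
Lemma csize_nil {A} {eA : Enc A} : csize ([::] : seq A) = 1.
Proof. by []. Qed.

Lemma ptime_if {G A : Type} {eG : Enc G} {eA : Enc A}
  (c : G -> bool) (e1 e2 : G -> A) : ptime c -> ptime e1 -> ptime e2 ->
  ptime (fun g => if c g then e1 g else e2 g).
Proof.
move=> hc h1 h2; have hc' : ptime (fun g => nseq (c g) tt).
  by apply: ptime_recode hc _ => a; rewrite enc_bool_nseq.
apply: ptime_ext (ptime_lcase hc' h2 (e1 := fun g _ _ => e1 g) _) _.
  pt.
by move=> g; case: (c g).
Qed.

Lemma ptime_rev {G A : Type} {eG : Enc G} {eA : Enc A}
  (s : G -> seq A) : ptime s -> ptime (fun g => rev (s g)).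
Proof.
move=> hs; have [k hk] := ptime_size hs.
apply: (ptime_ext (f := fun g => foldl (fun acc x => x :: acc) [::] (s g))); last first.
  move=> g; rewrite -[rev _]cats0; elim: (s g) (Nil A) => // a l IH r.
  by rewrite /= IH rev_cons cat_rcons.
apply: ptime_foldl; [exact: hs | pt | pt |].
have [l hl] : poly_bounded (fun n => bound k n + bound k n) by poly_bound.
exists l => g l1 l2 e; apply: leq_trans (hl _).
have aux : forall r : seq A, csize (foldl (fun acc x => x :: acc) r l1) <= csize l1 + csize r.
  elim: l1 {e} => [|a l1 IH] r /=; first exact: leq_addl.
  by apply: leq_trans (IH _) _; rewrite !csize_cons addnS addSn ltnS [csize a + csize l1]addnC -addnA.
apply: leq_trans (aux [::]) _; rewrite csize_nil; apply: leq_add; apply: leq_trans (hk g).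
  by rewrite e -(leq_add2r 1) csize_cat leq_add2l; apply: leq_ltn_trans (size_tsz _).
exact: leq_ltn_trans (size_tsz _).
Qed.

Lemma ptime_map {G A B : Type} {eG : Enc G} {eA : Enc A} {eB : Enc B} (l : G -> seq A) (h : G -> A -> B) : ptime l ->
  ptime (fun x : G * A => h x.1 x.2) -> ptime (fun g => [seq h g x | x <- l g]).
Proof.
move=> hl hh; apply: (ptime_ext (f := fun g => rev (foldl (fun acc x => h g x :: acc) [::] (l g)))).
  apply: ptime_rev; have [k hk] := ptime_size hl; have [k' hk'] := ptime_size hh.
  apply: ptime_foldl; [exact: hl | pt | |].
    apply: ptime_cons; last by pt.
    by apply: (ptime_comp (f := fun x : G * (seq B * A) => (x.1, x.2.2)) hh); pt.
  have [m hm] : poly_bounded (fun n => bound k n * (bound k' (n + bound k n + 1) + 1) + 1) by poly_bound.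
  exists m => g l1 l2 e; apply: leq_trans (hm _).
  set X := bound k' _ + 1.
  have aux : forall l3 r, (forall x, x \in map (fun x => csize x) l3 -> x <= csize (l g)) ->
      csize (foldl (fun acc x => h g x :: acc) r l3) <= size l3 * X + csize r.
    elim=> [|x l3 IH] r hx //=; rewrite mulSn -addnA.
    apply: leq_trans (IH _ _) _; first by move=> y hy; apply: hx; rewrite inE hy orbT.
    rewrite csize_cons addnCA leq_add2l -addn1 addnAC leq_add2r /X leq_add2r.
    apply: leq_trans (hk' (g, x)) _; apply: bound_mono; rewrite csize_prod -addn1 leq_add2r leq_add2l.
    by apply: leq_trans (hk _); apply: hx; rewrite inE eqxx.
  apply: leq_trans (aux _ _ _) _.
    rewrite e; elim: (l1) => // x l3 IH y; rewrite inE cat_cons csize_cons => /orP[/eqP->|/IH h'].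
      by rewrite leqW // leq_addr.
    by rewrite leqW // (leq_trans h') // leq_addl.
  rewrite csize_nil leq_add2r leq_mul2r; apply/orP; right.
  apply: leq_trans (hk g); rewrite e; apply: leq_trans (ltnW (size_tsz _)).
  by rewrite size_cat leq_addr.
move=> g; suff -> : forall s r, foldl (fun acc x => h g x :: acc) r s = catrev (map (h g) s) r.
  by rewrite catrevE cats0 revK.
by elim=> //= x s IH r; rewrite IH.
Qed.

Lemma ptime_cat {G A : Type} {eG : Enc G} {eA : Enc A}
  (s t : G -> seq A) : ptime s -> ptime t -> ptime (fun g => s g ++ t g).
Proof.
move=> hs ht; apply: (ptime_ext (f := fun g => foldl (fun acc x => x :: acc) (t g) (rev (s g)))).
  have [k hk] := ptime_size (ptime_rev hs); have [k' hk'] := ptime_size ht.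
  have [m hm] : poly_bounded (fun n => bound k n + bound k' n) by poly_bound.
  apply: ptime_foldl; [exact: ptime_rev | exact: ht | pt |].
  exists m => g l1 l2 e; apply: leq_trans (hm _).
  apply: leq_trans (leq_add (hk g) (hk' g)); rewrite e.
  have -> : forall r, foldl (fun acc x => x :: acc) r l1 = catrev l1 r.
    by elim: (l1) => //= x l IH r; apply: IH.
  have h1 : csize (catrev l1 (t g)) <= csize l1 + csize (t g).
    elim: l1 (t g) {e} => [|a l1 IH] r /=; first exact: leq_addl.
    by apply: leq_trans (IH _) _; rewrite !csize_cons addnS addSn ltnS [csize a + csize l1]addnC -addnA.
  apply: leq_trans h1 _; rewrite leq_add2r -(leq_add2r 1) csize_cat leq_add2l.
  exact: leq_ltn_trans (size_tsz _).
move=> g; have -> : forall r u, foldl (fun acc (x : A) => x :: acc) r u = catrev u r.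
  by move=> r u; elim: u r => //= x l IH r; apply: IH.
by rewrite catrevE revK.
Qed.

Lemma ptime_flatten {G A : Type} {eG : Enc G} {eA : Enc A} (s : G -> seq (seq A)) : ptime s -> ptime (fun g => flatten (s g)).
Proof.
move=> hs; have [k hk] := ptime_size hs.
apply: (ptime_ext (f := fun g => foldl (fun acc x => acc ++ x) [::] (s g))); last first.
  move=> g; suff aux : forall u r, foldl (fun acc x => acc ++ x) r u = r ++ flatten u :> seq A by rewrite aux.
  by elim=> [|x u IH] r /=; rewrite ?cats0 // IH catA.
apply: ptime_foldl; [exact: hs | pt | by apply: ptime_cat; pt |].
exists k => g l1 l2 e; apply: leq_trans (hk g); rewrite e => {e}.
have aux : forall l3 r, csize (foldl (fun acc x => acc ++ x) r l3) + 1 <= csize l3 + csize (r : seq A).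
  elim=> [|x l3 IH] r /=; first by rewrite addnC.
  apply: leq_trans (IH (r ++ x)) _; have := @csize_cat _ eA r x; rewrite csize_cons; csize_lia.
have := aux l1 [::]; rewrite csize_nil leq_add2r => h; apply: leq_trans h _.
by rewrite -(leq_add2r 1) csize_cat leq_add2l; apply: leq_ltn_trans (size_tsz _).
Qed.

Lemma ptime_nseqtt {G : Type} {eG : Enc G} (n : G -> nat) : ptime n -> ptime (fun g => nseq (n g) tt).
Proof. by move=> h; apply: ptime_recode h _ => a; rewrite enc_nat_nseq. Qed.

Lemma ptime_size_ {G A : Type} {eG : Enc G} {eA : Enc A} (s : G -> seq A) : ptime s -> ptime (fun g => size (s g)).
Proof.
move=> h; have h1 : ptime (fun g => [seq tt | x <- s g]) by apply: ptime_map; pt.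
apply: ptime_recode h1 _ => a; rewrite enc_nat_nseq; congr enc.
by elim: (s a) => //= x l ->.
Qed.

Lemma ptime_nseq {G A : Type} {eG : Enc G} {eA : Enc A} (n : G -> nat) (x : G -> A) : ptime n -> ptime x ->
  ptime (fun g => nseq (n g) (x g)).
Proof.
move=> hn hx; apply: (ptime_ext (f := fun g => [seq x g | _ <- nseq (n g) tt])).
  by apply: ptime_map; [exact: ptime_nseqtt | pt].
by move=> a; rewrite map_nseq.
Qed.

Lemma ptime_addn {G : Type} {eG : Enc G} (m n : G -> nat) : ptime m -> ptime n -> ptime (fun g => m g + n g).
Proof.
move=> hm hn; apply: (ptime_ext (f := fun g => size (nseq (m g) tt ++ nseq (n g) tt))).
  by apply: ptime_size_; apply: ptime_cat; apply: ptime_nseqtt.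
by move=> a; rewrite size_cat !size_nseq.
Qed.

Lemma ptime_succ {G : Type} {eG : Enc G} (m : G -> nat) : ptime m -> ptime (fun g => (m g).+1).
Proof.
move=> hm; apply: (ptime_ext (f := fun g => m g + 1)); first by apply: ptime_addn; pt.
by move=> a; rewrite addn1.
Qed.

Lemma ptime_muln {G : Type} {eG : Enc G} (m n : G -> nat) : ptime m -> ptime n -> ptime (fun g => m g * n g).
Proof.
move=> hm hn; apply: (ptime_ext (f := fun g => size (flatten [seq nseq (n g) tt | _ <- nseq (m g) tt]))).
  apply: ptime_size_; apply: ptime_flatten; apply: ptime_map; first exact: ptime_nseqtt.
  by apply: ptime_nseqtt; pt.
by move=> a; rewrite size_flatten; elim: (m a) => //= k ->; rewrite size_nseq.
Qed.

Lemma ptime_expn {G : Type} {eG : Enc G} (m : G -> nat) k : ptime m -> ptime (fun g => m g ^ k).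
Proof.
move=> hm; elim: k => [|k IH]; first exact: (ptime_const 1).
apply: (ptime_ext (f := fun g => m g * m g ^ k)); first exact: ptime_muln.
by move=> a; rewrite expnS.
Qed.

Lemma ptime_behead {G A : Type} {eG : Enc G} {eA : Enc A} (s : G -> seq A) : ptime s -> ptime (fun g => behead (s g)).
Proof.
move=> hs; apply: (ptime_ext (ptime_lcase hs (e0 := fun _ => [::]) (e1 := fun _ _ l => l) _ _)); try by pt.
Qed.

Lemma ptime_drop {G A : Type} {eG : Enc G} {eA : Enc A} (n : G -> nat) (s : G -> seq A) : ptime n -> ptime s -> ptime (fun g => drop (n g) (s g)).
Proof.
move=> hn hs; have dr : forall (m : nat) (l : seq A), foldl (fun acc _ => behead acc) l (nseq m tt) = drop m l.
  elim=> [|m IH] l /=; first by rewrite drop0.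
  by rewrite IH -drop1 drop_drop addn1.
apply: (ptime_ext (f := fun g => foldl (fun acc _ => behead acc) (s g) (nseq (n g) tt))); last by move=> g; rewrite dr.
have [k hk] := ptime_size hs.
apply: ptime_foldl; [exact: ptime_nseqtt | exact: hs | by apply: ptime_behead; pt |].
exists k => g l1 l2 e; apply: leq_trans (hk g).
have -> : l1 = nseq (size l1) tt by elim: (l1) => //= -[] l <-.
by rewrite dr -{2}(cat_take_drop (size l1) (s g)); apply: csize_catr.
Qed.

Lemma ptime_subn {G : Type} {eG : Enc G} (m n : G -> nat) : ptime m -> ptime n -> ptime (fun g => m g - n g).
Proof.
move=> hm hn; apply: (ptime_ext (f := fun g => size (drop (n g) (nseq (m g) tt)))).
  by apply: ptime_size_; apply: ptime_drop => //; apply: ptime_nseqtt.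
by move=> a; rewrite size_drop size_nseq.
Qed.

Lemma ptime_isnil {G A : Type} {eG : Enc G} {eA : Enc A} (s : G -> seq A) : ptime s -> ptime (fun g => if s g is [::] then true else false).
Proof. by move=> hs; apply: ptime_lcase => //; pt. Qed.

Lemma ptime_leq {G : Type} {eG : Enc G} (m n : G -> nat) : ptime m -> ptime n -> ptime (fun g => m g <= n g).
Proof.
move=> hm hn; have h := ptime_isnil (ptime_nseqtt (ptime_subn hm hn)).
by apply: ptime_ext h _ => a; rewrite /leq; case: (_ - _).
Qed.

Lemma ptime_andb {G : Type} {eG : Enc G} (m n : G -> bool) : ptime m -> ptime n -> ptime (fun g => m g && n g).
Proof. by move=> hm hn; apply: ptime_if => //; pt. Qed.
Lemma ptime_orb {G : Type} {eG : Enc G} (m n : G -> bool) : ptime m -> ptime n -> ptime (fun g => m g || n g).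
Proof. by move=> hm hn; apply: ptime_if => //; pt. Qed.
Lemma ptime_implb {G : Type} {eG : Enc G} (m n : G -> bool) : ptime m -> ptime n -> ptime (fun g => m g ==> n g).
Proof. by move=> hm hn; apply: ptime_if => //; pt. Qed.
Lemma ptime_negb {G : Type} {eG : Enc G} (m : G -> bool) : ptime m -> ptime (fun g => ~~ m g).
Proof. by move=> hm; apply: ptime_if => //; pt. Qed.
Lemma ptime_eqn {G : Type} {eG : Enc G} (m n : G -> nat) : ptime m -> ptime n -> ptime (fun g => m g == n g).
Proof.
move=> hm hn; apply: (ptime_ext (f := fun g => (m g <= n g) && (n g <= m g))).
  by apply: ptime_andb; apply: ptime_leq.
by move=> a; rewrite eqn_leq.
Qed.
Lemma ptime_eqb {G : Type} {eG : Enc G} (m n : G -> bool) : ptime m -> ptime n -> ptime (fun g => m g == n g).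
Proof.
move=> hm hn; apply: (ptime_ext (f := fun g => if m g then n g else ~~ n g)).
  by apply: ptime_if => //; apply: ptime_negb.
by move=> a; case: (m a); case: (n a).
Qed.

Lemma ptime_filter {G A : Type} {eG : Enc G} {eA : Enc A} (s : G -> seq A) (p : G -> A -> bool) : ptime s ->
  ptime (fun x : G * A => p x.1 x.2) -> ptime (fun g => [seq x <- s g | p g x]).
Proof.
move=> hs hp; apply: (ptime_ext (f := fun g => flatten [seq if p g x then [:: x] else [::] | x <- s g])).
  by apply: ptime_flatten; apply: ptime_map => //; apply: ptime_if => //; pt.
by move=> g; elim: (s g) => //= x l ->; case: (p g x).
Qed.

Lemma ptime_all {G A : Type} {eG : Enc G} {eA : Enc A} (s : G -> seq A) (p : G -> A -> bool) : ptime s ->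
  ptime (fun x : G * A => p x.1 x.2) -> ptime (fun g => all (p g) (s g)).
Proof.
move=> hs hp; have h : ptime (fun g => [seq x <- s g | ~~ p g x]).
  by apply: ptime_filter hs _; apply: ptime_negb.
apply: ptime_ext (ptime_isnil h) _ => g /=; by elim: (s g) => //= x l <-; case: (p g x).
Qed.

Lemma ptime_has {G A : Type} {eG : Enc G} {eA : Enc A} (s : G -> seq A) (p : G -> A -> bool) : ptime s ->
  ptime (fun x : G * A => p x.1 x.2) -> ptime (fun g => has (p g) (s g)).
Proof.
move=> hs hp; apply: (ptime_ext (f := fun g => ~~ all (fun x => ~~ p g x) (s g))).
  by apply: ptime_negb; apply: ptime_all hs _; apply: ptime_negb.
by move=> g; rewrite -has_predC; apply: eq_has => x /=; rewrite negbK.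
Qed.

Lemma ptime_head {G A : Type} {eG : Enc G} {eA : Enc A} (x : G -> A) (s : G -> seq A) : ptime x -> ptime s -> ptime (fun g => head (x g) (s g)).
Proof. by move=> hx hs; apply: ptime_lcase => //; pt. Qed.

Lemma ptime_nth {G A : Type} {eG : Enc G} {eA : Enc A} (x : G -> A) (s : G -> seq A) (n : G -> nat) : ptime x -> ptime s -> ptime n ->
  ptime (fun g => nth (x g) (s g) (n g)).
Proof.
move=> hx hs hn; apply: (ptime_ext (f := fun g => head (x g) (drop (n g) (s g)))).
  by apply: ptime_head => //; apply: ptime_drop.
by move=> g; rewrite -nth0 nth_drop addn0.
Qed.

Lemma ptime_take {G A : Type} {eG : Enc G} {eA : Enc A} (n : G -> nat) (s : G -> seq A) : ptime n -> ptime s -> ptime (fun g => take (n g) (s g)).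
Proof.
move=> hn hs; apply: (ptime_ext (f := fun g => rev (drop (size (s g) - n g) (rev (s g))))).
  by apply: ptime_rev; apply: ptime_drop; [apply: ptime_subn => //; apply: ptime_size_|apply: ptime_rev].
move=> g; rewrite drop_rev revK; case: (leqP (n g) (size (s g))) => h.
  by rewrite subKn.
by rewrite !take_oversize //; move: (n g) (size _) h => *; lia.
Qed.

Lemma ptime_rot {G A : Type} {eG : Enc G} {eA : Enc A} (n : G -> nat) (s : G -> seq A) : ptime n -> ptime s -> ptime (fun g => rot (n g) (s g)).
Proof. by move=> hn hs; apply: ptime_cat; [apply: ptime_drop|apply: ptime_take]. Qed.

Lemma csize_nats (l : seq nat) n : (forall x, x \in l -> x <= n) -> csize l <= size l * (n.*2 + 2) + 1.
Proof.
elim: l => [|x l IH] h //=; rewrite csize_cons csize_nat.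
have := IH (fun y hy => h y (mem_behead (s := x :: l) hy)).
have : x.*2 <= n.*2 by rewrite leq_double h // mem_head.
move: (csize _) => z; rewrite mulSn; move: (_ * _) => *; lia.
Qed.

Lemma ptime_iota {G : Type} {eG : Enc G} (m n : G -> nat) : ptime m -> ptime n -> ptime (fun g => iota (m g) (n g)).
Proof.
move=> hm hn.
have fe : forall a (l : seq unit) r, foldl (fun acc _ => size acc + a :: acc) r l =
   rev (iota (size r + a) (size l)) ++ r.
  move=> a; elim=> [|x l IH] r //=; rewrite IH /= rev_cons cat_rcons; by rewrite addSn.
apply: (ptime_ext (f := fun g => rev (foldl (fun acc _ => size acc + m g :: acc) [::] (nseq (n g) tt)))); last first.
  by move=> g; rewrite fe cats0 revK size_nseq.
apply: ptime_rev; have [k hk] := ptime_size hm; have [k' hk'] := ptime_size hn.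
apply: ptime_foldl; [exact: ptime_nseqtt | pt | |].
  by apply: ptime_cons; [apply: ptime_addn; [apply: ptime_size_|]|]; pt; apply: (ptime_comp (f := fst) hm); pt.
have [j hj] : poly_bounded (fun n => bound k' n * ((bound k n + bound k' n) + (bound k n + bound k' n) + 2) + 1) by poly_bound.
exists j => g l1 l2 e; apply: leq_trans (hj _).
have {e} sl : size l1 <= bound k' (csize g).
  apply: leq_trans (hk' g); rewrite csize_nat -(size_nseq (n g) tt) e size_cat -addnn -addSn.
  by rewrite -addnA -addnA leq_addr || lia.
have sm : m g <= bound k (csize g) by apply: leq_trans (hk g); rewrite csize_nat -addnn; lia.
rewrite fe cats0; apply: leq_trans (csize_nats (n := bound k (csize g) + bound k' (csize g)) _) _.
  by move=> x; rewrite mem_rev mem_iota /= add0n => /andP[_ h]; lia.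
rewrite size_rev size_iota addnn leq_add2r leq_mul2r sl orbT //.
Qed.

Ltac pt_base := lazymatch goal with
  | |- ptime (fun g => [seq @?h g x | x <- @?l g]) => apply: (ptime_map (l := l) (h := h))
  | |- ptime (fun g => [seq x <- @?l g | @?h g x]) => apply: (ptime_filter (s := l) (p := h))
  | |- ptime (fun g => all (@?h g) (@?l g)) => apply: (ptime_all (s := l) (p := h))
  | |- ptime (fun g => has (@?h g) (@?l g)) => apply: (ptime_has (s := l) (p := h))
  | |- ptime (fun g => rev (@?l g)) => apply: (ptime_rev (s := l))
  | |- ptime (fun g => flatten (@?l g)) => apply: (ptime_flatten (s := l))
  | |- ptime (fun g => size (@?l g)) => apply: (ptime_size_ (s := l))
  | |- ptime (fun g => behead (@?l g)) => apply: (ptime_behead (s := l))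
  | |- ptime (fun g => @?a g ++ @?b g) => apply: (ptime_cat (s := a) (t := b))
  | |- ptime (fun g => @?a g + @?b g) => apply: (ptime_addn (m := a) (n := b))
  | |- ptime (fun g => @?a g * @?b g) => apply: (ptime_muln (m := a) (n := b))
  | |- ptime (fun g => @?a g - @?b g) => apply: (ptime_subn (m := a) (n := b))
  | |- ptime (fun g => expn (@?a g) ?k) => apply: (ptime_expn (m := a) k)
  | |- ptime (fun g => leq (@?a g) (@?b g)) => apply: (ptime_leq (m := a) (n := b))
  | |- ptime (fun g => S (@?a g)) => apply: (ptime_succ (m := a))
  | |- ptime (fun g => @eq_op Datatypes_nat__canonical__eqtype_Equality (@?a g) (@?b g)) => apply: (ptime_eqn (m := a) (n := b))
  | |- ptime (fun g => @eq_op Datatypes_bool__canonical__eqtype_Equality (@?a g) (@?b g)) => apply: (ptime_eqb (m := a) (n := b))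
  | |- ptime (fun g => @?a g && @?b g) => apply: (ptime_andb (m := a) (n := b))
  | |- ptime (fun g => @?a g || @?b g) => apply: (ptime_orb (m := a) (n := b))
  | |- ptime (fun g => @?a g ==> @?b g) => apply: (ptime_implb (m := a) (n := b))
  | |- ptime (fun g => ~~ @?a g) => apply: (ptime_negb (m := a))
  | |- ptime (fun g => nth (@?x g) (@?s g) (@?n g)) => apply: (ptime_nth (x := x) (s := s) (n := n))
  | |- ptime (fun g => head (@?x g) (@?s g)) => apply: (ptime_head (x := x) (s := s))
  | |- ptime (fun g => take (@?n g) (@?s g)) => apply: (ptime_take (s := s) (n := n))
  | |- ptime (fun g => drop (@?n g) (@?s g)) => apply: (ptime_drop (s := s) (n := n))
  | |- ptime (fun g => rot (@?n g) (@?s g)) => apply: (ptime_rot (s := s) (n := n))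
  | |- ptime (fun g => iota (@?n g) (@?s g)) => apply: (ptime_iota (m := n) (n := s))
  | |- ptime (fun g => nseq (@?n g) (@?s g)) => apply: (ptime_nseq (n := n) (x := s))
  | _ => apply: ptime_if
  end.
Ltac pt_hook ::= pt_base.

(** * Simulation by Turing machines *)

Section tapes.
Variable X : finType.
Implicit Types t u : tape X.

(** Both halves are compared as if padded with blanks, since moving the head may add or drop
    explicit blanks at their ends. *)
Definition teq t u :=
  (forall i, nth None t.1 i = nth None u.1 i) /\ (forall i, nth None t.2 i = nth None u.2 i).

Lemma teq_scan t u : teq t u -> scan t = scan u.
Proof. by case=> _ h; rewrite /scan -!nth0 h. Qed.

Lemma teq_act t u a : teq t u -> teq (act t a) (act u a).
Proof.
case=> h1 h2; rewrite /act; case: a.2; split=> -[|i] //=;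
  by rewrite -?nth0 ?nth_behead ?h1 ?h2 //; case: i => [|i]; rewrite /= ?nth_behead ?h1 ?h2.
Qed.

Lemma lead_teq (r r' : seq (symbol X)) :
  (forall i, nth None r i = nth None r' i) -> leading_bits r = leading_bits r'.
Proof.
elim: r r' => [|x r IH] [|y r'] h //=.
- by have := h 0; rewrite /= => <-.
- by have := h 0; rewrite /= => ->.
by have := h 0; rewrite /= => ->; rewrite (IH r') // => i; have := h i.+1.
Qed.

Lemma leading_tape_of (w : seq bool) : leading_bits (tape_of X w).2 = w.
Proof. by elim: w => //= b w; rewrite /tape_of /= => ->. Qed.

(* What is tracked of a tape: nothing for [k = 0], its leading bits for
   [k = 1], its whole content for [k > 1]. *)
Definition rep (k : nat) t (w : seq bool) :=
  (0 < k -> leading_bits t.2 = w) /\ (1 < k -> teq t (tape_of X w)).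

Lemma rep_noop k t w : rep k t w -> rep k (act t (scan t, MoveN)) w.
Proof.
case: t => l r [h1 h2]; split=> hk.
  by rewrite -(h1 hk) /act /scan /=; case: (r) => [|[[]|]].
have [e1 e2] := h2 hk; split=> i; rewrite -?e1 -?e2 //.
by rewrite /act /scan /=; case: (r) => [|x r']; case: i => [|[|i]].
Qed.

(** The cell is erased before it is left, so that everything to the left of the head remains blank
    and the tape is again exact. *)
Lemma rep_pop k t b w : 0 < k -> rep k t (b :: w) -> rep k (act t (None, MoveR)) w.
Proof.
case: t => l r k0 [h1 h2]; have := h1 k0; rewrite /rep /act /=.
case: r {h1} h2 => [|[[b'|x]|] r] //= h2 [eb e]; split=> // hk.
have [e1 e2] := h2 hk; split=> [[|i]|i] //=; last exact: (e2 i.+1).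
by rewrite (e1 i) nth_nil.
Qed.

Lemma rep_push k t b w : rep k t w ->
  rep k (act (act t (scan t, MoveL)) (Some (inl b), MoveN)) (b :: w).
Proof.
case: t => l r [h1 h2]; split=> hk.
  by rewrite -(h1 hk) /act /scan /=; case: (r) => [|[[]|]].
have [e1 e2] := h2 hk; split=> [i|[|i]] //=; first by rewrite nth_behead e1 !nth_nil.
by rewrite -(e2 i) /scan /=; case: (r) => [|x r']; case: i => [|[|i]].
Qed.

Lemma rep_scan k t w : 0 < k -> rep k t w ->
  match scan t with Some (inl b) => exists w', w = b :: w' | _ => w = [::] end.
Proof.
move=> k0 [h1 _]; have := h1 k0; rewrite /scan.
by case: t.2 => [|[[b|x]|] r] //= <-; exists (leading_bits r).
Qed.
End tapes.

(* [IRun] runs the embedded machine [M] to completion; all other instructions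
   act on the tapes as on registers. *)
Inductive instr :=
| ILeft of nat | IWrite of nat & bool | IPop of nat
| ICase of nat & nat & nat & nat | IRun.

(** Addresses are absolute, with [pc] that of the first instruction. [ICase 0 e e e] is an
    unconditional jump: whatever register 0 holds, the target is [e]. *)
Fixpoint assemble (p : prog) (pc : nat) : seq instr :=
  match p with
  | Skip => [::]
  | Push i b => [:: ILeft i; IWrite i b]
  | Pop i => [:: IPop i]
  | Seq p q => let c := assemble p pc in c ++ assemble q (pc + size c)
  | Case i p1 p0 pe =>
      let c1 := assemble p1 pc.+1 in
      let a0 := (pc.+1 + size c1).+1 in let c0 := assemble p0 a0 in
      let ae := (a0 + size c0).+1 in let ce := assemble pe ae in
      let e := ae + size ce in
      ICase i pc.+1 a0 ae :: c1 ++ ICase 0 e e e :: c0 ++ ICase 0 e e e :: ce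
  | While i p1 p0 =>
      let c1 := assemble p1 pc.+1 in
      let a0 := (pc.+1 + size c1).+1 in let c0 := assemble p0 a0 in
      let e := (a0 + size c0).+1 in
      ICase i pc.+1 a0 e :: c1 ++ ICase 0 pc pc pc :: c0 ++ [:: ICase 0 pc pc pc]
  end.

Fixpoint regs_le (n : nat) (p : prog) : bool :=
  match p with
  | Skip => true
  | Push i _ | Pop i => i <= n
  | Seq p q => regs_le n p && regs_le n q
  | Case i p1 p0 pe => [&& i <= n, regs_le n p1, regs_le n p0 & regs_le n pe]
  | While i p1 p0 => [&& i <= n, regs_le n p1 & regs_le n p0]
  end.

Lemma regs_le_ex (p : prog) : exists n, forall m, n <= m -> regs_le m p.
Proof.
elim: p => [|i b|i|p [m hm] q [n hn]|i p [m hm] q [n hn] r [k hk]|i p [m hm] q [n hn]].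
- by exists 0.
- by exists i.
- by exists i.
- by exists (m + n) => l h /=; rewrite hm ?hn //; lia.
- by exists (i + m + n + k) => l h /=; rewrite hm ?hn ?hk ?andbT //; lia.
- by exists (i + m + n) => l h /=; rewrite hm ?hn ?andbT //; lia.
Qed.

Section machine.
Variables (M : machine) (prg : seq instr) (N : nat).

(** Tape [N] is at once register [N] and the input/output tape of [M]; the work tapes of [M] follow
    it. A state is a program counter together with, while [M] is running, a state of [M]. *)
Let nt := N + work_tapes M.
Let L := size prg.
Let st : finType := ('I_L.+1 * option (state M))%type.
Let sy := symbol (aux M).

Definition stay (sc : nt.+1.-tuple sy) (i : nat) : sy * move := (nth None sc i, MoveN).

Definition tm_delta (s : st) (sc : nt.+1.-tuple sy) : st * nt.+1.-tuple (sy * move) :=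
  match s.2 with
  | Some q =>
      if halting q then ((inord s.1.+1, None), [tuple stay sc i | i < nt.+1])
      else let d := delta q [tuple nth None sc (N + j) | j < (work_tapes M).+1] in
        ((s.1, Some d.1), [tuple if N <= i then nth (None, MoveN) d.2 (i - N) else stay sc i | i < nt.+1])
  | None =>
      match nth IRun prg s.1 with
      | ILeft r => ((inord s.1.+1, None),
           [tuple if i == r :> nat then (nth None sc i, MoveL) else stay sc i | i < nt.+1])
      | IWrite r b => ((inord s.1.+1, None),
           [tuple if i == r :> nat then (Some (inl b), MoveN) else stay sc i | i < nt.+1])
      | IPop r => ((inord s.1.+1, None),
           [tuple if i == r :> nat then (None, MoveR) else stay sc i | i < nt.+1])
      | ICase r a1 a0 ae =>
          ((inord (match nth None sc r with
                   | Some (inl b) => if b then a1 else a0 | _ => ae end), None),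
           [tuple stay sc i | i < nt.+1])
      | IRun => ((s.1, Some (start M)), [tuple stay sc i | i < nt.+1])
      end
  end.

Definition tm_halting (s : st) : bool := (s.1 == L :> nat) && (s.2 == None).

Definition tm : machine := @Machine st (aux M) nt (ord0, None) tm_halting tm_delta.

Definition at_ (kd : nat -> nat) pc (s : store) (c : config tm) :=
  [/\ c.1.1 = pc :> nat, c.1.2 = None &
      forall i : 'I_nt.+1, rep (kd i) (tnth c.2 i) (s i)].

Lemma nth_scans (c : config tm) (i : 'I_nt.+1) :
  nth None (map_tuple (@scan (aux M)) c.2) i = scan (tnth c.2 i).
Proof. by rewrite -tnth_nth tnth_map. Qed.

Lemma stepE (c : config tm) : ~~ tm_halting c.1 ->
  let d := tm_delta c.1 (map_tuple (@scan (aux M)) c.2) in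
  (step c).1 = d.1 /\ forall i, tnth (step c).2 i = act (tnth c.2 i) (tnth d.2 i).
Proof. by rewrite /step /= => /negbTE ->; split => // i; rewrite tnth_mktuple. Qed.

Lemma at_nh kd pc s c : at_ kd pc s c -> pc < L -> ~~ tm_halting c.1.
Proof. by case=> e1 e2 _ h; rewrite /tm_halting e1 (ltn_eqF h). Qed.

Lemma at_case kd pc s c r a1 a0 ae : at_ kd pc s c -> pc < L ->
  nth IRun prg pc = ICase r a1 a0 ae -> r <= nt -> 0 < kd r ->
  maxn a1 (maxn a0 ae) <= L ->
  at_ kd (match s r with true :: _ => a1 | false :: _ => a0 | _ => ae end) s (step c).
Proof.
move=> A lt e rn kr le; have [] := stepE (at_nh A lt); case: A => e1 e2 h.
rewrite /tm_delta e2 e1 e /= => es et; split; rewrite ?es //=; last first.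
  by move=> i; rewrite et tnth_mktuple /stay nth_scans; apply: rep_noop.
have hr : r < nt.+1 by [].
rewrite (nth_scans c (Ordinal hr)); have := rep_scan _ (h (Ordinal hr)) => /(_ kr).
have [l1 l2 l3] : [/\ a1 < L.+1, a0 < L.+1 & ae < L.+1].
  by rewrite !geq_max in le; case/and3P: le; split.
case: (scan _) => [[[] | x] | ] /=; first by case=> w ->; rewrite inordK.
- by case=> w ->; rewrite inordK.
- by move=> ->; rewrite inordK.
by move=> ->; rewrite inordK.
Qed.

Lemma at_pop kd pc s c r b w : at_ kd pc s c -> pc < L ->
  nth IRun prg pc = IPop r -> 0 < kd r -> s r = b :: w ->
  at_ kd pc.+1 (update s r w) (step c).
Proof.
move=> A lt e kr er; have [] := stepE (at_nh A lt); case: A => e1 e2 h.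
rewrite /tm_delta e2 e1 e /= => es et; split; rewrite ?es //= ?inordK //.
move=> i; rewrite et tnth_mktuple /update; case: eqP => [ei|_].
  by apply: (@rep_pop _ _ _ b); rewrite ei // -er -ei.
by rewrite /stay nth_scans; apply: rep_noop.
Qed.

Lemma at_push kd pc s c r b : at_ kd pc s c -> pc.+1 < L ->
  nth IRun prg pc = ILeft r -> nth IRun prg pc.+1 = IWrite r b ->
  at_ kd pc.+2 (update s r (b :: s r)) (step (step c)).
Proof.
move=> A lt e e'; have [] := stepE (at_nh A (ltnW lt)); case: A => e1 e2 h.
rewrite /tm_delta e2 e1 e /= => es et.
have A' : at_ (fun _ => 0) pc.+1 s (step c).
  by rewrite /at_ es /= inordK ?ltnS ?(ltnW lt) //; split => // i; split.
have [] := stepE (at_nh A' lt); case: A' => e1' e2' _.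
rewrite /tm_delta e2' e1' e' /= => es' et'; split; rewrite ?es' //= ?inordK //.
move=> i; rewrite et' et !tnth_mktuple /update /stay !nth_scans et tnth_mktuple nth_scans.
case: eqP => [ei|_]; last by apply: rep_noop; rewrite /stay nth_scans; apply: rep_noop.
by rewrite -ei; apply: rep_push.
Qed.

Definition code_at pc c := exists post, drop pc prg = c ++ post.

Lemma code_at_cat pc c1 c2 : code_at pc (c1 ++ c2) -> code_at pc c1 /\ code_at (pc + size c1) c2.
Proof.
case=> post e; split; first by exists (c2 ++ post); rewrite e catA.
by exists post; rewrite addnC -drop_drop e -catA drop_size_cat.
Qed.

Lemma code_at_cons pc i c : code_at pc (i :: c) ->
  [/\ nth IRun prg pc = i, pc < L & code_at pc.+1 c].
Proof.
case=> post e; split; first by rewrite -[pc]addn0 -nth_drop e.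
  by rewrite -subn_gt0 -size_drop e.
by exists post; rewrite -add1n -drop_drop e /= drop0.
Qed.

Lemma code_at_size pc c : code_at pc c -> pc <= L -> pc + size c <= L.
Proof.
by case=> post e h; have := congr1 size e; rewrite size_drop size_cat -/L; lia.
Qed.

(** The precision [kd] varies between the two uses. Before the call of [M] it is 2: tapes must match
    exactly. Afterwards it is 1 on the registers, as the output of [M] is known only by its leading
    bits, and 0 on the work tapes. Tests and pops need no more than a positive value. *)
Lemma exec_tm p s t s' : exec p s t s' -> forall kd pc c,
  (forall r, r <= N -> 0 < kd r) -> regs_le N p -> pc <= L ->
  code_at pc (assemble p pc) -> at_ kd pc s c ->
  at_ kd (pc + size (assemble p pc)) s' (iter t (@step tm) c).
Proof.
have rnt r : r <= N -> r <= nt by move=> h; apply: leq_trans h (leq_addr _ _).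
elim=> {p s t s'}.
- by move=> s kd pc c _ _ _ _ A; rewrite /= addn0.
- move=> i b s kd pc c hk /= hr _ /code_at_cons[e l] /code_at_cons[e' l' _] A.
  by rewrite addn2; apply: at_push.
- move=> i b w s es kd pc c hk /= hr _ /code_at_cons[e l _] A.
  by rewrite addn1; apply: at_pop es => //; apply: hk.
- move=> p q s t s' t' s'' _ IH1 _ IH2 kd pc c hk /= /andP[hp hq] hl /code_at_cat[c1 c2] A.
  rewrite [t + t']addnC iterD size_cat addnA; apply: IH2 => //; last exact: IH1.
  exact: code_at_size.
- move=> i p1 p0 pe w s t s' es _ IH kd pc c hk /= /and4P[hi h1 h0 he] hl.
  set c1 := assemble p1 _; set a0 := (pc.+1 + size c1).+1; set c0 := assemble p0 _; set ae := (a0 + size c0).+1.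
  set ce := assemble pe _ => /code_at_cons[e l] /code_at_cat[k1] /code_at_cons[e' l'].
  move=> /code_at_cat[k0] /code_at_cons[e'' l'' ke] A.
have lae : ae + size ce <= L by have := code_at_size ke l''.
  have A1 : at_ kd pc.+1 s (step c).
    have := at_case A l e (rnt _ hi) (hk _ hi); rewrite es; apply.
    by rewrite !geq_max l /=; apply/andP; split; lia.
  have := IH kd pc.+1 _ hk h1 l k1 A1 => A2.
  have := at_case A2 l' e' (rnt _ (leq0n _)) (hk _ (leq0n _)) => A3.
  rewrite -(iterS t) iterSr.
  rewrite (_ : pc + _ = ae + size ce); last by rewrite /= !size_cat /= size_cat /= /ae /a0; lia.
  have := A3; rewrite !maxnn lae => /(_ isT); by case: (s' 0) => [|[]].
- move=> i p1 p0 pe w s t s' es _ IH kd pc c hk /= /and4P[hi h1 h0 he] hl.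
  set c1 := assemble p1 _; set a0 := (pc.+1 + size c1).+1; set c0 := assemble p0 _; set ae := (a0 + size c0).+1.
  set ce := assemble pe _ => /code_at_cons[e l] /code_at_cat[k1] /code_at_cons[e' l'].
  move=> /code_at_cat[k0] /code_at_cons[e'' l'' ke] A.
  have lae : ae + size ce <= L by have := code_at_size ke l''.
  have A1 : at_ kd a0 s (step c).
    have := at_case A l e (rnt _ hi) (hk _ hi); rewrite es; apply.
    by rewrite !geq_max l /=; apply/andP; split; lia.
  have := IH kd a0 _ hk h0 l' k0 A1 => A2.
  have := at_case A2 l'' e'' (rnt _ (leq0n _)) (hk _ (leq0n _)) => A3.
  rewrite -(iterS t) iterSr.
  rewrite (_ : pc + _ = ae + size ce); last by rewrite /= !size_cat /= size_cat /= /ae /a0; lia.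
  have := A3; rewrite !maxnn lae => /(_ isT); by case: (s' 0) => [|[]].
- move=> i p1 p0 pe s t s' es _ IH kd pc c hk /= /and4P[hi h1 h0 he] hl.
  set c1 := assemble p1 _; set a0 := (pc.+1 + size c1).+1; set c0 := assemble p0 _; set ae := (a0 + size c0).+1.
  set ce := assemble pe _ => /code_at_cons[e l] /code_at_cat[k1] /code_at_cons[e' l'].
  move=> /code_at_cat[k0] /code_at_cons[e'' l'' ke] A.
  have lae : ae + size ce <= L by have := code_at_size ke l''.
  have A1 : at_ kd ae s (step c).
    have := at_case A l e (rnt _ hi) (hk _ hi); rewrite es; apply.
    by rewrite !geq_max l /=; apply/andP; split; lia.
  have := IH kd ae _ hk he l'' ke A1.
  by rewrite -(iterS t) iterSr (_ : pc + _ = ae + size ce) //= !size_cat /= size_cat /= /ae /a0; lia.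
- move=> i p1 p0 w s t s' t' s'' es _ IH _ IHW kd pc c hk hr hl hc A.
  move: (hr) (hc) => /= /and3P[hi h1 h0].
  set c1 := assemble p1 _; set a0 := (pc.+1 + size c1).+1; set c0 := assemble p0 _; set ee := (a0 + size c0).+1.
  move=> /code_at_cons[e l] /code_at_cat[k1] /code_at_cons[e' l'].
  move=> /code_at_cat[k0] /code_at_cons[e'' l'' _].
  have A1 : at_ kd pc.+1 s (step c).
    have := at_case A l e (rnt _ hi) (hk _ hi); rewrite es; apply.
    by rewrite !geq_max l /=; apply/andP; split; lia.
  have := IH kd pc.+1 _ hk h1 l k1 A1 => A2.
  have := at_case A2 l' e' (rnt _ (leq0n _)) (hk _ (leq0n _)) => A3.
  rewrite -[step (step _)]/(iter (t.+2 + t') (@step tm) c) [t.+2 + t']addnC iterD; apply: IHW => //.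
  rewrite (_ : iter t.+2 _ _ = step (iter t (@step tm) (step c))); last by rewrite -iterSr.
  have := A3; rewrite !maxnn (ltnW l) => /(_ isT); by case: (s' 0) => [|[]].
- move=> i p1 p0 w s t s' t' s'' es _ IH _ IHW kd pc c hk hr hl hc A.
  move: (hr) (hc) => /= /and3P[hi h1 h0].
  set c1 := assemble p1 _; set a0 := (pc.+1 + size c1).+1; set c0 := assemble p0 _; set ee := (a0 + size c0).+1.
  move=> /code_at_cons[e l] /code_at_cat[k1] /code_at_cons[e' l'].
  move=> /code_at_cat[k0] /code_at_cons[e'' l'' _].
  have A1 : at_ kd a0 s (step c).
    have := at_case A l e (rnt _ hi) (hk _ hi); rewrite es; apply.
    by rewrite !geq_max l /=; apply/andP; split; lia.
  have := IH kd a0 _ hk h0 l' k0 A1 => A2.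
  have := at_case A2 l'' e'' (rnt _ (leq0n _)) (hk _ (leq0n _)) => A3.
  rewrite -[step (step _)]/(iter (t.+2 + t') (@step tm) c) [t.+2 + t']addnC iterD; apply: IHW => //.
  rewrite (_ : iter t.+2 _ _ = step (iter t (@step tm) (step c))); last by rewrite -iterSr.
  have := A3; rewrite !maxnn (ltnW l) => /(_ isT); by case: (s' 0) => [|[]].
- move=> i p1 p0 s es kd pc c hk /= /and3P[hi h1 h0] hl.
  set c1 := assemble p1 _; set a0 := (pc.+1 + size c1).+1; set c0 := assemble p0 _; set ee := (a0 + size c0).+1.
  move=> /code_at_cons[e l] /code_at_cat[k1] /code_at_cons[e' l'].
  move=> /code_at_cat[k0] /code_at_cons[e'' l'' _] A.
  have := at_case A l e (rnt _ hi) (hk _ hi); rewrite es.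
  rewrite (_ : pc + _ = ee); last by rewrite /= !size_cat /= size_cat /= /ee /a0; lia.
  by apply; rewrite !geq_max l /=; apply/andP; split; lia.
Qed.

Definition in_ pc (s : store) (d : config M) (c : config tm) :=
  [/\ c.1.1 = pc :> nat, c.1.2 = Some d.1,
      forall i : 'I_nt.+1, i < N -> rep 1 (tnth c.2 i) (s i) &
      forall (i : 'I_nt.+1) (j : 'I_(work_tapes M).+1), i = N + j :> nat ->
        teq (tnth c.2 i) (tnth d.2 j)].

Lemma iter_halting (K : machine) (d : config K) n : halting d.1 -> iter n (@step K) d = d.
Proof. by move=> h; elim: n => //= n ->; rewrite /step h. Qed.

(** [M] may halt before [t] steps, whence some [t']; one further step notices the halt and goes on
    to the next instruction. *)
Lemma in_run pc s t : pc < L -> forall d c, in_ pc s d c ->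
  halting (iter t (@step M) d).1 ->
  exists2 t', t' <= t.+1 & at_ (fun i => i <= N) pc.+1
    (fun i => if i < N then s i else output (iter t (@step M) d)) (iter t' (@step tm) c).
Proof.
move=> lt; elim: t => [|t IH] d c I hd; (case: (boolP (halting d.1)) => hh;
  [rewrite iter_halting //; exists 1 => // | try by case/negP: hh ]).
all: have nh : ~~ tm_halting c.1 by (case: I => _ e _ _; rewrite /tm_halting e andbF).
all: have [] := stepE nh.
all: case: I => e1 e2 h1 h2; rewrite /tm_delta e2 ?hh ?(negbTE hh) /=.
1,2: move=> es et; split; rewrite ?es //= ?e1 ?inordK // => i; rewrite et tnth_mktuple /stay nth_scans.
1,2: apply: rep_noop; case: (ltngtP i N) => [h|h|h]; [exact: h1 | by split |].
1,2: split=> // _; rewrite /output; apply: lead_teq; apply: (proj2 (h2 i ord0 _)).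
1,2: by rewrite addn0.
set sc := [tuple _ | j < _]; have -> : sc = map_tuple (@scan (aux M)) d.2.
  apply: eq_from_tnth => j; rewrite tnth_mktuple tnth_map.
  have hj : N + j < nt.+1 by rewrite ltnS leq_add2l -ltnS.
  by rewrite (nth_scans c (Ordinal hj)); apply: teq_scan; apply: h2.
move=> es et.
have [||t' le A] := IH (step d) (step c).
- split; rewrite ?es //; first by rewrite /step (negbTE hh).
    move=> i hi; rewrite et tnth_mktuple leqNgt hi /= /stay nth_scans.
    by apply: rep_noop; apply: h1.
  move=> i j e; rewrite et tnth_mktuple e leq_addr addKn /step (negbTE hh) /= tnth_mktuple.
  rewrite (tnth_nth (None, MoveN)); apply: teq_act; exact: h2.
- by rewrite -iterSr.
- by exists t'.+1 => //; rewrite -(iterS t) !iterSr.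
Qed.
End machine.

(* The machine runs [p1], then [M] on the contents of register [N], and
   finally [p2] with the output of [M] in register [N]. *)
Theorem tm_sandwich (M : machine) (N : nat) (p1 p2 : prog) :
  0 < N -> regs_le N p1 -> regs_le N p2 ->
  exists K : machine, forall w T1 T2 tM s1 s3,
    run p1 (update (fun _ => [::]) 0 w) T1 s1 ->
    (forall j, N < j -> s1 j = [::]) ->
    let d := iter tM (@step M) (init M (s1 N)) in
    halting d.1 ->
    run p2 (fun i => if i < N then s1 i else if i == N then output d else [::]) T2 s3 ->
    outputs_within K w (T1 + tM + T2 + 2) (s3 0).
Proof.
move=> N0 r1 r2; pose c1 := assemble p1 0; pose c2 := assemble p2 (size c1).+1.
pose prg := c1 ++ IRun :: c2; exists (tm M prg N) => w T1 T2 tM s1 s3 [t1 le1 x1] hs1 d hd [t2 le2 x2].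
have sL : size prg = (size c1).+1 + size c2 by rewrite size_cat /= addnS.
have A0 : @at_ M prg N (fun _ => 2) 0 (update (fun _ => [::]) 0 w) (init (tm M prg N) w).
  split=> // i; rewrite tnth_mktuple /update; case: eqP => [->|ne] /=.
    by split=> // _; rewrite leading_tape_of.
  by case: eqP => [e|_]; [case: ne; apply: val_inj | split].
have K1 : code_at prg 0 c1 by exists (IRun :: c2); rewrite drop0.
have K2 : code_at prg (size c1).+1 c2.
  by exists [::]; rewrite cats0 -addn1 addnC -drop_drop drop_size_cat //= drop0.
have := @exec_tm M prg N _ _ _ _ x1 (fun _ => 2) 0 _ (fun _ _ => isT) r1 (leq0n _) K1 A0.
rewrite add0n; set cc := iter t1 _ _ => A1.
have lt : size c1 < size prg by rewrite sL; lia.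
have nI : nth IRun prg (size c1) = IRun by rewrite nth_cat ltnn subnn.
have I : in_ (size c1) s1 (init M (s1 N)) (step cc).
  have [] := stepE (at_nh A1 lt); case: A1 => e1 e2 h.
  rewrite /tm_delta e2 e1 nI /= => es et; split; rewrite ?es //=.
    by move=> i hi; rewrite et tnth_mktuple /stay nth_scans; apply: rep_noop; case: (h i).
  move=> i j e; rewrite et !tnth_mktuple /stay nth_scans.
  (* [M] has to start on a genuine initial configuration, not merely on the right leading bits. Here
     the precision 2 kept so far is used: tape [N] is exact and the tapes beyond it are blank. *)
  have [_ /(_ isT) H] := rep_noop (h i).
  suff -> : (if j == ord0 then s1 N else [::]) = s1 i by [].
  rewrite e; case: eqP => [->|/eqP ne]; first by rewrite addn0.
  rewrite hs1 // -[X in X < _]addn0 ltn_add2l lt0n; apply: contra ne => /eqP z.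
  by apply/eqP/val_inj.
have [t' le' A2] := in_run lt I hd.
pose s2 := fun i => if i < N then s1 i else if i == N then output d else [::].
have A2' : @at_ M prg N (fun i => i <= N) (size c1).+1 s2 (iter t' (@step (tm M prg N)) (step cc)).
  case: A2 => e1 e2 h; split=> // i; have := h i; rewrite /s2.
  by case: (ltngtP i N) => // _ _; split.
have hk r : r <= N -> 0 < (r <= N) by move->.
have A3 := @exec_tm M prg N _ _ _ _ x2 (fun i => i <= N) _ _ hk r2 lt K2 A2'.
set tt := t2 + (t' + t1.+1).
have : at_ (fun i => i <= N) (size prg) s3 (iter tt (@step (tm M prg N)) (init (tm M prg N) w)).
  by rewrite sL /tt !iterD iterS.
case=> e1 e2 h.
have hal : @halting (tm M prg N) (iter tt (@step (tm M prg N)) (init (tm M prg N) w)).1.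
  by rewrite /= /tm_halting e1 e2 eqxx.
rewrite /outputs_within.
have -> : T1 + tM + T2 + 2 = (T1 + tM + T2 + 2 - tt) + tt by rewrite subnK // /tt; lia.
rewrite iterD iter_halting //; split=> //.
by case: (h ord0) => /(_ isT).
Qed.

(** * Conversions between plain words, unary numbers and tree codes *)

Definition wrap b := While (b + 1)
  (Seq (Pop (b + 1)) (pushs (b + 2) [:: true; true; false; false]))
  (Seq (Pop (b + 1)) (pushs (b + 2) [:: true; false])).

(** A list cell opens with [true], and the two bits have the tree codes [true false false] and
    [false]; these make up the words pushed. Cells are added in front, so the word must be given in
    reverse. *)
Lemma stack_wrap s b x (u v : seq bool) :
  run (wrap b) (stack s b [:: x; u; word_of v]) (20 * size u + 1) (stack s b [:: x; [::]; word_of (catrev u v)]).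
Proof.
elim: u v => [|a u IH] v; first by apply: run_weak (stack_whileE _ _ _ _ _) _.
have -> : 20 * size (a :: u) + 1 = (18 + 2) + (20 * size u + 1) by rewrite /=; lia.
have ps (w : seq bool) : size w <= 4 -> run (pushs (b + 2) w) (stack s b [:: x; u; word_of v]) 8 (stack s b [:: x; u; w ++ word_of v]).
  move=> hw; apply: run_post; first by apply: run_weak (exec_pushs _ _ _) _; lia.
  by rewrite stack_upd stack_get.
rewrite /=; case: a.
- apply: stack_whileT (IH (true :: v)) => //.
  stp [:: x; u; word_of v] stack_pop; first exact: (ps [:: true; true; false; false]).
  by [].
- apply: stack_whileF (IH (false :: v)) => //.
  stp [:: x; u; word_of v] stack_pop; first exact: (ps [:: true; false]).
  by [].
Qed.

Definition unwrap b := While (b + 0)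
  (Seq (Pop (b + 0)) (Case (b + 0)
     (Seq (Pop (b + 0)) (Seq (Pop (b + 0)) (Seq (Pop (b + 0)) (Push (b + 1) true))))
     (Seq (Pop (b + 0)) (Push (b + 1) false)) Skip)) (Pop (b + 0)).

Lemma stack_unwrap s b (u v : seq bool) :
  run (unwrap b) (stack s b [:: word_of u; v]) (20 * size u + 10) (stack s b [:: [::]; catrev u v]).
Proof.
elim: u v => [|a u IH] v.
  apply: run_weak (_ : run _ _ (1 + 2 + 1) _) _ => //.
  apply: (@stack_whileF _ _ _ _ _ _ [::] _ (stack s b [:: [::]; v])) => //.
    by apply: run_post; [apply: (@stack_pop _ _ _ _ false)|].
  exact: stack_whileE.
have -> : 20 * size (a :: u) + 10 = (18 + 2) + (20 * size u + 10) by rewrite /=; lia.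
case: a.
- apply: stack_whileT (IH (true :: v)) => //.
  stp [:: true :: false :: false :: word_of u; v] stack_pop.
  apply: stack_caseT => //.
  stp [:: false :: false :: word_of u; v] stack_pop.
  stp [:: false :: word_of u; v] stack_pop.
  stp [:: word_of u; v] stack_pop.
  apply: run_post; [apply: stack_push | stack_eq_tac].
  all: try fin.
- apply: stack_whileT (IH (false :: v)) => //.
  stp [:: false :: word_of u; v] stack_pop.
  apply: stack_caseF => //.
  stp [:: word_of u; v] stack_pop.
  apply: run_post; [apply: stack_push | stack_eq_tac].
  all: fin.
Qed.

Definition unum b := While (b + 1)
  (Seq (Pop (b + 1)) (Seq (Pop (b + 1)) (Push (b + 2) true))) (Pop (b + 1)).

Lemma stack_unum s b x (n : nat) v :
  run (unum b) (stack s b [:: x; word_of n; v]) (20 * n + 10) (stack s b [:: x; [::]; nseq n true ++ v]).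
Proof.
elim: n v => [|n IH] v.
  apply: run_weak (_ : run _ _ (1 + 2 + 1) _) _ => //.
  apply: (@stack_whileF _ _ _ _ _ _ [::] _ (stack s b [:: x; [::]; v])) => //.
    by apply: run_post; [apply: (@stack_pop _ _ _ _ false)|].
  exact: stack_whileE.
have -> : 20 * n.+1 + 10 = (18 + 2) + (20 * n + 10) by lia.
have -> : nseq n.+1 true ++ v = nseq n true ++ true :: v by elim: (n) => //= k ->.
apply: stack_whileT (IH (true :: v)) => //.
stp [:: x; false :: word_of n; v] stack_pop.
stp [:: x; word_of n; v] stack_pop.
apply: run_post; [apply: stack_push | stack_eq_tac].
all: fin.
Qed.

(** The code of the input is kept in register 0, out of reach of [M], for use by [post_prog];
    register [N] gets the unary number on which [M] is started. *)
Definition pre_prog (N : nat) (pg : nat -> prog) :=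
  Seq (mv (0 + 0) (0 + 1)) (Seq (Push (0 + 2) false) (Seq (wrap 0) (Seq (mov (0 + 2) (0 + 0) (0 + 3))
  (Seq (dup (0 + 0) (0 + 1) (0 + 2)) (Seq (pg (0 + 1)) (Seq (unum 0) (mv (0 + 2) N))))))).

Definition post_prog (N : nat) (ph : nat -> prog) :=
  Seq (mv N (0 + 1)) (Seq (Push (0 + 2) false) (Seq (wrap 0)
  (Seq (mov (0 + 0) (0 + 2) (0 + 3)) (Seq (mov (0 + 2) (0 + 0) (0 + 3)) (Seq (Push (0 + 0) true)
  (Seq (ph (0 + 0)) (Seq (unwrap 0) (mv (0 + 1) (0 + 0))))))))).

Lemma upd_mk0 x : update (fun _ => [::]) 0 x = stack (fun _ => [::]) 0 [:: x].
Proof.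
apply: functional_extensionality => j; rewrite /update /stack /= subn0.
by case: j => //= j; rewrite nth_nil.
Qed.

Lemma size_le_tsz (w : seq bool) : size w <= csize w.
Proof. exact: ltnW (size_tsz w). Qed.
Lemma csize_le_size (w : seq bool) : csize w <= 4 * size w + 1.
Proof.
elim: w => // b w IH; rewrite csize_cons /=.
have : csize b <= 3 by case: b.
move: (csize _) IH (csize _) => *; lia.
Qed.

Ltac sz_lia := repeat match goal with
  | |- context [bound ?a ?b] => generalize (bound a b); intro
  | |- context [size ?x] => generalize (size x); intro end; lia.
Transparent ptime.
Lemma pre_run (g : seq bool -> nat) : ptime g -> exists pg k, forall N w, 5 < N ->
  run (pre_prog N pg) (update (fun _ => [::]) 0 w) (bound k (size w))
   (update (stack (fun _ => [::]) 0 [:: word_of w]) N (unary (g w))).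
Proof.
case=> pg [kg hg]; exists pg.
have [k hk] : poly_bounded (fun n => 1000 * (n + 1) + 100 * bound kg (4 * n + 1)) by poly_bound.
exists k => N w hN; apply: run_weak (hk _); rewrite upd_mk0 /pre_prog.
have hs : csize w <= 4 * size w + 1 := csize_le_size w.
have hG := bound_mono kg hs.
have hn : (g w).*2.+1 <= csize w + bound kg (csize w).
  by rewrite -csize_nat; apply: run_size (hg (fun _ => [::]) 0 w).
stp [:: [::]; rev w] (@stack_mv1 _ _ _ _ 2).
stp [:: [::]; rev w; word_of ([::] : seq bool)] stack_push.
stp [:: [::]; [::]; word_of w] (@stack_wrap _ _ _ (rev w) [::]); first by rewrite catrevE revK cats0.
stp [:: word_of w] stack_mov.
stp [:: word_of w; word_of w] stack_dup.
stp [:: word_of w; word_of (g w); [::]] (@stack_call pg _ 0 [:: word_of w] _ 1 _ _ erefl (fun s b => hg s b w)).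
stp [:: word_of w; [::]; nseq (g w) true] (@stack_unum _ 0 (word_of w) (g w) [::]).
have N2 : 0 + 2 != N by rewrite add0n; lia.
apply: run_post.
  by apply: (@exec_mv _ _ _ (nseq (g w) true) N2); rewrite stack_get.
rewrite stack_upd /=; congr update; first by stack_eq_tac.
rewrite catrevE /stack /= subn0 nth_default ?cats0 //=; last lia.
by rewrite rev_nseq.
all: try match goal with |- is_true (_ <= ?x) => is_evar x; exact: leqnn end.
rewrite /= ?size_nseq ?size_rev.
move: hs hG hn; rewrite /csize; sz_lia.
Qed.

Lemma post_run (h : seq bool * seq bool -> seq bool) : ptime h -> exists ph k, forall N w v, 5 < N ->
  run (post_prog N ph) (update (stack (fun _ => [::]) 0 [:: word_of w]) N v) (bound k (size w + size v))
   (stack (fun _ => [::]) 0 [:: h (w, v)]).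
Proof.
case=> ph [kh hh]; exists ph.
have [k hk] : poly_bounded (fun n => 1000 * (n + 1) + 100 * bound kh (4 * n + 3)) by poly_bound.
exists k => N w v hN; apply: run_weak (hk _); rewrite /post_prog.
have hs : csize (w, v) <= 4 * (size w + size v) + 3.
  by rewrite csize_prod; have := csize_le_size w; have := csize_le_size v; lia.
have hG := bound_mono kh hs.
have hn : csize (h (w, v)) <= csize (w, v) + bound kh (csize (w, v)).
  by apply: run_size (hh (fun _ => [::]) 0 (w, v)).
have N1 : N != 0 + 1 by rewrite add0n; lia.
apply: (@run_seq _ _ _ (stack (fun _ => [::]) 0 [:: word_of w; rev v])).
  apply: run_post; first by apply: (@exec_mv _ _ _ v N1); rewrite /update eqxx.
  have -> : update (update (stack (fun=> [::]) 0 [:: word_of w]) N v) N [::] = stack (fun=> [::]) 0 [:: word_of w].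
    apply: functional_extensionality => j; rewrite /update /stack; case: eqP => // ->.
    by rewrite /= subn0 nth_default //=; lia.
  rewrite stack_upd {1}/update ifN 1?eq_sym // stack_get catrevE cats0; stack_eq_tac.
stp [:: word_of w; rev v; word_of ([::] : seq bool)] stack_push.
stp [:: word_of w; [::]; word_of v] (@stack_wrap _ _ _ (rev v) [::]); first by rewrite catrevE revK cats0.
stp [:: [::]; [::]; word_of w ++ word_of v] stack_mov.
stp [:: word_of w ++ word_of v] stack_mov.
stp [:: word_of (w, v)] stack_push.
stp [:: word_of (h (w, v)); [::]] (@stack_call ph _ 0 [::] _ 0 _ _ erefl (fun s b => hh s b (w, v))).
stp [:: [::]; rev (h (w, v))] stack_unwrap.
apply: run_post; first by apply: exec_mv; rewrite ?stack_get.
by rewrite !stack_upd stack_get /= catrevE revK; stack_eq_tac.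
all: try match goal with |- is_true (_ <= ?x) => is_evar x; exact: leqnn end.
have hh' := size_le_tsz (h (w, v)); have hw := csize_le_size w; have hv := csize_le_size v.
rewrite /= ?size_nseq ?size_rev ?size_cat.
move: hs hG hn hh' hw hv; rewrite csize_prod /csize.
sz_lia.
Qed.

Lemma horner_bnd k n : (('X + 2%:P) ^+ k : {poly nat}).[n]%R = bound k n.
Proof.
rewrite horner_exp hornerD hornerX hornerC /bound.
by elim: k => // k IH; rewrite GRing.exprS expnS IH.
Qed.

Lemma horner_mono (p : {poly nat}) m n : m <= n -> p.[m]%R <= p.[n]%R.
Proof.
move=> h; rewrite !horner_coef; apply: leq_sum => i _; rewrite leq_mul2l; apply/orP; right.
have e (x : nat) : (x ^+ i)%R = x ^ i by elim: (nat_of_ord i) => // j IH; rewrite GRing.exprS expnS IH.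
by rewrite !e; case: (nat_of_ord i) => // j; rewrite leq_exp2r.
Qed.

Lemma poly_bounded_horner (p : {poly nat}) : poly_bounded (fun n => p.[n]%R).
Proof.
elim/poly_ind: p => [|p c IH].
  by exists 0 => n; rewrite horner0.
have [k hk] := poly_bounded_add (poly_bounded_mul IH poly_bounded_id) (poly_bounded_const c).
by exists k => n; rewrite hornerD hornerC hornerM hornerX; apply: hk.
Qed.

Lemma outputs_within_mono (M : machine) w t t' v :
  outputs_within M w t v -> t <= t' -> outputs_within M w t' v.
Proof.
by rewrite /outputs_within => -[h e] le; rewrite -(subnK le) iterD iter_halting.
Qed.

Lemma polytimeI (A B : Type) (encA : A -> seq bool) (encB : B -> seq bool) (f : A -> B)
    (M : machine) T : poly_bounded T ->
  (forall a, outputs_within M (encA a) (T (size (encA a))) (encB (f a))) -> polytime encA encB f.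
Proof.
case=> k hk h; exists M, (('X + 2%:P) ^+ k)%R => a; rewrite horner_bnd.
exact: outputs_within_mono (h a) (hk _).
Qed.

(** Bounds the output of the embedded machine, which is part of the input of the second program, by
    the running time of that machine. *)
Lemma output_size (M : machine) w t v : outputs_within M w t v -> size v <= size w + 2 * t.
Proof.
case=> _ <-; rewrite /output.
have lb (X : finType) (r : seq (symbol X)) : size (leading_bits r) <= size r.
  by elim: r => [|[[b|x]|] r IH].
apply: leq_trans (lb _ _) _; elim: t => [|t IH].
  by rewrite /= tnth_mktuple /tape_of /= size_map addn0.
rewrite iterS {1}/step; case: ifP => _; first by apply: leq_trans IH _; lia.
rewrite /= tnth_mktuple; set u := tnth _ _ in IH *; set a := tnth _ _.
have : size (act u a).2 <= size u.2 + 2.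
  by rewrite /act; case: a.2 => /=; rewrite ?size_behead; lia.
lia.
Qed.

(** The common shape of the reduction and of the verifier: [g] finds the number of candidates, [f]
    is the scoring rule, known only by its machine, and [h] finishes from the input and the encoded
    score vector. *)
Theorem polytime_ptime (B : Type) (encB : B -> seq bool) (f : nat -> B)
    (g : seq bool -> nat) (h : seq bool * seq bool -> seq bool) :
  polytime unary encB f -> ptime g -> ptime h ->
  polytime id id (fun w => h (w, encB (f (g w)))).
Proof.
case=> M [pM hM] Pg Ph; have [pg [kg hg]] := pre_run Pg; have [ph [kh hh]] := post_run Ph.
have [n1 r1] := regs_le_ex (pre_prog 0 pg).
have [n2 r2] := regs_le_ex (post_prog 0 ph).
pose N := n1 + n2 + 6.
have R1 : regs_le N (pre_prog N pg).
  by have := r1 N; rewrite /pre_prog /= !leqnn; apply; lia.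
have R2 : regs_le N (post_prog N ph).
  by have := r2 N; rewrite /post_prog /= !leqnn; apply; lia.
have [K hK] := tm_sandwich M (ltn_addl _ (isT : 0 < 6)) R1 R2.
have [k0 hk0] := ptime_size Pg.
pose G n := bound k0 (4 * n + 1); have [kp hkp] := poly_bounded_horner pM.
pose TM n := bound kp (G n).
apply: (@polytimeI _ _ _ _ _ K (fun n => bound kg n + TM n + bound kh (n + (G n + 2 * TM n)) + 2)).
  by rewrite /TM /G; poly_bound.
move=> w; rewrite /id; set n := size w.
have gn : g w <= G n.
  have := leq_trans (hk0 w) (bound_mono k0 (csize_le_size w)); rewrite csize_nat -/n -/(G n); lia.
have tn : pM.[size (unary (g w))]%R <= TM n.
  by rewrite /unary size_nseq; apply: leq_trans (horner_mono pM gn) (hkp _).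
have [ha eo] := hM (g w).
have sv := output_size (hM (g w)); rewrite /unary size_nseq -/(unary _) in sv.
rewrite /unary size_nseq in tn.
set v := encB (f (g w)) in eo sv *.
have N6 : 5 < N by rewrite /N; lia.
pose s1 := update (stack (fun _ => [::]) 0 [:: @word_of _ (@enc_seq bool enc_bit) w]) N (unary (g w)).
have s1N : s1 N = unary (g w) by rewrite /s1 /update eqxx.
have := hK w _ (bound kh (n + (G n + 2 * TM n))) pM.[size (unary (g w))]%R s1
  (stack (fun _ => [::]) 0 [:: h (w, v)]) (hg N w N6); rewrite -/N.
move=> H; cbv zeta in H; rewrite s1N eo in H; apply: outputs_within_mono (H _ ha _) _.
- move=> j hj; rewrite /s1 /update gtn_eqF // /stack /= subn0 nth_default //=; lia.
- have -> : (fun i => if i < N then s1 i else if i == N then v else [::]) =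
     update (stack (fun _ => [::]) 0 [:: word_of w]) N v.
    apply: functional_extensionality => j; rewrite /s1 /update.
    case: (ltngtP j N) => // hj; rewrite /stack /= subn0 nth_default //=; lia.
  apply: run_weak (hh N w v N6) _; apply: bound_mono; rewrite -/n leq_add2l.
  by apply: leq_trans sv _; rewrite leq_add // leq_mul2l.
rewrite /unary size_nseq -/n; lia.
Qed.

Import Order.TTheory GRing.Theory Num.Theory.

(** * Votes with floating candidates *)

(* [(o, ((lo, hi), wild))]: the candidates are ranked as in [o], except that the
   ones in [wild] may be placed anywhere between the positions [lo] and [hi]. *)
Definition vspec := (seq nat * ((nat * nat) * seq nat))%type.
Definition vlo (V : vspec) u := if u \in V.2.2 then V.2.1.1 else index u V.1.
Definition vhi (V : vspec) u := if u \in V.2.2 then V.2.1.2 else index u V.1.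
(** An interval order: every candidate has an interval of positions, a single point unless it
    floats. Transitivity and antisymmetry then come for free. *)
Definition vless (V : vspec) u v := vhi V u < vlo V v.

(* [((A, B), ((W, W0), wild))]: the first vote of the group is [A ++ W ++ B], with
   [wild] floating in the window [W]; the base order is [A ++ W0 ++ B]. *)
Definition group := ((seq nat * seq nat) * ((seq nat * seq nat) * seq nat))%type.
Definition gfirst (g : group) : vspec :=
  (g.1.1 ++ g.2.1.1 ++ g.1.2, ((size g.1.1, (size g.1.1 + size g.2.1.1).-1), g.2.2)).
Definition gbase (g : group) := g.1.1 ++ g.2.1.2 ++ g.1.2.

Definition gvalid m (g : group) :=
  [/\ perm_eq (g.1.1 ++ g.2.1.1 ++ g.1.2) (iota 0 m), perm_eq g.2.1.2 g.2.1.1,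
      {subset g.2.2 <= g.2.1.1} & 0 < size g.2.1.1].

(** Relations on [nat] restricted below [m], so that candidates can be numbered by arithmetic
    expressions. The passage to ordinals is postponed to [lift_rel] and [restr]. *)
Definition linear_on m (P : rel nat) :=
  [/\ forall u v, u < m -> v < m -> P u v || P v u,
      forall u v w, u < m -> v < m -> w < m -> P u v -> P v w -> P u w &
      forall u v, u < m -> v < m -> P u v -> P v u -> u = v].

Definition extends_on m (V : vspec) (P : rel nat) :=
  forall u v, u < m -> v < m -> vless V u v -> P u v.

Definition above (P : rel nat) u := fun b => P b u && (b != u).
Definition pos m (P : rel nat) u := count (above P u) (iota 0 m).

Lemma mem_iota0 m u : (u \in iota 0 m) = (u < m).
Proof. by rewrite mem_iota. Qed.

Section position.
Variables (m : nat) (P : rel nat).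
Hypothesis hP : linear_on m P.

Lemma pos_split X Y Z u : perm_eq (X ++ Y ++ Z) (iota 0 m) -> u \in Y ->
  (forall b, b \in X -> P b u) -> (forall b, b \in Z -> P u b) ->
  pos m P u = size X + count (above P u) Y.
Proof.
case: hP => _ _ anti pe uY hX hZ; rewrite /pos -(permP pe) !count_cat.
have un : uniq (X ++ Y ++ Z) by rewrite (perm_uniq pe) iota_uniq.
have lt v : v \in X ++ Y ++ Z -> v < m by rewrite (perm_mem pe) mem_iota0.
have um : u < m by apply: lt; rewrite !mem_cat uY orbT.
move: un; rewrite cat_uniq => /and3P[_ /hasPn nX]; rewrite cat_uniq => /and3P[_ /hasPn nZ _].
have -> : count (above P u) X = size X.
  apply/eqP; rewrite -all_count; apply/allP => b bX; rewrite /above hX //=.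
  apply: contraTneq bX => ->; apply: nX; by rewrite mem_cat uY.
have -> : count (above P u) Z = 0.
  apply/eqP; rewrite eqn0Ngt -has_count -all_predC; apply/allP => b bZ.
  rewrite /= /above negb_and negbK; case: eqP => [_|ne]; first by rewrite orbT.
  rewrite orbF; apply/negP => bu; apply: ne; apply: anti => //; last exact: hZ.
  by apply: lt; rewrite !mem_cat bZ !orbT.
by rewrite addn0.
Qed.

Lemma P_asym u v : u < m -> v < m -> u != v -> P u v = ~~ P v u.
Proof.
case: hP => tot _ anti um vm /eqP ne; have := tot _ _ um vm.
by case: (boolP (P u v)); case: (boolP (P v u)) => // h1 h2 _; case: ne; apply: anti.
Qed.
End position.

Section group.
Variables (m : nat) (g : group).
Hypothesis hg : gvalid m g.

Lemma gmem u : u < m -> [|| u \in g.1.1, u \in g.2.1.1 | u \in g.1.2].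
Proof. by case: hg => pe _ _ _; rewrite -!mem_cat (perm_mem pe) mem_iota0. Qed.

Lemma glt u : u \in g.2.1.1 -> u < m.
Proof.
by case: hg => pe _ _ _ h; have := perm_mem pe u; rewrite mem_iota0 !mem_cat h orbT => <-.
Qed.

Lemma guniq : uniq (g.1.1 ++ g.2.1.1 ++ g.1.2).
Proof. by case: hg => pe _ _ _; rewrite (perm_uniq pe) iota_uniq. Qed.

Lemma gdisj u : u \in g.2.1.1 -> (u \notin g.1.1) && (u \notin g.1.2).
Proof.
have := guniq; rewrite cat_uniq => /and3P[_ /hasPn n1]; rewrite cat_uniq => /and3P[_ /hasPn n2 _] h.
by rewrite n1 ?mem_cat ?h //; apply/negP => /n2; rewrite /= h.
Qed.

Lemma vlo_W u : u \in g.2.1.1 ->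
  size g.1.1 <= vlo (gfirst g) u /\ vhi (gfirst g) u < size g.1.1 + size g.2.1.1.
Proof.
move=> h; have /andP[n1 n2] := gdisj h; case: hg => _ _ _ s0.
rewrite /vlo /vhi /=; case: ifP => _; first by split => //; lia.
rewrite index_cat (negbTE n1) index_cat h; split; first exact: leq_addr.
by rewrite ltn_add2l index_mem.
Qed.

Lemma vless_W u v : u \in g.2.1.1 -> v \in g.2.1.1 -> u \notin g.2.2 -> v \notin g.2.2 ->
  vless (gfirst g) u v = (index u g.2.1.1 < index v g.2.1.1).
Proof.
move=> hu hv nu nv; have /andP[n1 _] := gdisj hu; have /andP[n2 _] := gdisj hv.
rewrite /vless /vlo /vhi /= (negbTE nu) (negbTE nv) !index_cat (negbTE n1) (negbTE n2) hu hv.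
by rewrite ltn_add2l.
Qed.

Lemma nwild u : u \notin g.2.1.1 -> (u \in g.2.2) = false.
Proof. by case: hg => _ _ sw _ h; apply: contraNF h; apply: sw. Qed.

Lemma vless_AW a w : a \in g.1.1 -> w \in g.2.1.1 -> vless (gfirst g) a w.
Proof.
move=> ha hw; have [l _] := vlo_W hw; rewrite /vless; apply: leq_trans l.
rewrite /vhi nwild; last by apply: contraTN ha => /gdisj/andP[].
by rewrite /= index_cat ha index_mem.
Qed.

Lemma vless_WB w b : w \in g.2.1.1 -> b \in g.1.2 -> vless (gfirst g) w b.
Proof.
move=> hw hb; have [_ l] := vlo_W hw; rewrite /vless; apply: leq_trans l _.
have nb : b \notin g.2.1.1 by apply: contraTN hb => /gdisj/andP[].
have := guniq; rewrite cat_uniq => /and3P[_ /hasPn n1 _].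
have na : b \notin g.1.1 by apply: n1; rewrite mem_cat hb orbT.
by rewrite /vlo nwild //= index_cat (negbTE na) index_cat (negbTE nb) addnA leq_addr.
Qed.

Lemma vless_plain u v : u \notin g.2.1.1 -> v \notin g.2.1.1 ->
  vless (gfirst g) u v = (index u (gfirst g).1 < index v (gfirst g).1).
Proof. by move=> hu hv; rewrite /vless /vlo /vhi !nwild. Qed.

Variable P : rel nat.
Hypothesis hP : linear_on m P.
Hypothesis eP : extends_on m (gfirst g) P.

Lemma pos_W u : u \in g.2.1.1 -> pos m P u = size g.1.1 + count (above P u) g.2.1.1.
Proof.
move=> hu; case: (hg) => pe _ _ _; apply: (pos_split hP pe hu).
  move=> b hb; apply: eP; [|exact: glt|exact: vless_AW].
  by have := perm_mem pe b; rewrite mem_iota0 !mem_cat hb => <-.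
move=> b hb; apply: eP; [exact: glt| |exact: vless_WB].
by have := perm_mem pe b; rewrite mem_iota0 !mem_cat hb !orbT => <-.
Qed.

Lemma vless_notW u v : u < m -> v < m -> v \notin g.2.1.1 ->
  (index u (gfirst g).1 < index v (gfirst g).1 -> vless (gfirst g) u v) /\
  (index v (gfirst g).1 < index u (gfirst g).1 -> vless (gfirst g) v u).
Proof.
move=> um vm nv; case: (boolP (u \in g.2.1.1)) => hu; last by rewrite !vless_plain.
have := gmem vm; rewrite (negbTE nv) /= => /orP[hv|hv].
  split=> [|_]; last exact: vless_AW.
  have /andP[n1 _] := gdisj hu; rewrite /= !index_cat hv (negbTE n1) hu.
  have h1 : index v g.1.1 < size g.1.1 by rewrite index_mem.
  by move=> h2; have := ltn_trans h2 h1; rewrite ltnNge leq_addr.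
split=> [_|]; first exact: vless_WB.
have /andP[n1 _] := gdisj hu.
have := guniq; rewrite cat_uniq => /and3P[_ /hasPn na _].
have {}na : v \notin g.1.1 by apply: na; rewrite mem_cat hv orbT.
rewrite /= !index_cat hu (negbTE nv) (negbTE na) (negbTE n1).
have h1 : index u g.2.1.1 < size g.2.1.1 by rewrite index_mem.
by rewrite ltn_add2l => h2; have := ltn_trans h2 h1; rewrite ltnNge leq_addr.
Qed.

(** Outside the window a candidate is comparable with all others, so its position is forced; and the
    window has the same size in the first vote as in the base order. *)
Lemma pos_plain u : u < m -> u \notin g.2.1.1 -> pos m P u = index u (gbase g).
Proof.
move=> um nu; case: (hg) => pe pw _ _.
have uo : u \in (gfirst g).1 by rewrite (perm_mem pe) mem_iota0.
have -> : index u (gbase g) = index u (gfirst g).1.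
  rewrite /gbase /= !index_cat (perm_mem pw) (negbTE nu); case: ifP => // _.
  by rewrite (perm_size pw).
set o := (gfirst g).1 in uo *; set k := index u o.
have ko : k < size o by rewrite index_mem.
have eo : o = take k o ++ [:: u] ++ drop k.+1 o.
  by rewrite -{1}(cat_take_drop k o) (drop_nth 0) // nth_index.
have uo' : uniq o by rewrite (perm_uniq pe) iota_uniq.
have lt v : v \in o -> v < m by rewrite (perm_mem pe) mem_iota0.
have pe' : perm_eq (take k o ++ [:: u] ++ drop k.+1 o) (iota 0 m) by rewrite -eo.
rewrite (pos_split hP pe' (mem_head _ _)).
- by rewrite /= /above eqxx andbF !addn0 size_take ko.
- move=> b hb; have bo := mem_take hb; apply: eP => //; first exact: lt.
  apply: (proj1 (vless_notW (lt _ bo) um nu)).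
  rewrite -/o -/k; have := hb; rewrite -index_mem size_take ko.
  by rewrite -{2}(cat_take_drop k o) index_cat hb.
- move=> b hb; have bo := mem_drop hb; apply: eP => //; first exact: lt.
  apply: (proj2 (vless_notW (lt _ bo) um nu)).
  rewrite -/o -/k; have := uo'; rewrite {1}eo cat_uniq => /and3P[_ /hasPn n _].
  have nb : b \notin take k o by apply: n; rewrite mem_cat hb orbT.
  have bu : b != u.
    have := uo'; rewrite {1}eo cat_uniq => /and3P[_ _ /=/andP[nd _]].
    by apply: contraNneq nd => <-.
  by rewrite {1}eo index_cat (negbTE nb) /= eq_sym (negbTE bu) size_take ko addnS ltnS leq_addr.
Qed.
End group.

Definition others m (ws : seq nat) := [seq x <- iota 0 m | ~~ (x \in ws)].

(** [u] and [u'] share the positions [h] and [h.+1] and are incomparable: exchanging them passes the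
    drop at [h] from [u] to [u']. *)
Definition arc_group m h u u' : group :=
  let r := others m [:: u; u'] in
  ((take h r, drop h r), (([:: u; u'], [:: u; u']), [:: u; u'])).
(** Nothing floats here. The first vote and the base order disagree on the pair, which makes a
    forced transfer from [u'] to [u]. *)
Definition setup_group m h u u' : group :=
  let r := others m [:: u; u'] in
  ((take h r, drop h r), (([:: u; u'], [:: u'; u]), [::])).
(** The window fills the positions from [hp] to [hq.+1], the fillers [F] bringing [b] just behind
    the second drop. Above [a], the floating [x] takes the first drop from [a]; below [b], it cedes
    the second one to [b]; in between, all scores are equal and nothing changes. *)
Definition merged_group m hp hq a x b : group :=
  let r := others m [:: a; x; b] in
  let F := take (hq - hp - 1) (drop hp r) in
  let W := a :: x :: F ++ [:: b] in
  ((take hp r, drop (hq - hp - 1) (drop hp r)), ((W, W), [:: x])).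
(** The window fills the positions from [h - 1] to [h.+2]: two equal upper scores and two equal
    lower ones, with [a], [c] above the drop and [d], [b] below. If [c] and [d] both pass above [a],
    then [a] falls and [d] rises; if both pass below [b], then [c] falls and [b] rises. *)
Definition split_group m h a b c d : group :=
  let r := others m [:: a; b; c; d] in let W := [:: a; c; d; b] in
  ((take (h - 1) r, drop (h - 1) r), ((W, W), [:: c; d])).

Lemma others_perm m ws : uniq ws -> all (fun x => x < m) ws ->
  perm_eq (ws ++ others m ws) (iota 0 m).
Proof.
move=> u /allP al; apply: uniq_perm; rewrite ?iota_uniq //.
  rewrite cat_uniq u filter_uniq ?iota_uniq // andbT.
  by apply/hasPn => x; rewrite mem_filter => /andP[].
move=> x; rewrite mem_cat mem_filter mem_iota0; case: (boolP (x \in ws)) => //= /al.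
by rewrite /= => ->.
Qed.

Lemma others_size m ws : uniq ws -> all (fun x => x < m) ws -> size ws + size (others m ws) = m.
Proof. by move=> u a; rewrite -size_cat (perm_size (others_perm u a)) size_iota. Qed.

Lemma count_td (p : pred nat) h r : count p r = count p (take h r) + count p (drop h r).
Proof. by rewrite -count_cat cat_take_drop. Qed.

Lemma arc_valid m h u u' : u != u' -> u < m -> u' < m -> gvalid m (arc_group m h u u').
Proof.
move=> ne um um'; have P := @others_perm m [:: u; u']; rewrite /= !inE ne um um' in P.
split=> //=; apply: perm_trans (P isT isT); apply/permP => p.
by rewrite !count_cat /= (count_td p h (others _ _)); lia.
Qed.

Lemma setup_valid m h u u' : u != u' -> u < m -> u' < m -> gvalid m (setup_group m h u u').
Proof.
move=> ne um um'; have [H _ _ _] := arc_valid h ne um um'.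
by split=> //=; apply/permP => p /=; lia.
Qed.

Lemma merged_valid m hp hq (a x b : nat) : uniq [:: a; x; b] -> all (fun x => x < m) [:: a; x; b] ->
  gvalid m (merged_group m hp hq a x b).
Proof.
move=> un al; have P := others_perm un al.
split=> //=; last by move=> y; rewrite !inE => ->; rewrite orbT.
apply: perm_trans P; apply/permP => p.
rewrite !count_cat /= !count_cat /= (count_td p hp (others _ _)).
rewrite (count_td p (hq - hp - 1) (drop hp (others _ _))). by move: (count p (take hp _)) (count p (take (hq - hp - 1) _)) (count p (drop (hq - hp - 1) _)) => X Y Z; lia.
Qed.

Lemma split_valid m h (a b c d : nat) : uniq [:: a; b; c; d] -> all (fun x => x < m) [:: a; b; c; d] ->
  gvalid m (split_group m h a b c d).
Proof.
move=> un al; have P := others_perm un al.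
split=> //=; last by move=> y; rewrite !inE => /orP[] ->; rewrite ?orbT.
apply: perm_trans P; apply/permP => p.
by rewrite !count_cat /= (count_td p (h - 1) (others _ _)); lia.
Qed.

Section delta.
Variables (s : seq nat) (m : nat).
Let sc k : int := (nth 0 s k)%:Z.

Definition gdelta (g : group) (P : rel nat) v : int :=
  sc (pos m P v) - sc (index v (gbase g)).
Definition indic (u v : nat) : int := ((u == v) : nat)%:Z.

Lemma gdelta_plain g P v : gvalid m g -> linear_on m P -> extends_on m (gfirst g) P ->
  v < m -> v \notin g.2.1.1 -> gdelta g P v = 0%R.
Proof. by move=> hg hP eP vm nv; rewrite /gdelta (pos_plain hg hP eP vm nv) subrr. Qed.

Lemma gdelta_W g P v : gvalid m g -> linear_on m P -> extends_on m (gfirst g) P ->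
  v \in g.2.1.1 -> gdelta g P v =
   (sc (size g.1.1 + count (above P v) g.2.1.1) - sc (size g.1.1 + index v g.2.1.2))%R.
Proof.
move=> hg hP eP hv; rewrite /gdelta (pos_W hg hP eP hv) /gbase index_cat index_cat.
have /andP[n1 _] := gdisj hg hv; have [_ pw _ _] := hg.
by rewrite (negbTE n1) (perm_mem pw) hv.
Qed.

Lemma ind0 (ws : seq nat) v w : v \notin ws -> w \in ws -> indic w v = 0%R.
Proof. by move=> nv hw; rewrite /indic; case: eqP nv => // <-; rewrite hw. Qed.

Variables (P : rel nat).
Hypothesis hP : linear_on m P.

Lemma arc_delta h u u' v : u != u' -> u < m -> u' < m -> h.+1 < m ->
  extends_on m (gfirst (arc_group m h u u')) P -> v < m ->
  gdelta (arc_group m h u u') P v =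
   ((P u' u : nat)%:Z * (sc h - sc h.+1) * (indic u' v - indic u v))%R.
Proof.
move=> ne um um' hm eP vm; have hg := arc_valid h ne um um'.
have sA : size (arc_group m h u u').1.1 = h.
  have := @others_size m [:: u; u']; rewrite /= !inE ne um um' => /(_ isT isT) hs.
  by rewrite size_take; case: ltnP => //; lia.
case: (boolP (v \in [:: u; u'])) => hv; last first.
  rewrite (gdelta_plain hg) // !(ind0 hv) ?inE ?eqxx ?orbT //; ring.
rewrite (gdelta_W hg) // sA /=.
have e2 := P_asym hP um um' ne.
move: hv; rewrite !inE => /orP[]/eqP ->; rewrite /above /indic !eqxx ?(eq_sym u' u) (negbTE ne) ?andbF ?andbT /= ?e2.
  by case: (P u' u) => /=; rewrite ?addn0 ?addn1 ?add0n; ring.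
by case: (P u' u) => /=; rewrite ?addn0 ?addn1 ?add0n; ring.
Qed.

Lemma setup_delta h u u' v : u != u' -> u < m -> u' < m -> h.+1 < m ->
  extends_on m (gfirst (setup_group m h u u')) P -> v < m ->
  gdelta (setup_group m h u u') P v = ((sc h - sc h.+1) * (indic u v - indic u' v))%R.
Proof.
move=> ne um um' hm eP vm; have hg := setup_valid h ne um um'.
have sA : size (setup_group m h u u').1.1 = h.
  have := @others_size m [:: u; u']; rewrite /= !inE ne um um' => /(_ isT isT) hs.
  by rewrite size_take; case: ltnP => //; lia.
case: (boolP (v \in [:: u; u'])) => hv; last first.
  rewrite (gdelta_plain hg) // !(ind0 hv) ?inE ?eqxx ?orbT //; ring.
have Puu' : P u u'.
  apply: eP => //; rewrite (vless_W hg) ?inE ?eqxx ?orbT //=.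
  by rewrite eqxx (negbTE ne).
have Pu'u : P u' u = false by have := P_asym hP um um' ne; rewrite Puu'; case: (P u' u).
rewrite (gdelta_W hg) // sA /=.
move: hv; rewrite !inE => /orP[]/eqP ->; rewrite /above /indic !eqxx ?(eq_sym u' u) (negbTE ne) ?andbF ?andbT /= ?Puu' ?Pu'u /= ?addn0 ?addn1 ?add0n; ring.
Qed.

(** The two transfers exclude each other because [a] stays above [b], so [x] cannot be above the one
    and below the other. *)
Lemma merged_delta hp hq (a x b : nat) : uniq [:: a; x; b] -> all (fun x => x < m) [:: a; x; b] ->
  hp < hq -> hq.+1 < m -> (forall j, hp < j -> j <= hq -> sc j = sc hp.+1) ->
  extends_on m (gfirst (merged_group m hp hq a x b)) P ->
  ~~ (P x a && P b x) /\ forall v, v < m ->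
  gdelta (merged_group m hp hq a x b) P v =
   ((P x a : nat)%:Z * (sc hp - sc hp.+1) * (indic x v - indic a v) +
    (P b x : nat)%:Z * (sc hq - sc hq.+1) * (indic b v - indic x v))%R.
Proof.
move=> un al hpq hqm mid eP; have hg := merged_valid hp hq un al.
set g := merged_group m hp hq a x b in eP hg *.
set r := others m [:: a; x; b].
have hs : 3 + size r = m := others_size un al.
set F := take (hq - hp - 1) (drop hp r).
have gW : g.2.1.1 = a :: x :: F ++ [:: b] by [].
have sF : size F = hq - hp - 1 by rewrite size_take size_drop; case: ltnP => //; lia.
have gA : g.1.1 = take hp r by [].
have sA : size g.1.1 = hp by rewrite gA size_take; move: (size r) hs => k hs; case: ltnP => //; lia.
have := guniq hg; rewrite cat_uniq => /and3P[_ _]; rewrite cat_uniq => /andP[uW _].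
have {uW} : uniq (a :: x :: F ++ [:: b]) by [].
rewrite cons_uniq cons_uniq cat_uniq !inE !mem_cat !inE !negb_or /= !andbT.
case/and4P => /and3P[ax aF ab] /andP[xF xb] uF bF.
have [am [xm [bm _]]] : a < m /\ x < m /\ b < m /\ true by case/and4P: al.
have Fm f : f \in F -> f < m.
  by move=> hf; apply: (glt hg); rewrite gW !inE mem_cat hf !orbT.
have nx f : f \in F -> f != x by move=> hf; apply: contraNneq xF => <-.
have na f : f \in F -> f != a by move=> hf; apply: contraNneq aF => <-.
have nb f : f \in F -> f != b by move=> hf; apply: contraNneq bF => <-.
have ia : index a (a :: x :: F ++ [:: b]) = 0 by rewrite /= eqxx.
have iF f : f \in F -> index f (a :: x :: F ++ [:: b]) = (index f F).+2.
  by move=> hf; rewrite /= eq_sym (negbTE (na f hf)) eq_sym (negbTE (nx f hf)) index_cat hf.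
have ib : index b (a :: x :: F ++ [:: b]) = (size F).+2.
  by rewrite /= (negbTE ab) (negbTE xb) index_cat (negbTE bF) /= eqxx addn0.
have mW y : (y \in g.2.1.1) = [|| y == a, y == x, y \in F | y == b].
  by rewrite gW !inE mem_cat inE.
have gw : g.2.2 = [:: x] by [].
have bx : b != x by rewrite eq_sym.
have Paf f : f \in F -> P a f.
  move=> hf; apply: eP => //; first exact: Fm.
  by rewrite (vless_W hg) ?mW ?gw ?inE ?hf ?eqxx ?orbT ?orbT ?orbT ?ax ?(nx f hf) // gW ia (iF f hf).
have Pfb f : f \in F -> P f b.
  move=> hf; apply: eP => //; first exact: Fm.
  rewrite (vless_W hg) ?mW ?gw ?inE ?hf ?eqxx ?orbT ?orbT ?orbT ?(nx f hf) ?bx // gW (iF f hf) ib.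
  by rewrite !ltnS index_mem.
have Pab : P a b.
  by apply: eP => //; rewrite (vless_W hg) ?mW ?gw ?inE ?eqxx ?orbT ?orbT ?orbT ?ax ?bx // gW ia ib.
have [tot trans anti] := hP.
have asym := P_asym hP.
have Pba : P b a = false by rewrite asym 1?eq_sym // Pab.
have Pfa f (hf : f \in F) : P f a = false by rewrite (asym f a (Fm f hf) am (na f hf)) (Paf f hf).
have Pbf f (hf : f \in F) : P b f = false.
  by rewrite (asym b f bm (Fm f hf)) ?(Pfb f hf) // eq_sym nb.
have YZ : ~~ (P x a && P b x).
  apply/negP => /andP[h1 h2]; by have := trans _ _ _ bm xm am h2 h1; rewrite Pba.
split=> // v vm.
case: (boolP (v \in a :: x :: F ++ [:: b])) => hv; last first.
  by rewrite (gdelta_plain hg) // !(ind0 hv) ?inE ?mem_cat ?inE ?eqxx ?orbT //; ring.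
rewrite (gdelta_W hg) // sA [g.2.1.2]gW gW.
have scm n : 0 < n -> n <= size F + 1 -> sc (hp + n) = sc hp.+1.
  by move=> n0 nF; apply: mid; move: (size F) sF hpq n0 nF; clear; lia.
have cF : count (above P x) F <= size F := count_size _ _.
have e2 : hp + (size F).+2 = hq.+1 by move: (size F) sF hpq; clear; lia.
have sq : sc hq = sc hp.+1 by apply: mid.
move: hv; rewrite !inE mem_cat inE => /or4P[/eqP->|/eqP->|hf|/eqP->].
- have -> : count (above P a) (a :: x :: F ++ [:: b]) = P x a.
    rewrite /= count_cat /= {1 2 4}/above eqxx andbF Pba (eq_sym x a) ax andbT /= add0n addn0.
    rewrite (_ : count _ F = 0) ?addn0 //; apply/eqP; rewrite eqn0Ngt -has_count -all_predC.
    by apply/allP => f hf; rewrite /= /above (Pfa f hf).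
  rewrite /= eqxx addn0 /indic eqxx (eq_sym x a) (negbTE ax) (eq_sym b a) (negbTE ab).
  by case: (P x a) => /=; rewrite ?addn0 ?addn1; ring.
- rewrite /= (negbTE ax) eqxx addn1 count_cat /= {1 2 4}/above eqxx andbF ax eq_sym xb !andbT addn0 add0n.
  rewrite /indic eqxx (negbTE ax) eq_sym (negbTE xb).
  have Pax : P a x = ~~ P x a by apply: asym.
  case: (boolP (P x a)) YZ => [Pxa /= /negbTE Pbx|Pxa _].
    rewrite Pax Pxa Pbx /= (_ : count _ F = 0) ?addn0; first by ring.
    apply/eqP; rewrite eqn0Ngt -has_count -all_predC.
    apply/allP => f hf; rewrite /= /above (nx f hf) andbT (asym f x (Fm f hf) xm (nx f hf)) negbK.
    exact: (trans _ _ _ xm am (Fm f hf) Pxa (Paf f hf)).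
  rewrite Pax Pxa /=; case: (boolP (P b x)) => Pbx /=.
    rewrite (_ : count _ F = size F); last first.
      apply/eqP; rewrite -all_count; apply/allP => f hf; rewrite /above (nx f hf) andbT.
      exact: (trans _ _ _ (Fm f hf) bm xm (Pfb f hf) Pbx).
    by rewrite addn1 add1n e2 -sq; ring.
  by rewrite addn0 scm //; [ring | move: (count _ _) (size F) cF; clear; lia].
- rewrite (iF v hf).
  have iv : index v F < size F by rewrite index_mem.
  rewrite (scm (index v F).+2) //; last by move: (index v F) (size F) iv; clear; lia.
  rewrite /indic eq_sym (negbTE (nx v hf)) eq_sym (negbTE (na v hf)) eq_sym (negbTE (nb v hf)).
  have c1 : count (above P v) F < size F.
    rewrite ltn_neqAle count_size andbT -all_count; apply/allP => /(_ v hf).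
    by rewrite /above eqxx andbF.
  rewrite /= count_cat /= {1 4}/above (Paf v hf) (Pbf v hf) (eq_sym a) (na v hf) /=.
  rewrite scm //; first by ring.
  by move: (count _ _) (size F) c1 (above P v x); clear => c n c1 []; lia.
- rewrite ib.
  rewrite /= count_cat /= {1 2 4}/above eqxx andbF Pab ab xb /= andbT.
  rewrite (_ : count _ F = size F); last first.
    apply/eqP; rewrite -all_count; apply/allP => f hf; by rewrite /above (nb f hf) andbT; exact: Pfb.
  rewrite /indic eqxx (negbTE ab) (negbTE xb) e2 (asym x b) //.
  case: (P b x) => /=; rewrite ?addn0 ?add0n.
    by rewrite add1n scm ?addn1 // -sq; ring.
  by rewrite !add1n e2; ring.
Qed.

(** The last term is a leak: when neither transfer takes place, [d] may still be ranked above [c],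
    and then it takes over the drop. It cannot be prevented by the partial vote, but [conserve]
    shows it to be harmless. *)
Lemma split_delta h (a b c d : nat) : uniq [:: a; b; c; d] -> all (fun x => x < m) [:: a; b; c; d] ->
  0 < h -> h.+2 < m -> sc (h - 1) = sc h -> sc h.+2 = sc h.+1 ->
  extends_on m (gfirst (split_group m h a b c d)) P ->
  let Y := P c a && P d a in let Z := P b c && P b d in
  ~~ (Y && Z) /\ forall v, v < m ->
  gdelta (split_group m h a b c d) P v =
   ((sc h - sc h.+1) * ((Y : nat)%:Z * (indic d v - indic a v) + (Z : nat)%:Z * (indic b v - indic c v)
     + ([&& ~~ Y, ~~ Z & P d c] : nat)%:Z * (indic d v - indic c v)))%R.
Proof.
move=> un al h0 hm s1 s2 eP; have hg := split_valid h un al.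
set g := split_group m h a b c d in eP hg *.
have hs : 4 + size (others m [:: a; b; c; d]) = m := others_size un al.
have gA : g.1.1 = take (h - 1) (others m [:: a; b; c; d]) by [].
have sA : size g.1.1 = h - 1.
  rewrite gA size_take; move: (size (others _ _)) hs hm h0; clear => k hs hm h0.
  case: ltnP => //; lia.
have [am [bm [cm dm]]] : a < m /\ b < m /\ c < m /\ d < m by case/and5P: al => -> -> -> ->.
move: (un); rewrite /= !inE !negb_or => /and4P[/and3P[ab ac ad] /andP[bc bd] word_of _].
have Pab : P a b.
  apply: eP => //; rewrite (vless_W hg) ?inE ?eqxx ?orbT //=; rewrite ?negb_or ?ac ?ad ?bc ?bd //.
  by rewrite eqxx (negbTE ab).
have [tot trans anti] := hP.
have asym := P_asym hP.
have Pba : P b a = false by rewrite asym 1?eq_sym // Pab.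
have t u v w := fun hu hv hw => introT implyP (fun h1 => introT implyP (fun h2 => trans u v w hu hv hw h1 h2)).
have e0 : h - 1 + 0 = h - 1 by rewrite addn0.
have e1 : h - 1 + 1 = h by lia.
have e3 : h - 1 + 2 = h.+1 by lia.
have e4 : h - 1 + 3 = h.+2 by lia.
(* The instances of transitivity, with [a] above [b], that cut the truth values of the five open
   comparisons down to actual orders; the rest is a finite check. *)
have F1 : [&& P c a ==> ~~ P b c, P d a ==> ~~ P b d, P c d ==> P d a ==> P c a, P d c ==> P c a ==> P d a,
   P b c ==> P c d ==> P b d & P b d ==> P d c ==> P b c].
  rewrite !t // !andbT; apply/andP; split; apply/implyP => h1; apply/negP => h2.
    by have := trans _ _ _ bm cm am h2 h1; rewrite Pba.
  by have := trans _ _ _ bm dm am h2 h1; rewrite Pba.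
have Pac := asym _ _ am cm ac; have Pad := asym _ _ am dm ad.
have Pcb : P c b = ~~ P b c by rewrite asym // eq_sym.
have Pdb : P d b = ~~ P b d by rewrite asym // eq_sym.
have Pdc : P d c = ~~ P c d by rewrite asym // eq_sym.
split.
  by move: F1; case: (P c a); case: (P d a); case: (P b c); case: (P b d).
move=> v vm; case: (boolP (v \in [:: a; c; d; b])) => hv; last first.
  by rewrite (gdelta_plain hg) // !(ind0 hv) ?inE ?eqxx ?orbT //; ring.
rewrite (gdelta_W hg) // sA.
have [[ba ca da] [cb db dc]] : [/\ b == a = false, c == a = false & d == a = false] /\
    [/\ c == b = false, d == b = false & d == c = false].
  by split; split; apply/negbTE; rewrite eq_sym.
move: hv; rewrite !inE => /or4P[]/eqP-> /=; rewrite /above /indic ?eqxx ?ba ?ca ?da ?cb ?db ?dc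
  ?(negbTE ab) ?(negbTE ac) ?(negbTE ad) ?(negbTE bc) ?(negbTE bd) ?(negbTE word_of) /= ?andbT ?andbF ?Pab ?Pba ?Pac ?Pad ?Pcb ?Pdb ?Pdc;
  move: F1; rewrite ?Pdc; case: (P c a); case: (P d a); case: (P b c); case: (P b d); case: (P c d) => //= _;
  rewrite ?addn0 ?add0n ?add1n ?e0 ?e1 ?e3 ?e4 ?addnA ?s1 ?s2; ring.
Qed.
End delta.

Definition ord_rel (o : seq nat) : rel nat := fun u v => index u o <= index v o.

Lemma ord_rel_linear m o : perm_eq o (iota 0 m) -> linear_on m (ord_rel o).
Proof.
move=> pe; split=> [u v um vm|u v w _ _ _|u v um vm]; rewrite /ord_rel.
- exact: leq_total.
- exact: leq_trans.
move=> h1 h2; have e : index u o = index v o by apply/eqP; rewrite eqn_leq h1 h2.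
by rewrite -(nth_index 0 (_ : u \in o)) ?e ?nth_index // (perm_mem pe) mem_iota0.
Qed.

Lemma index_filter_leq (p : pred nat) (s : seq nat) u v : p u -> p v ->
  (index u (filter p s) <= index v (filter p s)) = (index u s <= index v s).
Proof.
move=> pu pv; elim: s => //= x s IH; case: ifP => px /=.
  by case: eqP => //; case: eqP => // _ _; rewrite ltnS.
rewrite IH; case: eqP => [e|_]; first by rewrite e pu in px.
by case: eqP => [e|_]; [rewrite e pv in px|rewrite ltnS].
Qed.

Section real.
Variables (m : nat) (g : group) (W' : seq nat).
Hypothesis hg : gvalid m g.
Hypothesis hW : perm_eq W' g.2.1.1.
Hypothesis hF : [seq y <- W' | y \notin g.2.2] = [seq y <- g.2.1.1 | y \notin g.2.2].

Let o' := g.1.1 ++ W' ++ g.1.2.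

Lemma vlo_vhi u : vlo (gfirst g) u <= vhi (gfirst g) u.
Proof. by rewrite /vlo /vhi; case: ifP => //= _; have [_ _ _ h] := hg; lia. Qed.

Lemma vless_asym u v : vless (gfirst g) u v -> vless (gfirst g) v u -> False.
Proof. by rewrite /vless; have := vlo_vhi u; have := vlo_vhi v; lia. Qed.

Lemma ord_perm : perm_eq o' (iota 0 m).
Proof.
have [pe _ _ _] := hg; apply: perm_trans pe.
by rewrite perm_cat2l perm_cat2r.
Qed.

(** Floating candidates may stand anywhere in the window, so only the relative order of the fixed
    ones has to be kept; this is [hF]. *)
Lemma ord_extends : extends_on m (gfirst g) (ord_rel o').
Proof.
move=> u v um vm h; rewrite /ord_rel /o'.
have mW y : (y \in W') = (y \in g.2.1.1) := perm_mem hW y.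
case: (boolP ((u \in g.2.1.1) && (v \in g.2.1.1))) => [/andP[hu hv]|nuv].
  have /andP[nu _] := gdisj hg hu; have /andP[nv _] := gdisj hg hv.
  have [l1 l2] := vlo_W hg hu; have [l3 l4] := vlo_W hg hv.
  have lo1 := vlo_vhi u; have lo2 := vlo_vhi v.
  have wu : u \notin g.2.2.
    by apply/negP => w; move: h; rewrite /vless {1}/vhi w /=; lia.
  have wv : v \notin g.2.2.
    by apply/negP => w; move: h; rewrite /vless {1}/vlo w /=; lia.
  rewrite !index_cat (negbTE nu) (negbTE nv) !mW hu hv leq_add2l.
  rewrite -(@index_filter_leq (fun y => y \notin g.2.2) W' u v wu wv) hF.
  rewrite (@index_filter_leq (fun y => y \notin g.2.2) g.2.1.1 u v wu wv) ltnW //.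
  by rewrite -(vless_W hg).
have lt : index u (gfirst g).1 < index v (gfirst g).1.
  rewrite ltnNge leq_eqVlt negb_or; apply/andP; split.
    have [pe _ _ _] := hg.
    have io w : w < m -> w \in (gfirst g).1 by rewrite (perm_mem pe) mem_iota0.
    apply/negP => /eqP e; have uv : v = u by rewrite -(nth_index 0 (io _ vm)) e nth_index // io.
    by move: h; rewrite uv => h; apply: (vless_asym h h).
  apply/negP => l; apply: (vless_asym h).
  case: (boolP (v \in g.2.1.1)) nuv => [hv|nv _]; last exact: (proj2 (vless_notW hg um vm nv)).
  by rewrite andbT => nu; apply: (proj1 (vless_notW hg vm um nu)).
apply: ltnW; move: lt; rewrite /= !index_cat !mW (perm_size hW).
case: (boolP (u \in g.1.1)) => uA; case: (boolP (v \in g.1.1)) => vA //.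
- move=> _; apply: leq_trans (leq_addr _ _); by rewrite index_mem.
- have hv : index v g.1.1 < size g.1.1 by rewrite index_mem.
  by move=> l; have := ltn_trans l hv; rewrite ltnNge leq_addr.
rewrite !ltn_add2l; case: (boolP (u \in g.2.1.1)) nuv => uW; case: (boolP (v \in g.2.1.1)) => vW //= _.
- by move=> _; apply: leq_trans (leq_addr _ _); rewrite -(perm_size hW) index_mem mW.
have hv : index v g.2.1.1 < size g.2.1.1 by rewrite index_mem.
by move=> l; have := ltn_trans l hv; rewrite ltnNge leq_addr.
Qed.

Lemma ord_relW u v : u \in g.2.1.1 -> v \in g.2.1.1 ->
  ord_rel o' u v = (index u W' <= index v W').
Proof.
move=> hu hv; have /andP[nu _] := gdisj hg hu; have /andP[nv _] := gdisj hg hv.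
by rewrite /ord_rel /o' !index_cat (negbTE nu) (negbTE nv) !(perm_mem hW) hu hv leq_add2l.
Qed.
End real.

Definition realises m g (P : rel nat) := linear_on m P /\ extends_on m (gfirst g) P.

Lemma base_real m g : gvalid m g -> exists P, realises m g P.
Proof.
move=> hg; exists (ord_rel (g.1.1 ++ g.2.1.1 ++ g.1.2)); split.
  by apply: ord_rel_linear; have [pe] := hg.
exact: (ord_extends hg (perm_refl _)).
Qed.

Lemma arc_real m h u u' (y : bool) : u != u' -> u < m -> u' < m ->
  exists P, realises m (arc_group m h u u') P /\ P u' u = y.
Proof.
move=> ne um um'; have hg := arc_valid h ne um um'.
pose W' := if y then [:: u'; u] else [:: u; u'].
have pW : perm_eq W' [:: u; u'].
  by rewrite /W'; case: (y); rewrite // (perm_catC [:: u'] [:: u]).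
have fW : [seq z <- W' | z \notin [:: u; u']] = [seq z <- [:: u; u'] | z \notin [:: u; u']].
  by rewrite /W'; case: (y); rewrite /= !inE !eqxx ?orbT.
exists (ord_rel ((arc_group m h u u').1.1 ++ W' ++ (arc_group m h u u').1.2)).
split; first by split; [apply: ord_rel_linear; exact: ord_perm|exact: ord_extends].
rewrite (ord_relW hg pW) ?inE ?eqxx ?orbT // /W'.
by case: (y) => /=; rewrite ?eqxx ?(eq_sym u') (negbTE ne).
Qed.

Lemma merged_real m hp hq (a x b : nat) (y z : bool) : uniq [:: a; x; b] ->
  all (fun x => x < m) [:: a; x; b] -> ~~ (y && z) ->
  exists P, realises m (merged_group m hp hq a x b) P /\ (P x a = y /\ P b x = z).
Proof.
move=> un al yz; have hg := merged_valid hp hq un al.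
set g := merged_group m hp hq a x b in hg *.
pose F := take (hq - hp - 1) (drop hp (others m [:: a; x; b])).
have gW : g.2.1.1 = a :: x :: F ++ [:: b] by [].
have gw : g.2.2 = [:: x] by [].
pose W' := if y then x :: a :: F ++ [:: b] else if z then a :: F ++ [:: b; x] else a :: x :: F ++ [:: b].
have pW : perm_eq W' g.2.1.1.
  apply/permP => p; rewrite gW /W'; case: (y); case: (z); rewrite /= ?count_cat /=; lia.
have := guniq hg; rewrite cat_uniq => /and3P[_ _]; rewrite cat_uniq => /andP[uW _].
have {uW} : uniq (a :: x :: F ++ [:: b]) by [].
rewrite cons_uniq cons_uniq cat_uniq !inE !mem_cat !inE !negb_or /= !andbT.
case/and4P => /and3P[ax aF ab] /andP[xF xb] uF bF.
have fW : [seq w <- W' | w \notin g.2.2] = [seq w <- g.2.1.1 | w \notin g.2.2].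
  rewrite gw gW /W'; have e : [seq w <- F | w \notin [:: x]] = F.
    by apply/all_filterP/allP => w hw; rewrite inE; apply: contraNneq xF => <-.
  by case: (y); case: (z); rewrite /= ?filter_cat /= ?e !inE ?eqxx ?ax ?(eq_sym b x) ?xb /=.
exists (ord_rel (g.1.1 ++ W' ++ g.1.2)).
split; first by split; [apply: ord_rel_linear; exact: ord_perm|exact: ord_extends].
have [ha hx hb] : [/\ a \in g.2.1.1, x \in g.2.1.1 & b \in g.2.1.1].
  by rewrite gW !inE !mem_cat !inE !eqxx !orbT.
rewrite !(ord_relW hg pW) // /W'.
have [xa ba bx] : [/\ x == a = false, b == a = false & b == x = false].
  by split; apply/negbTE; rewrite eq_sym.
case: (y) yz => /= [/negbTE ->|_].
  by rewrite ?eqxx ?xa ?ba ?bx ?(negbTE xb) ?(negbTE ax) ?(negbTE ab) index_cat (negbTE bF) /= eqxx.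
case: (z) => /=; rewrite ?eqxx ?xa ?ba ?bx ?(negbTE xb) ?(negbTE ax) ?(negbTE ab) ?ltn0 //.
by rewrite !index_cat (negbTE bF) (negbTE xF) /= !eqxx bx ltnS leq_add2l.
Qed.

(** Besides realising the two bits, the order must avoid the leak: if neither bit is set, [c] stays
    above [d]. *)
Lemma split_real m h (a b c d : nat) (y z : bool) : uniq [:: a; b; c; d] ->
  all (fun x => x < m) [:: a; b; c; d] -> ~~ (y && z) ->
  exists P, realises m (split_group m h a b c d) P /\
   [/\ P c a && P d a = y, P b c && P b d = z & [&& ~~ y, ~~ z & P d c] = false].
Proof.
move=> un al yz; have hg := split_valid h un al.
set g := split_group m h a b c d in hg *.
move: (un); rewrite /= !inE !negb_or => /and4P[/and3P[ab ac ad] /andP[bc bd] word_of _].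
have [[ba ca da] [cb db dc]] : [/\ b == a = false, c == a = false & d == a = false] /\
    [/\ c == b = false, d == b = false & d == c = false].
  by split; split; apply/negbTE; rewrite eq_sym.
have {ab ac ad bc bd word_of} [[ab ac ad] [bc bd word_of]] : [/\ a == b = false, a == c = false & a == d = false] /\
    [/\ b == c = false, b == d = false & c == d = false].
  by split; split; apply/negbTE.
pose W' := if y then [:: c; d; a; b] else if z then [:: a; b; c; d] else [:: a; c; d; b].
have pW : perm_eq W' g.2.1.1.
  by apply/permP => p; rewrite /W'; case: (y); case: (z) => /=; lia.
have fW : [seq w <- W' | w \notin g.2.2] = [seq w <- g.2.1.1 | w \notin g.2.2].
  by rewrite /W'; case: (y); case: (z); rewrite /= !inE ?eqxx ?ac ?ad ?bc ?bd /= ?orbT.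
exists (ord_rel (g.1.1 ++ W' ++ g.1.2)).
split; first by split; [apply: ord_rel_linear; exact: ord_perm|exact: ord_extends].
rewrite !(ord_relW hg pW) ?inE ?eqxx ?orbT // /W'.
case: (y) yz => /= [/negbTE ->|_]; [|case: (z)]; rewrite /= ?eqxx ?ab ?ac ?ad ?bc ?bd ?word_of ?ba ?ca ?da ?cb ?db ?dc /=. all: by [].
Qed.

Lemma pair_code_inj b x k x' k' : k < b -> k' < b -> x * b + k = x' * b + k' -> x = x' /\ k = k'.
Proof.
move=> h h' e; have b0 : 0 < b by apply: leq_ltn_trans h.
have e1 := congr1 (fun z => z %/ b) e; have e2 := congr1 (fun z => z %% b) e.
move: e1 e2; rewrite !divnMDl // !divn_small // !addn0 !modnMDl !modn_small //.
Qed.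

Lemma sum_pick (T : eqType) (s : seq T) (F : T -> int) t0 : uniq s -> t0 \in s ->
  (\sum_(t <- s) F t * ((t == t0) : nat)%:Z = F t0)%R.
Proof.
move=> us hs; rewrite (bigD1_seq t0) //= eqxx mulr1 big1 ?addr0 // => t /negbTE ->.
by rewrite mulr0.
Qed.

(** * Choice networks as flows of points *)

Definition wire := (nat * nat)%type.
Definition occurrence := (nat * wire)%type.

(* A network: [nv] variables with values below [nk], [nc] clauses; [occ] lists
   the literals with the index of their clause. *)
Record network := Network { nv : nat; nk : nat; nc : nat; occ : seq occurrence }.

Section codes.
Variable I : network.
Definition nocc := size (occ I).
Definition lit k : wire := (nth (0, (0, 0)) (occ I) k).2.
Definition cla k : nat := (nth (0, (0, 0)) (occ I) k).1.
(* Numbers of the candidates; 0 is the distinguished one.  The wire [w] of the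
   variable [i] leads from the source [cS i] through the nodes [cN w k] to the sink
   [cTp], meeting the [k]-th occurrence between its nodes [k] and [k.+1]; the
   clause [j] leads from [cS' j] through some [cC k] to [cTq].  With two drops
   available, [cC k] can be merged with a node of the wire ([cX true]). *)
Definition cTp := 1.
Definition cTq := 2.
Definition cS i := 3 + i.
Definition cS' j := 3 + nv I + j.
Definition cC k := 3 + nv I + nc I + k.
Definition cN (w : wire) k := 3 + nv I + nc I + nocc + ((w.1 * nk I + w.2) * nocc.+1 + k).
(** Every wire has a slot for every occurrence, including those on other wires, which it passes by a
    plain arc. Thus slots and occurrences share their numbers, and one slot more leads to the
    sink. *)
Definition cND w k := if k == 0 then cS w.1 else if k == nocc.+1 then cTp else cN w k.
Definition ncodes := 3 + nv I + nc I + nocc + nv I * nk I * nocc.+1.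
Definition cX (mg : bool) k := if mg then cND (lit k) k.+1 else cC k.

Definition wires : seq wire := [seq (i, v) | i <- iota 0 (nv I), v <- iota 0 (nk I)].
Definition arcs : seq (wire * nat) := [seq (w, k) | w <- wires, k <- iota 0 nocc.+1].
Definition crossing (t : wire * nat) := (t.2 < nocc) && (lit t.2 == t.1).

Definition desc := (nat * (wire * nat))%type.
(* The groups of votes: feeding the sources of the variables (0) and of the
   clauses (1), passing points along the wires (2), and from the clauses to their
   occurrences (3). *)
Definition descs : seq desc :=
  [seq (0, ((i, 0), 0)) | i <- iota 0 (nv I)] ++ [seq (1, ((j, 0), 0)) | j <- iota 0 (nc I)] ++
  [seq (2, t) | t <- arcs] ++ [seq (3, ((0, 0), k)) | k <- iota 0 nocc].

Definition wf_net := forall o, o \in occ I -> [/\ o.1 < nc I, o.2.1 < nv I & o.2.2 < nk I].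

Definition choice_sat := exists2 f : nat -> nat, (forall i, i < nv I -> f i < nk I) &
  forall j, j < nc I -> exists2 o : occurrence, o \in occ I & o.1 = j /\ f o.2.1 <> o.2.2.

Lemma mem_wires (w : wire) : (w \in wires) = (w.1 < nv I) && (w.2 < nk I).
Proof.
apply/allpairsP/idP => [[[i v] /= [hi hv ->]]|/andP[h1 h2]].
  by rewrite !mem_iota0 in hi hv; rewrite hi.
by exists w; rewrite !mem_iota0 -surjective_pairing.
Qed.

Lemma uniq_wires : uniq wires.
Proof. by apply: allpairs_uniq; rewrite ?iota_uniq // => -[? ?] [? ?]. Qed.

Lemma mem_arcs (t : wire * nat) : (t \in arcs) = (t.1 \in wires) && (t.2 <= nocc).
Proof.
apply/allpairsP/idP => [[[w k] [hw hk ->]]|/andP[h1 h2]].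
  by rewrite mem_iota0 in hk; apply/andP.
by exists t; rewrite mem_iota0 -surjective_pairing.
Qed.

Lemma uniq_arcs : uniq arcs.
Proof. by apply: allpairs_uniq; rewrite ?iota_uniq ?uniq_wires // => -[? ?] [? ?]. Qed.

Lemma uniq_descs : uniq descs.
Proof.
have disj (a b : nat) (s s' : seq desc) : a <> b -> (forall x, x \in s -> x.1 = a) ->
    (forall x, x \in s' -> b <= x.1) -> a < b -> ~~ has (mem s) s'.
  move=> _ h h' ab; apply/hasPn => x /h' l; apply/negP => /h e; lia.
rewrite /descs !cat_uniq !map_inj_uniq ?iota_uniq ?uniq_arcs //=; try by move=> ? ? [].
rewrite andbT; apply/and3P; split.
- apply: (@disj 0 1) => // [x /mapP[? _ -> //]|x].
  by rewrite !mem_cat => /or3P[] /mapP[? _ ->].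
- apply: (@disj 1 2) => // [x /mapP[? _ -> //]|x].
  by rewrite !mem_cat => /orP[] /mapP[? _ ->].
apply: (@disj 2 3) => // [x /mapP[? _ -> //]|x].
by case/mapP=> ? _ ->.
Qed.

Hypothesis wf : wf_net.

Lemma lit_wires k : k < nocc -> lit k \in wires.
Proof. by move=> h; rewrite mem_wires /lit; have [_ -> ->] := wf (mem_nth (0, (0, 0)) h). Qed.

Lemma cla_lt k : k < nocc -> cla k < nc I.
Proof. by move=> h; rewrite /cla; have [] := wf (mem_nth (0, (0, 0)) h). Qed.

Lemma cN_inj (w : wire) k (w' : wire) k' : w \in wires -> w' \in wires -> k <= nocc -> k' <= nocc ->
  cN w k = cN w' k' -> (w, k) = (w', k').
Proof.
rewrite !mem_wires; case: w w' => [i v] [i' v'] /= /andP[_ hv] /andP[_ hv'] hk hk' /addnI.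
by case/pair_code_inj => // /pair_code_inj[] //= -> -> ->.
Qed.

Lemma wire_lt (w : wire) : w \in wires -> w.1 * nk I + w.2 < nv I * nk I.
Proof.
rewrite mem_wires => /andP[h1 h2]; apply: leq_trans (_ : w.1.+1 * nk I <= _).
  by rewrite mulSn; move: (w.1 * nk I) => X; lia.
by rewrite leq_mul2r h1 orbT.
Qed.

Lemma ncodes_ge : 3 + nv I + nc I + nocc <= ncodes.
Proof. exact: leq_addr. Qed.

Lemma cN_lt (w : wire) k : w \in wires -> k <= nocc -> cN w k < ncodes.
Proof.
move=> /wire_lt; rewrite /cN /ncodes; move: (w.1 * _ + _) (nv I * nk I) => X Y h hk.
rewrite ltn_add2l; apply: leq_trans (_ : X.+1 * nocc.+1 <= _).
  by rewrite mulSn; move: (X * _) => Z; lia.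
by rewrite leq_mul2r h orbT.
Qed.

Lemma cND_lt (w : wire) k : w \in wires -> k <= nocc.+1 -> 0 < cND w k < ncodes.
Proof.
move=> hw hk; rewrite /cND; case: eqP => [_|k0].
  by have := hw; rewrite mem_wires => /andP[h _]; have := ncodes_ge; rewrite /cS; lia.
case: eqP => [_|kR]; first by rewrite /ncodes.
by rewrite cN_lt //= ; lia.
Qed.

Lemma cX_lt mg k : k < nocc -> 0 < cX mg k < ncodes.
Proof.
move=> h; rewrite /cX; case: mg; first by apply: cND_lt; [exact: lit_wires|rewrite ltnS ltnW].
by have := ncodes_ge; rewrite /cC; lia.
Qed.

Section flow.
Variables (mg : bool) (p q : int) (y z u : desc -> bool).
Hypothesis p0 : (0 < p)%R.
Hypothesis q0 : (0 < q)%R.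
Let B (b : bool) : int := (b : nat)%:Z.

(* [flow d] lists the score changes (amount, candidate) in the vote [d]. *)
Definition flow (d : desc) : seq (int * nat) :=
  let: (w, k) := d.2 in
  if d.1 == 0 then [:: (p, cS w.1); (- p, cTp)]%R
  else if d.1 == 1 then [:: (q, cS' w.1); (- q, cTq)]%R
  else if d.1 == 2 then
    let f := [:: (B (y d) * p, cND w k.+1); (- (B (y d) * p), cND w k)]%R in
    if crossing d.2 then
      f ++ [:: (B (z d) * q, cTq); (- (B (z d) * q), cX mg k);
        (B (u d) * p, cND w k.+1); (- (B (u d) * p), cX mg k)]%R
    else f
  else [:: (B (y d) * q, cX mg k); (- (B (y d) * q), cS' (cla k))]%R.

(** The score changes paired with a weight on the candidates. For the indicator of a set this is
    what the vote adds to the total of the set, so conservation can be tested on any set at once. *)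
Definition flow_sum (phi : nat -> int) d : int := (\sum_(x <- flow d) x.1 * phi x.2)%R.

Lemma flow_lt d x : d \in descs -> x \in flow d -> 0 < x.2 < ncodes.
Proof.
rewrite !mem_cat => /or4P[] /mapP[t ht ->]; rewrite /flow /=.
- rewrite mem_iota0 in ht; rewrite !inE => /orP[]/eqP -> //=; have := ncodes_ge; rewrite /cS; lia.
- rewrite mem_iota0 in ht; rewrite !inE => /orP[]/eqP -> //=; have := ncodes_ge; rewrite /cS'; lia.
- move: ht; rewrite mem_arcs; case: t => w k /= /andP[hw hk].
  have A : forall x, x \in [:: (B (y (2, (w, k))) * p, cND w k.+1); (- (B (y (2, (w, k))) * p), cND w k)]%R -> 0 < x.2 < ncodes.
    by move=> e; rewrite !inE => /orP[]/eqP -> /=; apply: cND_lt => //; lia.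
  case: ifP => [/andP[/= h _]|_]; last exact: A.
  rewrite (mem_cat x [:: _; _]) => /orP[/A //|]; rewrite !inE => /or4P[]/eqP -> //=.
  + exact: cX_lt.
  + exact: cND_lt.
  exact: cX_lt.
rewrite mem_iota0 in ht; rewrite !inE => /orP[]/eqP -> /=; first exact: cX_lt.
have := cla_lt ht; have := ncodes_ge; rewrite /cS'; lia.
Qed.

Lemma sum_descs (F : desc -> int) : (\sum_(d <- descs) F d =
  \sum_(i <- iota 0 (nv I)) F (0, ((i, 0), 0)) + \sum_(j <- iota 0 (nc I)) F (1, ((j, 0), 0)) +
  \sum_(t <- arcs) F (2, t) + \sum_(k <- iota 0 nocc) F (3, ((0, 0), k)))%R.
Proof. by rewrite /descs !big_cat !big_map /= !addrA. Qed.

(** An occurrence lies on exactly one wire, and the last slot [nocc] is never a crossing. *)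
Lemma sum_crossing (G : wire * nat -> int) :
  (\sum_(t <- arcs | crossing t) G t = \sum_(k <- iota 0 nocc) G (lit k, k))%R.
Proof.
have -> : arcs = [seq (w, k) | w <- wires, k <- iota 0 nocc ++ [:: nocc]].
  by rewrite /arcs -addn1 iotaD add0n.
rewrite big_mkcond big_allpairs exchange_big big_cat /= big_seq1 [X in (_ + X)%R]big1 ?addr0; last first.
  by move=> w _; rewrite /crossing /= ltnn.
apply: eq_big_seq => k; rewrite mem_iota0 => hk; rewrite /crossing /= hk /=.
rewrite -(@sum_pick _ wires (fun w => G (w, k)) (lit k) uniq_wires (lit_wires hk)).
by apply: eq_bigr => w _; rewrite eq_sym; case: eqP => _; rewrite ?mulr1 ?mulr0.
Qed.

Definition Y w k := B (y (2, (w, k))).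
Definition Z k := B (z (2, (lit k, k))).
Definition U k := B (u (2, (lit k, k))).
Definition G k := B (y (3, ((0, 0), k))).

Lemma sum_flow_sum phi : (\sum_(d <- descs) flow_sum phi d =
  \sum_(i <- iota 0 (nv I)) p * (phi (cS i) - phi cTp) +
  \sum_(j <- iota 0 (nc I)) q * (phi (cS' j) - phi cTq) +
  \sum_(t <- arcs) Y t.1 t.2 * p * (phi (cND t.1 t.2.+1) - phi (cND t.1 t.2)) +
  \sum_(k <- iota 0 nocc) (Z k * q * (phi cTq - phi (cX mg k)) +
      U k * p * (phi (cND (lit k) k.+1) - phi (cX mg k))) +
  \sum_(k <- iota 0 nocc) G k * q * (phi (cX mg k) - phi (cS' (cla k))))%R.
Proof.
rewrite sum_descs; congr (_ + _)%R; last first.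
  by apply: eq_bigr => k _; rewrite /flow_sum /flow /= !big_cons big_nil /G /=; ring.
rewrite -[RHS]addrA; congr (_ + _)%R.
  by congr (_ + _)%R; apply: eq_bigr => k _; rewrite /flow_sum /flow /= !big_cons big_nil /=; ring.
rewrite -(sum_crossing (fun t => B (z (2, t)) * q * (phi cTq - phi (cX mg t.2)) +
   B (u (2, t)) * p * (phi (cND t.1 t.2.+1) - phi (cX mg t.2)))%R).
rewrite [X in (_ + X)%R]big_mkcond -big_split /=; apply: eq_bigr => -[w k] _.
rewrite /flow_sum /flow /=; case: ifP => _; rewrite ?big_cat /= !big_cons big_nil /Y /=; ring.
Qed.

Hypothesis excl : forall k, k < nocc -> ~~ (y (2, (lit k, k)) && z (2, (lit k, k))).
Hypothesis zero : forall phi, (\sum_(d <- descs) flow_sum phi d = 0)%R.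

Lemma cN_ge w k : 3 + nv I + nc I + nocc <= cN w k.
Proof. exact: leq_addr. Qed.

Lemma cND_range (P : pred nat) (w : wire) k : w \in wires ->
  (forall x, 3 + nv I + nc I + nocc <= x -> ~~ P x) -> ~~ P cTp ->
  P (cND w k) = (k == 0) && P (cS w.1).
Proof.
move=> hw h1 h2; rewrite /cND; case: eqP => // _; case: eqP => _; first exact: negbTE.
by apply: negbTE; apply: h1; apply: cN_ge.
Qed.

Lemma cX_range (P : pred nat) k : k < nocc ->
  (forall x, 3 + nv I + nc I <= x -> ~~ P x) -> ~~ P cTp -> P (cX mg k) = false.
Proof.
move=> hk h1 h2; rewrite /cX; case: mg; last by apply: negbTE; apply: h1; apply: leq_addr.
by rewrite cND_range ?lit_wires // => x hx; apply: h1; apply: leq_trans hx; apply: leq_addr.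
Qed.

Lemma sum_const_nat (c : int) n : (\sum_(i <- iota 0 n) c = c * n%:Z)%R.
Proof. by rewrite big_const_seq count_predT size_iota iter_addr_0 -mulr_natr natz. Qed.

(** The balance equation for one weight, its five kinds of terms left to be evaluated separately.
    The balances below are instances with indicators of suitable sets. *)
Lemma flow_sum_eq (phi F1 F2 : nat -> int) (F3 : wire * nat -> int) (F4 F5 : nat -> int) :
  (forall i, (i < nv I)%N -> p * (phi (cS i) - phi cTp) = F1 i)%R ->
  (forall j, (j < nc I)%N -> q * (phi (cS' j) - phi cTq) = F2 j)%R ->
  (forall w k, w \in wires -> (k <= nocc)%N ->
     Y w k * p * (phi (cND w k.+1) - phi (cND w k)) = F3 (w, k))%R ->
  (forall k, (k < nocc)%N -> Z k * q * (phi cTq - phi (cX mg k)) +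
      U k * p * (phi (cND (lit k) k.+1) - phi (cX mg k)) = F4 k)%R ->
  (forall k, (k < nocc)%N -> G k * q * (phi (cX mg k) - phi (cS' (cla k))) = F5 k)%R ->
  (\sum_(i <- iota 0 (nv I)) F1 i + \sum_(j <- iota 0 (nc I)) F2 j + \sum_(t <- arcs) F3 t +
   \sum_(k <- iota 0 nocc) F4 k + \sum_(k <- iota 0 nocc) F5 k = 0)%R.
Proof.
move=> h1 h2 h3 h4 h5; rewrite -[RHS](zero phi) sum_flow_sum.
congr (_ + _ + _ + _ + _)%R; apply: eq_big_seq => x.
- by rewrite mem_iota0 => /h1.
- by rewrite mem_iota0 => /h2.
- by case: x => w k; rewrite mem_arcs => /andP[/h3 h /h].
- by rewrite mem_iota0 => /h4.
by rewrite mem_iota0 => /h5.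
Qed.

Let none {T : Type} (x : T) : int := 0%R.

Lemma sum_none (T : Type) (s : seq T) : (\sum_(x <- s) none x = 0)%R.
Proof. exact: big1_eq. Qed.

(** Balance of the set of all clause sources: each is fed [q], and points leave the set only towards
    occurrences. *)
Lemma total_G : (\sum_(k <- iota 0 nocc) G k = (nc I)%:Z)%R.
Proof.
pose P x := (3 + nv I <= x) && (x < 3 + nv I + nc I).
have hx x : 3 + nv I + nc I <= x -> ~~ P x by rewrite /P; lia.
have hx' x : 3 + nv I + nc I + nocc <= x -> ~~ P x by move=> h; apply: hx; lia.
have nS i : i < nv I -> P (cS i) = false by rewrite /P /cS; lia.
have nS' i : i < nc I -> P (cS' i) = true by rewrite /P /cS'; lia.
have nND w k : w \in wires -> P (cND w k) = false.
  move=> hw; rewrite cND_range //; have := hw; rewrite mem_wires => /andP[h _].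
  by rewrite nS ?andbF.
have h := @flow_sum_eq (fun x => B (P x)) none (fun _ => q) none none (fun k => - q * G k)%R.
have {h} := h _ _ _ _ _; rewrite !sum_none sum_const_nat -big_distrr /= => h.
have {h} : (q * (\sum_(k <- iota 0 nocc) G k - (nc I)%:Z) = 0)%R.
  apply/eqP; rewrite -oppr_eq0; apply/eqP; rewrite -[RHS]h //; first by ring.
  + by move=> i hi; rewrite nS // subrr mulr0.
  + by move=> i hi; rewrite nS' // subr0 mulr1.
  + by move=> w k hw hk; rewrite !nND // subrr mulr0.
  + by move=> k hk; rewrite cX_range // nND ?lit_wires // subrr !mulr0.
  by move=> k hk; rewrite cX_range // nS' ?cla_lt // /B /=; ring.
by move/eqP; rewrite mulf_eq0 (gt_eqF q0) subr_eq0 => /eqP.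
Qed.

(** Balance of the sink [cTq]: it loses [q] for every clause and is repaid only at crossings. *)
Lemma total_Z : (\sum_(k <- iota 0 nocc) Z k = (nc I)%:Z)%R.
Proof.
pose P x := (x == cTq).
have hx x : 3 + nv I + nc I <= x -> ~~ P x by rewrite /P /cTq; lia.
have hx' x : 3 + nv I + nc I + nocc <= x -> ~~ P x by move=> h; apply: hx; lia.
have nND w k : w \in wires -> P (cND w k) = false.
  by move=> hw; rewrite cND_range // andbF.
have h := @flow_sum_eq (fun x => B (P x)) none (fun _ => - q)%R none (fun k => q * Z k)%R none.
have {h} := h _ _ _ _ _; rewrite !sum_none sum_const_nat -big_distrr /= => h.
have {h} : (q * (\sum_(k <- iota 0 nocc) Z k - (nc I)%:Z) = 0)%R.
  apply/eqP; rewrite -[X in _ == X]h //; first by apply/eqP; ring.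
  + by move=> i hi; rewrite /P /= subrr mulr0.
  + by move=> i hi; rewrite /P eqxx /B /=; ring.
  + by move=> w k hw hk; rewrite !nND // subrr mulr0.
  + by move=> k hk; rewrite cX_range // nND ?lit_wires // /P eqxx /B /=; ring.
  by move=> k hk; rewrite cX_range // /P /B /=; ring.
by move/eqP; rewrite mulf_eq0 (gt_eqF q0) subr_eq0 => /eqP.
Qed.

(** Balance of the node behind slot [k], taken together with [cX] if the occurrence [k] lies on this
    wire. The leak [U] runs between these two candidates, so it stays inside the set and drops
    out. *)
Lemma conserve (w : wire) k : w \in wires -> k < nocc ->
  (p * (Y w k - Y w k.+1) + B (lit k == w) * q * (G k - Z k) = 0)%R.
Proof.
move=> hw hk.
pose P x := (x == cN w k.+1) || ((lit k == w) && (x == cX mg k)).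
have low x : x < 3 + nv I + nc I -> P x = false.
  move=> hx; rewrite /P (_ : (x == cN w k.+1) = false) /=; last first.
    by apply/eqP => e; have := cN_ge w k.+1; rewrite -e; lia.
  apply/andP => -[_ /eqP e]; move: hx; rewrite e /cX; case: mg; last by rewrite /cC; lia.
  rewrite /cND /= eqSS (ltn_eqF hk); have := cN_ge (lit k) k.+1; lia.
have PN (w' : wire) k' : w' \in wires -> k' <= nocc.+1 -> P (cND w' k') = ((w', k') == (w, k.+1)).
  move=> hw' hk'; rewrite /cND; case: eqP => [->|k0].
    rewrite xpair_eqE andbF low //; have := hw'; rewrite mem_wires => /andP[h _]; rewrite /cS; lia.
  case: eqP => [->|kR].
    by rewrite xpair_eqE eqSS (gtn_eqF hk) andbF low.
  have eqN : (cN w' k' == cN w k.+1) = ((w', k') == (w, k.+1)).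
    apply/eqP/eqP => [|[-> ->] //]; apply: cN_inj => //; lia.
  rewrite /P eqN; case: (eqVneq (lit k) w) => [e|_] /=; last by rewrite orbF.
  rewrite /cX; case: mg; last first.
    rewrite (_ : (cN w' k' == cC k) = false) ?orbF //; apply/eqP => e'.
    by have := cN_ge w' k'; rewrite e' /cC; lia.
  by rewrite /cND /= eqSS (ltn_eqF hk) e eqN orbb.
have PX k' : k' < nocc -> P (cX mg k') = (lit k == w) && (k' == k).
  move=> hk'; case E : mg; rewrite /cX.
    rewrite PN ?lit_wires // ?ltnS ?(ltnW hk') // xpair_eqE eqSS.
    by case: (eqVneq k' k) => [->|]; rewrite ?andbF.
  rewrite /P E (_ : (cC k' == cN w k.+1) = false) /=; first by rewrite /cC eqn_add2l.
  by apply/eqP => e; have := cN_ge w k.+1; rewrite -e /cC; lia.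
have h := @flow_sum_eq (fun x => B (P x)) none none
  (fun t => Y t.1 t.2 * p * ((t == (w, k)) : nat)%:Z - Y t.1 t.2 * p * ((t == (w, k.+1)) : nat)%:Z)%R
  (fun k' => - (B (lit k == w) * Z k' * q) * ((k' == k) : nat)%:Z)%R
  (fun k' => (B (lit k == w) * G k' * q) * ((k' == k) : nat)%:Z)%R.
have {h} := h _ _ _ _ _; rewrite !sum_none sumrB !sum_pick ?uniq_arcs ?iota_uniq ?mem_iota0 ?mem_arcs ?hw ?(ltnW hk) //= => h.
rewrite -[RHS]h; first by ring.
- by move=> i hi; rewrite !low ?subrr ?mulr0 // /cS; lia.
- by move=> i hi; rewrite !low ?subrr ?mulr0 // /cS'; lia.
- move=> w' k' h1 h2; rewrite !PN //; last by rewrite ltnW.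
  by rewrite ![(_, _) == (_, _)]xpair_eqE eqSS /B; ring.
- move=> k' h'; rewrite PN ?lit_wires // ?ltnS ?(ltnW h') // PX //.
  rewrite (low cTq) // xpair_eqE eqSS /B; case: (eqVneq k' k) => [->|_]; rewrite ?andbT ?andbF /=; ring.
move=> k' h'; rewrite PX // (low (cS' _)).
  by rewrite /B; case: (eqVneq k' k) => [->|_]; rewrite ?andbT ?andbF /=; ring.
by have := cla_lt h'; rewrite /cS'; lia.
Qed.

(** Balance of the candidate [cS i]: the [p] points fed to it can leave only by the first arc of one
    of its wires. *)
Lemma source i : i < nv I -> exists v, (i, v) \in wires /\ y (2, ((i, v), 0)).
Proof.
move=> hi; pose P x := (x == cS i).
have hx x : 3 + nv I <= x -> ~~ P x by rewrite /P /cS; lia.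
have hx1 x : 3 + nv I + nc I <= x -> ~~ P x by move=> h; apply: hx; lia.
have hx2 x : 3 + nv I + nc I + nocc <= x -> ~~ P x by move=> h; apply: hx; lia.
have nS' j : P (cS' j) = false by apply: negbTE; apply: hx; rewrite /cS'; lia.
have h := @flow_sum_eq (fun x => B (P x)) (fun j => p * ((j == i) : nat)%:Z)%R none
  (fun t => - p * (Y t.1 t.2 * B ((t.2 == 0) && (t.1.1 == i))))%R none none.
have {h} := h _ _ _ _ _; rewrite !sum_none sum_pick ?iota_uniq ?mem_iota0 // -big_distrr /= !addr0.
set S := (\sum_(t <- arcs) _)%R => h.
have {h} H : (p + - p * S = 0)%R.
  apply: h.
  + by move=> j _; rewrite /P /cS eqn_add2l /= subr0.
  + by move=> j _; rewrite nS' // subrr mulr0.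
  + by move=> w k hw hk; rewrite !cND_range // /P /cS eqn_add2l /B /=; ring.
  + by move=> k hk; rewrite cX_range // cND_range ?lit_wires //= subrr !mulr0.
  by move=> k hk; rewrite cX_range // nS' subrr mulr0.
case: (boolP (has (fun t => [&& y (2, t), t.2 == 0 & t.1.1 == i]) arcs)) => [/hasP[[[i' v] k]]|/hasPn hn].
  rewrite mem_arcs => /andP[/= hw _] /and3P[hy /eqP e1 /eqP e2]; exists v.
  by rewrite -e2 -{2}e1.
exfalso; move: p0; have -> : (p = 0)%R; last by rewrite ltxx.
rewrite -[RHS]H /S big_seq big1 ?mulr0 ?addr0 //.
move=> t /hn; rewrite /Y -surjective_pairing; case: (y (2, t)) => /=; last by rewrite mul0r.
by move=> /negbTE ->; rewrite mulr0.
Qed.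

Lemma clause_source j : j < nc I -> exists k, [/\ k < nocc, cla k = j & y (3, ((0, 0), k))].
Proof.
move=> hj; pose P x := (x == cS' j).
have nS i : i < nv I -> P (cS i) = false by rewrite /P /cS /cS'; lia.
have hx x : 3 + nv I + nc I <= x -> ~~ P x by rewrite /P /cS'; lia.
have hx2 x : 3 + nv I + nc I + nocc <= x -> ~~ P x by move=> h; apply: hx; lia.
have nT : P cTp = false by rewrite /P /cS' /cTp; lia.
have nT' : P cTq = false by rewrite /P /cS' /cTq; lia.
have nND w k : w \in wires -> P (cND w k) = false.
  move=> hw; rewrite cND_range // ?nT //; have := hw; rewrite mem_wires => /andP[h _].
  by rewrite nS ?andbF.
have h := @flow_sum_eq (fun x => B (P x)) none (fun i => q * ((i == j) : nat)%:Z)%R none none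
  (fun k => - q * (G k * B (cla k == j)))%R.
have {h} := h _ _ _ _ _; rewrite !sum_none sum_pick ?iota_uniq ?mem_iota0 // -big_distrr /= !addr0 add0r.
set S := (\sum_(k <- iota 0 nocc) _)%R => h.
have {h} H : (q + - q * S = 0)%R.
  apply: h.
  + by move=> i hi; rewrite nS // nT subrr mulr0.
  + by move=> i hi; rewrite nT' /P /cS' eqn_add2l /= subr0.
  + by move=> w k hw hk; rewrite !nND // subrr mulr0.
  + by move=> k hk; rewrite cX_range // ?nT // nND ?lit_wires // nT' subrr !mulr0.
  by move=> k hk; rewrite cX_range // ?nT // /P /cS' eqn_add2l /B /=; ring.
case: (boolP (has (fun k => y (3, ((0, 0), k)) && (cla k == j)) (iota 0 nocc))) => [/hasP[k]|/hasPn hn].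
  by rewrite mem_iota0 => hk /andP[hy /eqP e]; exists k.
exfalso; move: q0; have -> : (q = 0)%R; last by rewrite ltxx.
rewrite -[RHS]H /S big_seq big1 ?mulr0 ?addr0 //.
move=> k /hn; rewrite /G; case: (y _) => /=; last by rewrite mul0r.
by move=> /negbTE ->; rewrite mulr0.
Qed.

(** If clause points cross at [k], then by exclusion no wire points arrive there, and [conserve]
    reads [q * (G k - 1) = p * Y (lit k) k.+1], whose right side is nonnegative. *)
Lemma Z_le_G k : k < nocc -> (Z k <= G k)%R.
Proof.
move=> hk; have := conserve (lit_wires hk) hk; have := excl hk.
rewrite eqxx /Y /Z /G; case: (z _) => /=; last by case: (y _).
rewrite andbT => /negbTE ->; case: (y (3, _)) => //=; rewrite /B /=.
have : (0 <= p * ((y (2, (lit k, k.+1)) : nat)%:Z))%R by apply: mulr_ge0 => //; apply: ltW.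
move: (p * _)%R => X; lia.
Qed.

(** The differences [G k - Z k] are nonnegative, and by [total_G] and [total_Z] they sum to zero.
    Hence no points change from one kind to the other, even if [p] equals [q]. *)
Lemma Z_eq_G k : k < nocc -> Z k = G k.
Proof.
move=> hk; have : (\sum_(k <- iota 0 nocc) (G k - Z k) = 0)%R by rewrite sumrB total_G total_Z subrr.
rewrite big_seq => /eqP; rewrite psumr_eq0; last first.
  by move=> i; rewrite mem_iota0 => hi; rewrite subr_ge0 Z_le_G.
move=> /allP /(_ k); rewrite mem_iota0 hk => /(_ isT) /=; rewrite subr_eq0 => /eqP.
by move=> ->.
Qed.

Lemma Y_const (w : wire) k : w \in wires -> k <= nocc -> Y w k = Y w 0.
Proof.
move=> hw; elim: k => // k IH hk; rewrite -IH 1?ltnW //.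
have := conserve hw hk; rewrite (Z_eq_G hk) subrr mulr0 addr0 => /eqP.
by rewrite mulf_eq0 (gt_eqF p0) /= subr_eq0 => /eqP.
Qed.

(** A variable takes the value of a wire that is open at its source, and such a wire is open
    throughout by [Y_const]. Were the occurrence used by a clause on this wire, its crossing would
    transmit both flows. *)
Theorem flow_choice : choice_sat.
Proof.
pose f i := find (fun v => y (2, ((i, v), 0))) (iota 0 (nk I)).
have hf i : i < nv I -> f i < nk I /\ y (2, ((i, f i), 0)).
  move=> hi; have [v [hv yv]] := source hi.
  have h : has (fun v => y (2, ((i, v), 0))) (iota 0 (nk I)).
    apply/hasP; exists v => //; rewrite mem_iota0.
    by move: hv; rewrite mem_wires => /andP[].
  have := h; rewrite has_find size_iota => l; split=> //.
  by have := nth_find 0 h; rewrite nth_iota.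
exists f; first by move=> i /hf[].
move=> j /clause_source[k [hk ek yk]].
exists (nth (0, (0, 0)) (occ I) k); first exact: mem_nth.
split=> // e; have hw := lit_wires hk.
have := hw; rewrite mem_wires => /andP[/hf[_ yf] _].
have el : lit k = ((lit k).1, f (lit k).1) by rewrite {1}[lit k]surjective_pairing; congr pair.
have zk : z (2, (lit k, k)).
  by have := Z_eq_G hk; rewrite /Z /G yk; case: (z _).
have := excl hk; rewrite zk andbT => /negP; apply.
have yl : y (2, (lit k, 0)) by rewrite el.
by have := Y_const hw (ltnW hk); rewrite /Y yl; case: (y _).
Qed.
End flow.
End codes.

Lemma telescope_iota (F : nat -> int) n :
  (\sum_(k <- iota 0 n) (F k.+1 - F k) = F n - F 0)%R.
Proof.
elim: n => [|n IH]; first by rewrite big_nil subrr.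
by rewrite -addn1 iotaD big_cat IH /= big_seq1 add0n addn1; ring.
Qed.

Section converse.
Variable I : network.
Hypothesis wf : wf_net I.
Variables (mg : bool) (p q : int) (f : nat -> nat).
Hypothesis fK : forall i, i < nv I -> f i < nk I.
Hypothesis fS : forall j, j < nc I ->
  exists2 o : occurrence, o \in occ I & o.1 = j /\ f o.2.1 <> o.2.2.

(** A clause may be satisfied by several of its literals, but it has points for one only; the first
    of them is selected. *)
Definition falsified j := find (fun o : occurrence => (o.1 == j) && (f o.2.1 != o.2.2)) (occ I).
Definition chosen k := k == falsified (cla I k).
Definition ysol (d : desc) : bool :=
  if d.1 == 2 then f d.2.1.1 == d.2.1.2 else chosen d.2.2.
Definition zsol (d : desc) : bool := chosen d.2.2.

Lemma falsifiedP j : j < nc I -> [/\ falsified j < nocc I, cla I (falsified j) = j &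
  f (lit I (falsified j)).1 != (lit I (falsified j)).2].
Proof.
case/fS => o ho [e1 e2].
have h : has (fun o : occurrence => (o.1 == j) && (f o.2.1 != o.2.2)) (occ I).
  by apply/hasP; exists o => //; apply/andP; split; apply/eqP.
have := nth_find (0, (0, 0)) h => /andP[/eqP h1 h2].
by split=> //; rewrite /falsified /nocc -has_find.
Qed.

Lemma sol_excl k : k < nocc I -> ~~ (ysol (2, (lit I k, k)) && zsol (2, (lit I k, k))).
Proof.
move=> hk; rewrite /ysol /zsol /= /chosen; apply/negP => /andP[/eqP e1 /eqP e2].
have [_ _] := falsifiedP (cla_lt wf hk); by rewrite -e2 e1 eqxx.
Qed.

Lemma sum_chosen (F : nat -> int) :
  (\sum_(k <- iota 0 (nocc I)) ((chosen k : nat)%:Z * F (cla I k)) = \sum_(j <- iota 0 (nc I)) F j)%R.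
Proof.
transitivity (\sum_(j <- iota 0 (nc I)) \sum_(k <- iota 0 (nocc I)) F j * ((k == falsified j) : nat)%:Z)%R; last first.
  apply: eq_big_seq => j; rewrite mem_iota0 => hj; have [h1 _ _] := falsifiedP hj.
  by rewrite (sum_pick (fun _ => F j)) ?iota_uniq ?mem_iota0.
rewrite exchange_big /=; apply: eq_big_seq => k; rewrite mem_iota0 => hk.
rewrite (eq_big_seq (fun j => (chosen k : nat)%:Z * F (cla I k) * ((j == cla I k) : nat)%:Z)%R).
  by rewrite (sum_pick (fun _ => _ * _)%R) ?iota_uniq ?mem_iota0 ?cla_lt.
move=> j; rewrite mem_iota0 => hj; have [_ h2 _] := falsifiedP hj.
case: (eqVneq j (cla I k)) => [->|ne] /=; first by rewrite /chosen mulr1 mulrC.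
rewrite mulr0; case: eqP => [e|]; last by rewrite mulr0.
by case/eqP: ne; rewrite e h2.
Qed.

(** Along the wire selected for a variable the sum telescopes from its source to [cTp]; every clause
    sends its points through its selected occurrence to [cTq]. Both cancel what was fed in. *)
Lemma converse_zero phi :
  (\sum_(d <- descs I) flow_sum I mg p q ysol zsol (fun _ => false) phi d = 0)%R.
Proof.
rewrite sum_flow_sum //.
have -> : (\sum_(t <- arcs I) Y ysol t.1 t.2 * p * (phi (cND I t.1 t.2.+1) - phi (cND I t.1 t.2)) =
   \sum_(i <- iota 0 (nv I)) p * (phi cTp - phi (cS i)))%R.
  rewrite /arcs big_allpairs /= /wires big_allpairs /=; apply: eq_big_seq => i; rewrite mem_iota0 => hi.
  rewrite -(sum_pick (fun _ => p * (phi cTp - phi (cS i)))%R (iota_uniq 0 (nk I)) (_ : f i \in _)); last first.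
    by rewrite mem_iota0 fK.
  apply: eq_bigr => v _.
  rewrite (eq_bigr (fun k => (f i == v : nat)%:Z * p * (phi (cND I (i, v) k.+1) - phi (cND I (i, v) k)))%R) //.
  have T := telescope_iota (fun k => phi (cND I (i, v) k)) (nocc I).+1; cbv beta in T.
  rewrite -big_distrr T eq_sym.
  rewrite {1}/cND /= eqxx /cND /=; case: (v == f i) => /=; ring.
rewrite [X in (_ + X + _)%R](eq_bigr (fun k => (chosen k : nat)%:Z * (q * (phi cTq - phi (cX I mg k))))%R); last first.
  by move=> k _; rewrite /Z /U /zsol /=; ring.
rewrite [X in (_ + X)%R](eq_bigr (fun k => (chosen k : nat)%:Z * (q * (phi (cX I mg k) - phi (cS' I (cla I k)))))%R); last first.
  by move=> k _; rewrite /G /ysol /=; ring.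
rewrite -addrA -big_split /=.
rewrite [X in (_ + X)%R](eq_bigr (fun k => (chosen k : nat)%:Z * (q * (phi cTq - phi (cS' I (cla I k)))))%R); last first.
  by move=> k _; ring.
rewrite (sum_chosen (fun j => q * (phi cTq - phi (cS' I j)))%R).
have quad (a b c d : int) : (a + c = 0 -> b + d = 0 -> a + b + c + d = 0)%R by lia.
by apply: quad; rewrite -big_split /= big1 // => i _; ring.
Qed.
End converse.

(** The form in which the scoring vector enters the crossings: two successive drops for
    [merged_group], or, with [hp = hq], one drop between two pairs of equal scores for
    [split_group]. *)
Definition drops (s : seq nat) m (mg : bool) hp hq :=
  [/\ nth 0 s hp.+1 < nth 0 s hp, nth 0 s hq.+1 < nth 0 s hq, hp.+1 < m, hq.+1 < m &
    if mg then hp < hq /\ forall j, hp < j -> j <= hq -> nth 0 s j = nth 0 s hp.+1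
    else hp = hq /\ [/\ 0 < hp, hp.+2 < m, nth 0 s (hp - 1) = nth 0 s hp &
      nth 0 s hp.+2 = nth 0 s hp.+1]].

Section groups.
Variable I : network.
Hypothesis wf : wf_net I.
Variables (s : seq nat) (m : nat) (mg : bool) (hp hq : nat).
Hypothesis hd : drops s m mg hp hq.
Hypothesis hm : ncodes I <= m.

Let p : int := ((nth 0 s hp)%:Z - (nth 0 s hp.+1)%:Z)%R.
Let q : int := ((nth 0 s hq)%:Z - (nth 0 s hq.+1)%:Z)%R.

Definition grp (d : desc) : group :=
  let: (w, k) := d.2 in
  if d.1 == 0 then setup_group m hp (cS w.1) cTp
  else if d.1 == 1 then setup_group m hq (cS' I w.1) cTq
  else if d.1 == 2 then
    if crossing I d.2 then
      if mg then merged_group m hp hq (cND I w k) (cND I w k.+1) cTq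
      else split_group m hp (cND I w k) cTq (cC I k) (cND I w k.+1)
    else arc_group m hp (cND I w k) (cND I w k.+1)
  else arc_group m hq (cS' I (cla I k)) (cX I mg k).

Definition ysel (d : desc) (P : rel nat) : bool :=
  let: (w, k) := d.2 in
  if d.1 == 2 then
    if crossing I d.2 && ~~ mg then P (cC I k) (cND I w k) && P (cND I w k.+1) (cND I w k)
    else P (cND I w k.+1) (cND I w k)
  else P (cX I mg k) (cS' I (cla I k)).
Definition zsel (d : desc) (P : rel nat) : bool :=
  let: (w, k) := d.2 in
  if mg then P cTq (cND I w k.+1) else P cTq (cC I k) && P cTq (cND I w k.+1).
Definition usel (d : desc) (P : rel nat) : bool :=
  let: (w, k) := d.2 in
  [&& ~~ mg, ~~ ysel d P, ~~ zsel d P & P (cND I w k.+1) (cC I k)].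

Lemma desc_ind (Q : desc -> Prop) :
  (forall i, i < nv I -> Q (0, ((i, 0), 0))) -> (forall j, j < nc I -> Q (1, ((j, 0), 0))) ->
  (forall w k, w \in wires I -> k <= nocc I -> Q (2, (w, k))) ->
  (forall k, k < nocc I -> Q (3, ((0, 0), k))) -> forall d, d \in descs I -> Q d.
Proof.
move=> h1 h2 h3 h4 d; rewrite !mem_cat => /or4P[] /mapP[t ht ->].
- by apply: h1; rewrite mem_iota0 in ht.
- by apply: h2; rewrite mem_iota0 in ht.
- by case: t ht => w k; rewrite mem_arcs => /andP[h h']; apply: h3.
by apply: h4; rewrite mem_iota0 in ht.
Qed.

Lemma cND_neq (w : wire) k : w \in wires I -> k <= nocc I -> cND I w k != cND I w k.+1.
Proof.
rewrite mem_wires => /andP[h _] hk; rewrite /cND /= eqSS; apply/eqP.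
have a1 := cN_ge I w k; have a2 := cN_ge I w k.+1.
rewrite (ltn_eqF (_ : k < (nocc I).+1)) //.
case: (k =P 0) => k0; case: (k =P nocc I) => kR; rewrite /cS /cTp; try lia.
by rewrite /cN => /addnI/addnI; lia.
Qed.

Lemma cND_Tq (w : wire) k : w \in wires I -> cND I w k != cTq.
Proof.
move=> hw; rewrite /cND /cS /cTq /cTp; have := cN_ge I w k.
by case: (k =P 0) => _; case: (k =P (nocc I).+1) => _; lia.
Qed.

Lemma cC_neq (w : wire) k k' : w \in wires I -> k' < nocc I -> cC I k' != cND I w k.
Proof.
rewrite mem_wires => /andP[h _] h'; rewrite /cND /cS /cC /cTp; have := cN_ge I w k.
by case: (k =P 0) => _; case: (k =P (nocc I).+1) => _; lia.
Qed.

Lemma ND_lt_m (w : wire) k : w \in wires I -> k <= nocc I -> cND I w k < m /\ cND I w k.+1 < m.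
Proof.
move=> hw hk; have /andP[_ h1] := cND_lt hw (leqW hk).
by have /andP[_ h2] := @cND_lt I w k.+1 hw hk; split; apply: leq_trans hm.
Qed.

Lemma cross_uniq (w : wire) k : w \in wires I -> k < nocc I ->
  uniq [:: cND I w k; cTq; cC I k; cND I w k.+1].
Proof.
move=> hw hk; have n1 := cND_neq hw (ltnW hk); have n2 := cND_Tq k hw; have n3 := cND_Tq k.+1 hw.
have n4 := cC_neq k hw hk; have n5 := cC_neq k.+1 hw hk.
have n6 : cTq != cC I k by rewrite /cC /cTq; apply/eqP; lia.
rewrite cons_uniq cons_uniq cons_uniq !inE !negb_or n1 n2 n5 n6 /= andbT.
by rewrite [_ == cC I k]eq_sym n4 eq_sym n3.
Qed.

Lemma cross_lt (w : wire) k : w \in wires I -> k < nocc I ->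
  all (fun x => x < m) [:: cND I w k; cTq; cC I k; cND I w k.+1].
Proof.
move=> hw hk; have [h1 h2] := ND_lt_m hw (ltnW hk); rewrite /= h1 h2 andbT /=.
have := ncodes_ge I; rewrite /cTq /cC; lia.
Qed.

Lemma crossE (w : wire) k : w \in wires I -> crossing I (w, k) -> k < nocc I /\ lit I k = w.
Proof. by move=> hw /andP[/= h /eqP]. Qed.

Lemma merged_uniq (w : wire) k : w \in wires I -> k < nocc I ->
  uniq [:: cND I w k; cND I w k.+1; cTq] /\ all (fun x => x < m) [:: cND I w k; cND I w k.+1; cTq].
Proof.
move=> hw hk; have := cross_uniq hw hk; have := cross_lt hw hk.
rewrite /= !inE !negb_or => /and4P[-> -> _ ->] /and4P[/and3P[-> _ ->] /andP[_ h] _ _].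
by rewrite eq_sym h.
Qed.

Lemma grp_valid d : d \in descs I -> gvalid m (grp d).
Proof.
have nge := ncodes_ge I.
move: d; apply: (@desc_ind (fun d => gvalid m (grp d))) => [i hi|j hj|w k hw hk|k hk]; rewrite /grp /=.
- by apply: setup_valid; rewrite /cS /cTp; lia.
- by apply: setup_valid; rewrite /cS' /cTq; lia.
- case: ifP => [/(crossE hw)[hk' _]|_]; last first.
    by have [h1 h2] := ND_lt_m hw hk; apply: arc_valid => //; apply: cND_neq.
  case: mg; first by have [h1 h2] := merged_uniq hw hk'; apply: merged_valid.
  by apply: split_valid; [apply: cross_uniq|apply: cross_lt].
apply: arc_valid.
- rewrite /cX; case: mg; last by rewrite /cC /cS'; have := cla_lt wf hk; lia.
  rewrite /cND /= eqSS (ltn_eqF hk); have := cN_ge I (lit I k) k.+1; have := cla_lt wf hk; rewrite /cS'; lia.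
- by have := cla_lt wf hk; rewrite /cS'; lia.
by have /andP[_ h] := cX_lt wf mg hk; apply: leq_trans hm.
Qed.

Lemma grp_delta d P v : d \in descs I -> realises m (grp d) P -> v < m ->
  gdelta s m (grp d) P v =
  flow_sum I mg p q (fun d => ysel d P) (fun d => zsel d P) (fun d => usel d P) (fun c => indic c v) d.
Proof.
have nge := ncodes_ge I; have [d1 d2 hpm hqm hmg] := hd.
move=> hdd [lP eP] vm; move: d hdd eP.
apply: (@desc_ind (fun d => extends_on m (gfirst (grp d)) P -> gdelta s m (grp d) P v =
  flow_sum I mg p q (fun d => ysel d P) (fun d => zsel d P) (fun d => usel d P) (fun c => indic c v) d)) => [i hi|j hj|w k hw hk|k hk]; rewrite /grp /flow_sum /flow /= => eP.
- rewrite (setup_delta s lP _ _ _ hpm eP vm) ?big_cons ?big_nil /=; try by rewrite /cS /cTp; lia.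
  by rewrite /p; ring.
- rewrite (setup_delta s lP _ _ _ hqm eP vm) ?big_cons ?big_nil /=; try by rewrite /cS' /cTq; lia.
  by rewrite /q; ring.
- have [h1 h2] := ND_lt_m hw hk; have ne := cND_neq hw hk.
  move: eP; rewrite /ysel /zsel /usel /ysel /zsel /=; case: ifP => [/[dup] cr /(crossE hw)[hk' el]|_] eP; last first.
    by rewrite (arc_delta s lP ne h1 h2 hpm eP vm) !big_cons big_nil /p /=; ring.
  move: eP hmg; rewrite /cX el; case: mg => /= eP hmg.
    have [h3 h4] := merged_uniq hw hk'; case: hmg => hmg1 hmg2.
    have mid j : hp < j -> j <= hq -> Posz (nth 0 s j) = Posz (nth 0 s hp.+1) by move=> a b; rewrite hmg2.
    have [_ H] := merged_delta lP h3 h4 hmg1 hqm mid eP.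
    by rewrite H // !big_cons big_nil /= /p /q; ring.
  have := cross_uniq hw hk'; have := cross_lt hw hk' => h4 h3.
  case: hmg => ehq [c1 c2 c3 c4].
  have [_ H] := split_delta lP h3 h4 c1 c2 (congr1 Posz c3) (congr1 Posz c4) eP.
  by rewrite H // !big_cons big_nil /= /p /q -ehq; ring.
have hg := grp_valid (d := (3, ((0, 0), k))).
have lS : cS' I (cla I k) < m by have := cla_lt wf hk; rewrite /cS'; lia.
have lX : cX I mg k < m by have /andP[_ h] := cX_lt wf mg hk; apply: leq_trans hm.
have ne : cS' I (cla I k) != cX I mg k.
  rewrite /cX; case: mg; last by rewrite /cC /cS'; have := cla_lt wf hk; lia.
  rewrite /cND /= eqSS (ltn_eqF hk); have := cN_ge I (lit I k) k.+1; have := cla_lt wf hk; rewrite /cS'; lia.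
by rewrite (arc_delta s lP ne lS lX hqm eP vm) !big_cons big_nil /ysel /= /q; ring.
Qed.

Lemma sel_excl w k P : w \in wires I -> crossing I (w, k) -> realises m (grp (2, (w, k))) P ->
  ~~ (ysel (2, (w, k)) P && zsel (2, (w, k)) P).
Proof.
have [d1 d2 hpm hqm hmg] := hd.
move=> hw cr [lP]; rewrite /grp /ysel /zsel /= cr; have [hk' el] := crossE hw cr.
move: hmg; case: mg => /= hmg eP.
  have [h3 h4] := merged_uniq hw hk'; case: hmg => hmg1 hmg2.
  have mid j : hp < j -> j <= hq -> Posz (nth 0 s j) = Posz (nth 0 s hp.+1) by move=> a b; rewrite hmg2.
  by have [] := merged_delta lP h3 h4 hmg1 hqm mid eP.
case: hmg => ehq [c1 c2 c3 c4].
by have [] := split_delta lP (cross_uniq hw hk') (cross_lt hw hk') c1 c2 (congr1 Posz c3) (congr1 Posz c4) eP.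
Qed.

Lemma grp_real (y z : desc -> bool) d : d \in descs I ->
  (forall w k, w \in wires I -> crossing I (w, k) -> ~~ (y (2, (w, k)) && z (2, (w, k)))) ->
  exists P, realises m (grp d) P /\ forall p q phi,
    flow_sum I mg p q (fun d => ysel d P) (fun d => zsel d P) (fun d => usel d P) phi d =
    flow_sum I mg p q y z (fun _ => false) phi d.
Proof.
have nge := ncodes_ge I.
move=> hdd ex; have hv := grp_valid hdd; move: d hdd hv.
apply: (@desc_ind (fun d => gvalid m (grp d) -> exists P, realises m (grp d) P /\ forall p q phi,
    flow_sum I mg p q (fun d => ysel d P) (fun d => zsel d P) (fun d => usel d P) phi d =
    flow_sum I mg p q y z (fun _ => false) phi d)) => [i hi|j hj|w k hw hk|k hk]; rewrite /grp /flow_sum /flow /= => hv.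
- by have [P hP] := base_real hv; exists P.
- by have [P hP] := base_real hv; exists P.
- have [h1 h2] := ND_lt_m hw hk; have ne := cND_neq hw hk.
  move: hv ex; rewrite /ysel /zsel /usel /ysel /zsel /=; case: ifP => [/[dup] cr /(crossE hw)[hk' el]|_] hv ex; last first.
    have [P [rP e]] := arc_real (m := m) hp (y (2, (w, k))) ne h1 h2.
    by exists P; split=> // p' q' phi; rewrite e.
  move: hv (ex _ _ hw cr); case: mg => /= hv ex'.
    have [h3 h4] := merged_uniq hw hk'.
    have [P [rP [e1 e2]]] := merged_real hp hq h3 h4 ex'.
    by exists P; split=> // p' q' phi; rewrite e1 e2.
  have [P [rP [e1 e2 e3]]] := split_real hp (cross_uniq hw hk') (cross_lt hw hk') ex'.
  by exists P; split=> // p' q' phi; rewrite e1 e2 e3.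
have [n1 n2] : cS' I (cla I k) < m /\ cX I mg k < m.
  have /andP[_ h] := cX_lt wf mg hk; have := cla_lt wf hk.
  by split; [rewrite /cS'; lia|apply: leq_trans hm].
have ne : cS' I (cla I k) != cX I mg k.
  rewrite /cX; case: mg; last by rewrite /cC /cS'; have := cla_lt wf hk; lia.
  rewrite /cND /= eqSS (ltn_eqF hk); have := cN_ge I (lit I k) k.+1; have := cla_lt wf hk; rewrite /cS'; lia.
have [P [rP e]] := arc_real (m := m) hq (y (3, ((0, 0), k))) ne n1 n2.
by exists P; split=> // p' q' phi; rewrite /ysel /= e.
Qed.
End groups.

(** * Rotations of a base order, and the passage to votes over ordinals *)

Lemma index_rot_split (o : seq nat) a k : uniq o -> a \in o -> k <= size o ->
  index a (rot k o) = if k <= index a o then index a o - k else size o - k + index a o.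
Proof.
move=> uo ao hk; rewrite /rot index_cat.
have := cat_take_drop k o => e; have := uo; rewrite -{1}e cat_uniq => /and3P[_ /hasPn nd _].
have st : size (take k o) = k by rewrite size_take; case: ltnP => //; lia.
have ia : index a o = if a \in take k o then index a (take k o) else k + index a (drop k o).
  by rewrite -{1}e index_cat st.
case: ifP => ad.
  have nt : a \notin take k o by apply/negP => h; have := nd _ ad; rewrite h.
  by rewrite ia (negbTE nt) leq_addr addKn.
have at_ : a \in take k o by have := ao; rewrite -{1}e mem_cat ad orbF.
have l : index a (take k o) < k by rewrite -{2}st index_mem.
by rewrite ia at_ leqNgt l /= size_drop.
Qed.

(** Over the [m] rotations a candidate visits every position exactly once. *)
Lemma rot_sum (F : nat -> int) m (o : seq nat) a : perm_eq o (iota 0 m) -> a < m ->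
  (\sum_(k <- iota 0 m) F (index a (rot k o)) = \sum_(k <- iota 0 m) F k)%R.
Proof.
move=> pe am; have uo : uniq o by rewrite (perm_uniq pe) iota_uniq.
have so : size o = m by rewrite (perm_size pe) size_iota.
have ao : a \in o by rewrite (perm_mem pe) mem_iota0.
have il : index a o < m by rewrite -so index_mem.
rewrite -(big_map (fun k => index a (rot k o)) xpredT F); apply: perm_big.
have fe k : k < m -> index a (rot k o) = if k <= index a o then index a o - k else m - k + index a o.
  by move=> hk; rewrite index_rot_split ?so // ltnW.
apply: uniq_perm; rewrite ?iota_uniq //.
  rewrite map_inj_in_uniq ?iota_uniq // => x y; rewrite !mem_iota0 => hx hy.
  by rewrite !fe //; case: ifP => h1; case: ifP => h2; lia.
move=> x; rewrite mem_iota0; apply/mapP/idP => [[k]|hx].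
  by rewrite mem_iota0 => hk ->; rewrite fe //; case: ifP; lia.
case: (leqP x (index a o)) => h.
  exists (index a o - x); first by rewrite mem_iota0; lia.
  by rewrite fe; last lia; case: ifP; lia.
exists (m + index a o - x); first by rewrite mem_iota0; lia.
by rewrite fe; last lia; case: ifP; lia.
Qed.

Lemma iota_blocks m G : iota 0 (G * m) = flatten [seq [seq j * m + k | k <- iota 0 m] | j <- iota 0 G].
Proof.
elim: G => [|G IH]; first by [].
rewrite mulSn addnC iotaD IH add0n -[in RHS]addn1 iotaD map_cat flatten_cat /= cats0 add0n.
by congr (_ ++ _); rewrite -[X in iota X _]addn0 iotaDl.
Qed.

Lemma linear_index m (P : rel nat) o u : linear_on m P -> perm_eq o (iota 0 m) ->
  (forall a b, a < m -> b < m -> index a o < index b o -> P a b) -> u < m ->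
  pos m P u = index u o.
Proof.
move=> hP pe h um; set k := index u o.
have uo : u \in o by rewrite (perm_mem pe) mem_iota0.
have ko : k < size o by rewrite index_mem.
have eo : o = take k o ++ [:: u] ++ drop k.+1 o.
  by rewrite -{1}(cat_take_drop k o) (drop_nth 0) // nth_index.
have uo' : uniq o by rewrite (perm_uniq pe) iota_uniq.
have lt v : v \in o -> v < m by rewrite (perm_mem pe) mem_iota0.
have pe' : perm_eq (take k o ++ [:: u] ++ drop k.+1 o) (iota 0 m) by rewrite -eo.
rewrite (pos_split hP pe' (mem_head _ _)).
- by rewrite /= /above eqxx andbF !addn0 size_take ko.
- move=> b hb; have bo := mem_take hb; apply: h => //; first exact: lt.
  rewrite -/k; have := hb; rewrite -index_mem size_take ko.
  by rewrite -{2}(cat_take_drop k o) index_cat hb.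
- move=> b hb; have bo := mem_drop hb; apply: h => //; first exact: lt.
  rewrite -/k; have := uo'; rewrite {1}eo cat_uniq => /and3P[_ /hasPn n _].
  have nb : b \notin take k o by apply: n; rewrite mem_cat hb orbT.
  have bu : b != u.
    have := uo'; rewrite {1}eo cat_uniq => /and3P[_ _ /=/andP[nd _]].
    by apply: contraNneq nd => <-.
  by rewrite {1}eo index_cat (negbTE nb) /= eq_sym (negbTE bu) size_take ko addnS ltnS leq_addr.
Qed.

(** The partial vote takes the place of the unrotated base order; the other votes of the group are
    the proper rotations. So the group deviates from the common score by [gdelta] alone. *)
Definition gvote (g : group) k : vspec :=
  if k == 0 then gfirst g else (rot k (gbase g), ((0, 0), [::])).

Lemma gbase_perm m g : gvalid m g -> perm_eq (gbase g) (iota 0 m).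
Proof. by case=> pe pw _ _; apply: perm_trans pe; rewrite perm_cat2l perm_cat2r. Qed.

Lemma vless_partial (V : vspec) m : V.2.1.1 <= V.2.1.2 ->
  partial_vote (fun a b : 'I_m => vless V a b).
Proof.
move=> le; have lh u : vlo V u <= vhi V u by rewrite /vlo /vhi; case: ifP.
split=> [b a c|a b]; rewrite /vless.
  by have := lh b; lia.
by case/andP; have := lh a; have := lh b; lia.
Qed.

Section lift.
Variable M : nat.
Let m := M.+1.

Definition lift_rel (L : rel 'I_m) : rel nat := fun u v => L (inord u) (inord v).

Lemma lift_linear (L : rel 'I_m) : linear_vote L -> linear_on m (lift_rel L).
Proof.
case=> tot tr anti; split=> [u v _ _|u v w _ _ _|u v um vm h1 h2].
- exact: tot.
- exact: tr.
by rewrite -(inordK um) -(inordK vm); congr nat_of_ord; apply: anti; rewrite /lift_rel in h1 h2; rewrite h1.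
Qed.

Lemma lift_pos (L : rel 'I_m) (a : 'I_m) : position L a = pos m (lift_rel L) a.
Proof.
rewrite /position /pos cardsE cardE size_filter -val_enum_ord count_map enumT.
by apply: eq_count => b; rewrite /= ?inE /above /lift_rel !inord_val.
Qed.

Definition restr (P : rel nat) : rel 'I_m := fun a b => P a b.

Lemma restr_linear P : linear_on m P -> linear_vote (restr P).
Proof.
case=> tot tr anti; split=> [a b|b a c|a b /andP[h1 h2]].
- exact: (tot _ _ (ltn_ord a) (ltn_ord b)).
- exact: (tr _ _ _ (ltn_ord a) (ltn_ord b) (ltn_ord c)).
by apply: val_inj; apply: (anti _ _ (ltn_ord a) (ltn_ord b) h1 h2).
Qed.

Lemma restr_pos P (a : 'I_m) : position (restr P) a = pos m P a.
Proof.
rewrite lift_pos /pos; apply: eq_in_count => b; rewrite mem_iota0 => hb.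
by rewrite /above /lift_rel /restr inord_val inordK.
Qed.
End lift.

Section instance.
Variables (r : scoring_rule) (I : network).
Hypothesis wf : wf_net I.
Variables (M : nat) (mg : bool) (hp hq : nat).
Let m := M.+1.
Let s : seq nat := r m.
Hypothesis hd : drops s m mg hp hq.
Hypothesis hm : ncodes I <= m.

Let D := descs I.
Let gr d := grp I m mg hp hq d.
Definition pw_vote i : vspec := gvote (gr (nth (0, ((0, 0), 0)) D (i %/ m))) (i %% m).

Lemma pw_vote_partial (i : 'I_(size D * m)) :
  partial_vote (fun a b : 'I_m => vless (pw_vote i) a b).
Proof.
apply: vless_partial; rewrite /pw_vote /gvote; case: ifP => //= _.
have hi : i %/ m < size D by rewrite ltn_divLR.
by have [_ _ _ h] := grp_valid wf s mg hp hq hm (mem_nth (0, ((0, 0), 0)) hi);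
rewrite /gr; move: (size _) h => x; move: (size _) => y; clear; case: x => // x _; rewrite addnS leq_addr.
Qed.

Definition pw_inst : pw_instance := PWInstance pw_vote_partial (ord0 : 'I_m).

Let p : int := (Posz (nth 0 s hp) - Posz (nth 0 s hp.+1))%R.
Let q : int := (Posz (nth 0 s hq) - Posz (nth 0 s hq.+1))%R.

Lemma p_gt0 : (0 < p)%R.
Proof. by case: hd => h _ _ _ _; rewrite /p subr_gt0 ltz_nat. Qed.
Lemma q_gt0 : (0 < q)%R.
Proof. by case: hd => _ h _ _ _; rewrite /q subr_gt0 ltz_nat. Qed.

(* With all rotations of a base order present, a group of votes gives every
   candidate the same total, up to the deviation of its first vote. *)
Lemma score_groups (P : nat -> rel nat) a : a < m ->
  (forall i, i < size D * m -> linear_on m (P i) /\ extends_on m (pw_vote i) (P i)) ->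
  (\sum_(i <- iota 0 (size D * m)) Posz (nth 0 s (pos m (P i) a)) =
   \sum_(d <- D) (gdelta s m (gr d) (P (index d D * m)) a) +
   (size D)%:Z * \sum_(k <- iota 0 m) Posz (nth 0 s k))%R.
Proof.
move=> am hP; rewrite iota_blocks big_flatten big_map.
rewrite (eq_big_seq (fun j => gdelta s m (gr (nth (0, ((0, 0), 0)) D j)) (P (j * m)) a +
   \sum_(k <- iota 0 m) Posz (nth 0 s k))%R); last first.
  move=> j; rewrite mem_iota0 => hj; rewrite big_map.
  set g := gr _; have vg : gvalid m g := grp_valid wf s mg hp hq hm (mem_nth _ hj).
  rewrite -(rot_sum (fun k => Posz (nth 0 s k)) (gbase_perm vg) am) /gdelta.
  rewrite /m /= !big_cons addn0 rot0 addrA subrK; congr (_ + _)%R.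
  apply: eq_big_seq => k; rewrite mem_iota => /andP[k0 kM]; congr (Posz (nth _ _ _)).
  have jk : j * m + k < size D * m.
    by apply: leq_trans (_ : j.+1 * m <= _); rewrite ?leq_mul2r ?hj ?orbT // mulSn addnC ltn_add2r.
  have [l e] := hP _ jk; apply: linear_index => //.
    by apply: perm_trans (gbase_perm vg); rewrite perm_rot.
  move=> u v um vm lt; apply: e => //.
  have kM' : k < m by [].
  rewrite /pw_vote divnMDl // divn_small // addn0 modnMDl modn_small // -/(gr _) -/g /gvote.
  by rewrite gtn_eqF.
rewrite big_split /= sum_const_nat mulrC; congr (_ + _)%R.
rewrite (big_nth (0, ((0, 0), 0))) /index_iota subn0; apply: eq_big_seq => j; rewrite mem_iota0 => hj.
by rewrite index_uniq ?uniq_descs.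
Qed.

Lemma first_vote (P : nat -> rel nat) d : d \in D ->
  (forall i, i < size D * m -> linear_on m (P i) /\ extends_on m (pw_vote i) (P i)) ->
  realises m (gr d) (P (index d D * m)).
Proof.
move=> hdd hP; have hi : index d D < size D by rewrite index_mem.
have [|l e] := hP (index d D * m); first by rewrite ltn_mul2r.
split=> //; move: e; rewrite /pw_vote mulnK // modnMl nth_index //.
Qed.

Lemma total_scoreE (P : 'I_(size D * m) -> rel 'I_m) (Q : nat -> rel nat) (a : 'I_m) :
  (forall i : 'I_(size D * m), position (P i) a = pos m (Q i) a) ->
  Posz (total_score s P a) = (\sum_(i <- iota 0 (size D * m)) Posz (nth 0 s (pos m (Q i) a)))%R.
Proof.
move=> h; rewrite /total_score -[X in iota 0 X]subn0 -/(index_iota _ _) big_mkord.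
rewrite (big_morph Posz PoszD (erefl _)); apply: eq_bigr => i _; by rewrite h.
Qed.

Theorem pw_choice : possible_winner r pw_inst <-> choice_sat I.
Proof.
have nge := ncodes_ge I.
split.
- case=> P [hP hw].
  pose Q i : rel nat := if insub i is Some j then lift_rel (P j) else fun _ _ => false.
  have QE (i : 'I_(size D * m)) : Q i = lift_rel (P i) by rewrite /Q valK.
  have hQ i : i < size D * m -> linear_on m (Q i) /\ extends_on m (pw_vote i) (Q i).
    move=> hi; have := QE (Ordinal hi) => /= ->; have [l e] := hP (Ordinal hi).
    split; first exact: lift_linear.
    move=> u v um vm huv; apply: e => /=; by rewrite !inordK.
  pose T d := Q (index d D * m).
  pose y d := ysel I mg d (T d); pose z d := zsel I mg d (T d); pose u d := usel I mg d (T d).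
  have sc (a : 'I_m) : Posz (total_score s P a) =
     (\sum_(d <- D) flow_sum I mg p q y z u (fun c => indic c a) d + (size D)%:Z * \sum_(k <- iota 0 m) Posz (nth 0 s k))%R.
    rewrite (@total_scoreE P Q) ?score_groups //; last by move=> i; rewrite QE lift_pos.
    congr (_ + _)%R; apply: eq_big_seq => d hdd.
    by rewrite /gr (grp_delta wf hd hm hdd (first_vote hdd hQ)).
  (* No flow touches candidate 0, so its own deviation is zero and, as it wins, bounds all the
     others. *)
  have le0 a : a < m -> (\sum_(d <- D) flow_sum I mg p q y z u (fun c => indic c a) d <= 0)%R.
    move=> am; have := hw (Ordinal am); rewrite -lez_nat !sc lerD2r => /le_trans; apply.
    rewrite big_seq big1 // => d hdd; rewrite /flow_sum big_seq big1 // => x hx.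
    have /andP[x0 _] := flow_lt wf p_gt0 q_gt0 hdd hx.
    by rewrite /indic /= gtn_eqF //= mulr0.
  (* Every weighted balance is a combination of the deviations of single candidates, so it is enough
     that these vanish. *)
  have swap phi : (\sum_(d <- D) flow_sum I mg p q y z u phi d =
     \sum_(a <- iota 0 m) phi a * \sum_(d <- D) flow_sum I mg p q y z u (fun c => indic c a) d)%R.
    under [RHS]eq_bigr do rewrite big_distrr; rewrite exchange_big /=.
    apply: eq_big_seq => d hdd; rewrite /flow_sum; under [RHS]eq_bigr do rewrite big_distrr.
    rewrite exchange_big /=; apply: eq_big_seq => x hx; have /andP[_ xm] := flow_lt wf p_gt0 q_gt0 hdd hx.
    rewrite -(sum_pick (fun a => x.1 * phi a)%R (iota_uniq 0 m) (_ : x.2 \in _)); last first.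
      by rewrite mem_iota0; apply: leq_trans hm.
    by apply: eq_bigr => a _; rewrite /indic eq_sym; ring.
  (* Votes only move points, i.e. the balance for the constant weight 1 is zero; nonpositive numbers
     with sum zero all vanish. *)
  have eq0 a : a < m -> (\sum_(d <- D) flow_sum I mg p q y z u (fun c => indic c a) d = 0)%R.
    move=> am; have : (\sum_(a <- iota 0 m) - \sum_(d <- D) flow_sum I mg p q y z u (fun c => indic c a) d = 0)%R.
      rewrite sumrN; apply/eqP; rewrite oppr_eq0; apply/eqP.
      transitivity (\sum_(d <- D) flow_sum I mg p q y z u (fun _ => 1) d)%R.
        by rewrite swap; apply: eq_bigr => b _; rewrite mul1r.
      rewrite big_seq big1 // => d hdd.
      rewrite /flow_sum /flow; case: (d) => t [w k] /=.
      case: ifP => _; first by rewrite !big_cons big_nil /=; ring.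
      case: ifP => _; first by rewrite !big_cons big_nil /=; ring.
      case: ifP => _; last by rewrite !big_cons big_nil /=; ring.
      by case: ifP => _; rewrite !big_cons big_nil /=; ring.
    rewrite big_seq => /eqP; rewrite psumr_eq0; last first.
      by move=> b; rewrite mem_iota0 => hb; rewrite oppr_ge0 le0.
    by move=> /allP /(_ a); rewrite mem_iota0 am => /(_ isT) /=; rewrite oppr_eq0 => /eqP.
  apply: (@flow_choice I wf mg p q y z u p_gt0 q_gt0) => [k hk|phi].
    have hdd : (2, (lit I k, k)) \in D.
      rewrite !mem_cat; apply/orP; right; apply/orP; right; apply/orP; left; apply: map_f.
      by rewrite mem_arcs (lit_wires wf hk) ltnW.
    apply: (sel_excl hd hm); first exact: lit_wires.
      by rewrite /crossing /= hk eqxx.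
    exact: first_vote.
  rewrite swap big_seq big1 // => a; rewrite mem_iota0 => am; by rewrite eq0 // mulr0.
- case=> f fK fS.
  pose y := ysol I f; pose z := zsol I f.
  have ex w k : w \in wires I -> crossing I (w, k) -> ~~ (y (2, (w, k)) && z (2, (w, k))).
    by move=> _ /andP[/= hk /eqP <-]; apply: sol_excl.
  have real (i : 'I_(size D * m)) : exists Pi : rel nat, linear_on m Pi /\ extends_on m (pw_vote i) Pi /\
     (i %% m = 0 -> forall phi, let d := nth (0, ((0, 0), 0)) D (i %/ m) in
     flow_sum I mg p q (fun d => ysel I mg d Pi) (fun d => zsel I mg d Pi) (fun d => usel I mg d Pi) phi d =
     flow_sum I mg p q y z (fun _ => false) phi d).
    have hi : i %/ m < size D by rewrite ltn_divLR.
    set d := nth _ D (i %/ m); have hdd : d \in D by apply: mem_nth.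
    rewrite /pw_vote /gvote -/d; case: eqP => [e0|ne0].
      have [Pi [[h1 h2] h3]] := grp_real wf s mg hp hq hm hdd ex.
      by exists Pi.
    (* Except for the first vote of a group nothing floats, so the completion is forced. *)
    have pe : perm_eq (rot (i %% m) (gbase (gr d))) (iota 0 m).
      by apply: perm_trans (gbase_perm (grp_valid wf s mg hp hq hm hdd)); rewrite perm_rot.
    exists (ord_rel (rot (i %% m) (gbase (gr d)))); split; first exact: ord_rel_linear.
    by split=> // u v um vm; rewrite /vless /vlo /vhi /ord_rel /= => /ltnW.
  have [F hF] := fin_all_exists real.
  pose Q i : rel nat := if insub i is Some j then F j else fun _ _ => false.
  have QE (i : 'I_(size D * m)) : Q i = F i by rewrite /Q valK.
  have hQ i : i < size D * m -> linear_on m (Q i) /\ extends_on m (pw_vote i) (Q i).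
    by move=> hi; have := QE (Ordinal hi) => /= ->; have [h1 [h2 _]] := hF (Ordinal hi).
  exists (fun i => restr (F i)); split.
    move=> i; have [h1 [h2 _]] := hF i; split; first exact: restr_linear.
    by move=> a b; apply: h2.
  have sc (a : 'I_m) : Posz (total_score s (fun i => restr (F i)) a) =
     ((size D)%:Z * \sum_(k <- iota 0 m) Posz (nth 0 s k))%R.
    rewrite (@total_scoreE _ Q) ?score_groups //; last by move=> i; rewrite QE restr_pos.
    rewrite (eq_big_seq (fun d => flow_sum I mg p q y z (fun _ => false) (fun c => indic c a) d)).
      by rewrite converse_zero ?add0r.
    move=> d hdd; rewrite /gr (grp_delta wf hd hm hdd (first_vote hdd hQ)) //.
    have hi : index d D < size D by rewrite index_mem.
    have hi' : index d D * m < size D * m by rewrite ltn_mul2r.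
    have := QE (Ordinal hi') => /= ->; have [_ [_]] := hF (Ordinal hi').
    by rewrite /= modnMl mulnK // nth_index //; apply.
  by move=> a /=; rewrite -lez_nat !sc.
Qed.
End instance.

(** * Tableaux *)

(* The clause list [cs] excludes every choice containing all wires of one of
   its members. *)
Definition net_of (n k : nat) (cs : seq (seq wire)) : network :=
  Network n k (size cs) (flatten [seq [seq (j, w) | w <- nth [::] cs j] | j <- iota 0 (size cs)]).

Lemma net_of_sat n k cs : choice_sat (net_of n k cs) <->
  exists2 f : nat -> nat, (forall i, i < n -> f i < k) &
    forall c, c \in cs -> has (fun w : wire => f w.1 != w.2) c.
Proof.
split=> -[f fk h]; exists f => //=.
  move=> c hc; have [|o] := h (index c cs); first by rewrite /= index_mem.
  case/flattenP => _ /mapP[j hj ->] /mapP[w hw ->] /= [e /eqP ne].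
  by apply/hasP; exists w => //; rewrite -(nth_index [::] hc) -e.
move=> j hj; have /hasP[w hw /eqP ne] := h _ (mem_nth [::] hj).
exists (j, w) => //; apply/flattenP; exists [seq (j, w) | w <- nth [::] cs j]; last exact: map_f.
by apply: map_f; rewrite mem_iota0.
Qed.

Lemma net_of_wf n k (cs : seq (seq wire)) : (forall c (w : wire), c \in cs -> w \in c -> w.1 < n /\ w.2 < k) -> wf_net (net_of n k cs).
Proof.
move=> h o /flattenP[_ /mapP[j hj ->] /mapP[w hw ->]] /=; rewrite mem_iota0 in hj.
by have [? ?] := h _ _ (mem_nth [::] hj) hw.
Qed.

Section tableau.
Variable M : machine.
Variables (w0 : seq bool) (Q T : nat).
Hypothesis wQT : size w0 + Q <= T.
(** Column [d] collects, over all tapes, the cells at distance [d - T] from the respective heads,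
    together with the state. All heads are thus at [T], and the entry of row [t] and column [d] is
    the variable [t * N + d]. *)
Let N := T + T.+1.
Notation sym := (symbol (aux M)).

Definition column : finType := (state M * (work_tapes M).+1.-tuple sym)%type.
Definition ccode (v : column) : nat := enum_rank v.
Definition ccodes (P : pred column) : seq nat := [seq ccode v | v <- enum column & P v].

Definition cell (t : tape (aux M)) d : sym :=
  if T <= d then nth None t.2 (d - T) else nth None t.1 (T - d).-1.

Definition col (c : config M) d : column := (c.1, [tuple cell (tnth c.2 i) d | i < (work_tapes M).+1]).

(* Where the column [d] lies with respect to the head, at [T]. *)
Definition side d := if d == T.+1 then 0 else if d == T then 1 else if d.+1 == T then 2 else 3.

(** [c] is the column at the heads and [e] the value of [side]. When a head moves left, the tape
    shifts right relative to it: the new entry comes from [l], except in column [T.+1], that is for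
    [e = 0], which receives the written symbol. The other moves are analogous. *)
Definition next (e : nat) (c l v r : column) : column :=
  if halting c.1 then v else
  let a := delta c.1 c.2 in
  (a.1, [tuple (let: (b, mv) := tnth a.2 i in
                match mv with
                | MoveL => if e == 0 then b else tnth l.2 i
                | MoveN => if e == 1 then b else tnth v.2 i
                | MoveR => if e == 2 then b else tnth r.2 i
                end) | i < (work_tapes M).+1]).

(** The forbidden five-tuples of entries. They depend on the machine and on [e] only, hence are
    constants of the reduction. *)
Definition combos e : seq ((nat * nat) * (nat * (nat * nat))) :=
  [seq ((ccode v.1.1, ccode v.1.2), (ccode v.2.1, (ccode v.2.2.1, ccode v.2.2.2))) |
    v : (column * column) * (column * (column * column)) <- enum {: (column * column) * (column * (column * column))} &
    v.2.2.2 != next e v.1.1 v.1.2 v.2.1 v.2.2.1].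

Definition tape0 (b : sym) : column :=
  (start M, [tuple (if i == ord0 then b else None) | i < (work_tapes M).+1]).

(** Four classes of entries of the first row, each given by what it forbids: exactly the bit
    [false], exactly [true], exactly blank, and any of the three. *)
Definition disc : seq (seq nat) :=
  [:: ccodes (predC1 (tape0 (Some (inl false)))); ccodes (predC1 (tape0 (Some (inl true))));
      ccodes (predC1 (tape0 None));
      ccodes (predC (mem [:: tape0 (Some (inl false)); tape0 (Some (inl true)); tape0 None]))].

(** Blanks to the left of the head, the fixed word, [Q] free cells for the certificate, and blanks.
    The last block overshoots the row, of which only the first [N] entries are read. *)
Definition init_classes : seq nat := nseq T 2 ++ ([seq nat_of_bool b | b <- w0] ++ (nseq Q 3 ++ nseq N 2)).

(** Four groups of clauses: the first row is admissible; behind [w0] nothing follows a blank, so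
    that the free cells spell a word; every interior entry arises by [next] from the row before; and
    at time [T] the symbol [true] is scanned on tape 0. *)
Definition tableau : seq (seq wire) :=
  [seq [:: (d, v)] | d <- iota 0 N, v <- nth [::] disc (nth 0 init_classes d)] ++
  ([seq [:: (d, ccode (tape0 None)); (d.+1, v)] | d <- iota (T + size w0) (T - size w0),
     v <- nth [::] disc 2] ++
  (flatten [seq [seq [:: (t * N + T, v.1.1); (t * N + d.-1, v.1.2); (t * N + d, v.2.1);
              (t * N + d.+1, v.2.2.1); (t.+1 * N + d, v.2.2.2)] |
       d <- iota 1 (T + T.-1), v <- combos (side d)] | t <- iota 0 T] ++
  [seq [:: (T * N + T, v)] | v <- ccodes (fun v : column => tnth v.2 ord0 != Some (inl true))])).

Lemma ccode_inj : injective ccode.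
Proof. by move=> a b /val_inj /enum_rank_inj. Qed.

Lemma ccode_lt v : ccode v < #|column|.
Proof. exact: ltn_ord. Qed.

Lemma mem_ccodes (P : pred column) v : (ccode v \in ccodes P) = P v.
Proof. by rewrite (mem_map ccode_inj) mem_filter mem_enum andbT. Qed.

Lemma ccodes_lt P k : k \in ccodes P -> k < #|column|.
Proof. by case/mapP=> v _ ->; apply: ccode_lt. Qed.

Lemma ccode_surj k : k < #|column| -> exists v, k = ccode v.
Proof. by move=> h; exists (enum_val (Ordinal h)); rewrite /ccode enum_valK. Qed.

Lemma cell_act (t : tape (aux M)) b mv d : 0 < d ->
  cell (act t (b, mv)) d = match mv with
   | MoveL => if d == T.+1 then b else cell t d.-1
   | MoveN => if d == T then b else cell t d
   | MoveR => if d.+1 == T then b else cell t d.+1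
   end.
Proof.
case: t => l r d0; rewrite /cell /act; case: mv => /=.
- case: (leqP T d) => h.
    have ed : d = T + (d - T) by rewrite subnKC.
    rewrite ed in d0 *; rewrite addKn; move: (d - T) d0 => k; case: k => [|[|k]].
    + rewrite addn0 ltn_eqF // => T0; rewrite (_ : (T <= T.-1) = false); last by lia.
      by rewrite (_ : (T - T.-1).-1 = 0) ?nth0 //; lia.
    + by rewrite addn1 eqxx.
    move=> _; rewrite (_ : (T + k.+2 == T.+1) = false); last lia.
    rewrite (_ : T <= (T + k.+2).-1); last lia.
    by rewrite /= nth_behead (_ : (T + k.+2).-1 - T = k.+1) //; lia.
  rewrite (_ : (d == T.+1) = false); last lia.
  rewrite (_ : (T <= d.-1) = false); last lia.
  by rewrite nth_behead; congr nth; lia.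
- case: (leqP T d) => h.
    rewrite (_ : (d.+1 == T) = false); last lia.
    rewrite (_ : (T <= d.+1)); last lia.
    by rewrite nth_behead subSn.
  case: eqP => [e|n]; first by rewrite -e (_ : d.+1 - d = 1) //; lia.
  rewrite (_ : (T <= d.+1) = false); last lia.
  by rewrite (_ : (T - d).-1 = (T - d.+1).-1.+1) //; lia.
case: (leqP T d) => h; last by rewrite (_ : (d == T) = false) //; lia.
case: eqP => [->|n]; first by rewrite subnn.
by rewrite (_ : d - T = (d - T).-1.+1) /=; [rewrite nth_behead|lia].
Qed.

Lemma col_step c d : 0 < d -> col (step c) d = next (side d) (col c T) (col c d.-1) (col c d) (col c d.+1).
Proof.
move=> d0; rewrite /next /step /=; case: ifP => // _.
have -> : [tuple cell (tnth c.2 i) T | i < (work_tapes M).+1] = map_tuple (@scan (aux M)) c.2.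
  by apply: eq_from_tnth => i; rewrite tnth_mktuple tnth_map /cell leqnn subnn /scan nth0.
congr (_, _); apply: eq_from_tnth => i; rewrite [LHS]tnth_mktuple tnth_mktuple [in RHS]tnth_mktuple.
case: (tnth (delta _ _).2 i) => b mv; rewrite cell_act // /side.
case: mv; rewrite ?tnth_mktuple.
- by case: (d =P T.+1) => // _; case: (d =P T) => // _; case: (d.+1 =P T).
- case: (d =P T.+1) => [->|_]; first by rewrite (_ : (T.+2 == T) = false) //; lia.
  by case: (d =P T) => [->|_]; [rewrite (_ : (T.+1 == T) = false) //; lia|case: (d.+1 =P T)].
case: (d =P T.+1) => [->|_]; first by rewrite (_ : (T.+1 == T) = false) //; lia.
by case: (d =P T) => // _; case: (d.+1 =P T).
Qed.

Definition input (w : seq bool) d : sym := if T <= d then nth None [seq Some (inl b) | b <- w] (d - T) else None.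

Lemma col_init w d : col (init M w) d = tape0 (input w d).
Proof.
congr (_, _); apply: eq_from_tnth => i; rewrite !tnth_mktuple /cell /input /tape_of.
by case: eqP => _ /=; case: ifP => // _; rewrite ?nth_nil.
Qed.

Definition accepts w := scan (tnth (iter T (@step M) (init M w)).2 ord0) == Some (inl true).

Definition tab w i := ccode (col (iter (i %/ N) (@step M) (init M w)) (i %% N)).

Lemma tabE w t d : d < N -> tab w (t * N + d) = ccode (col (iter t (@step M) (init M w)) d).
Proof. by move=> h; rewrite /tab divnMDl ?(leq_ltn_trans _ h) // divn_small // addn0 modnMDl modn_small. Qed.

Lemma tab0 w d : d < N -> tab w d = ccode (tape0 (input w d)).
Proof. by move=> h; rewrite -[d]add0n -[0](mul0n N) tabE // col_init. Qed.

Lemma init_classesE d : nth 0 init_classes d =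
  if d < T then 2 else if d < T + size w0 then nat_of_bool (nth false w0 (d - T)) else
  if d < T + size w0 + Q then 3 else if d < T + size w0 + Q + N then 2 else 0.
Proof.
rewrite /init_classes nth_cat size_nseq nth_nseq; case: ltnP => // h1.
rewrite nth_cat size_map ltn_subLR //; case: ltnP => h2.
  by rewrite (nth_map false) // ltn_subLR.
rewrite nth_cat size_nseq nth_nseq; case: ltnP => h3.
  by rewrite ifT //; lia.
by rewrite ifF ?nth_nseq; [case: ltnP => h4; case: ltnP => //; lia|lia].
Qed.

Lemma input_cat y d : size y <= Q -> T <= d ->
  input (w0 ++ y) d = if d < T + size w0 then Some (inl (nth false w0 (d - T)))
    else if d < T + size w0 + size y then Some (inl (nth false y (d - T - size w0))) else None.
Proof.
move=> hy hd; rewrite /input hd map_cat nth_cat size_map ltn_subLR //; case: ifP => h1.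
  by rewrite (nth_map false) // ltn_subLR.
case: ifP => h2; first by rewrite (nth_map false) //; lia.
by rewrite nth_default // size_map; lia.
Qed.

Lemma tape0_inj : injective tape0.
Proof. by move=> a b /(congr1 (fun v : column => tnth v.2 ord0)); rewrite !tnth_mktuple. Qed.

Lemma dis1 b v : (ccode v \in ccodes (predC1 (tape0 b))) = (v != tape0 b).
Proof. exact: mem_ccodes. Qed.

Lemma allowed_init y d : size y <= Q -> d < N ->
  ccode (tape0 (input (w0 ++ y) d)) \notin nth [::] disc (nth 0 init_classes d).
Proof.
move=> hy hd; rewrite init_classesE; case: ltnP => h1 /=.
  by rewrite dis1 /input leqNgt h1 /= eqxx.
rewrite input_cat //; case: ltnP => h2; first by case: nth; rewrite /= dis1 eqxx.
case: (ltnP d (T + size w0 + Q)) => h3; last first.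
  have -> : d < T + size w0 + Q + N by rewrite ltn_addl.
  by rewrite /= dis1 ifF ?eqxx //; lia.
rewrite /= mem_ccodes /= !inE negbK; case: ifP => _; last by rewrite eqxx !orbT.
by case: nth; rewrite eqxx ?orbT.
Qed.

Lemma tableau_sound y : size y <= Q -> accepts (w0 ++ y) ->
  forall c, c \in tableau -> has (fun w : wire => tab (w0 ++ y) w.1 != w.2) c.
Proof.
move=> hy acc c; rewrite !mem_cat => /or4P[].
- case/allpairsPdep => d [v [hd hv ->]] /=; rewrite mem_iota0 in hd; rewrite orbF tab0 //.
  by apply: contraNneq (allowed_init hy hd) => ->.
- case/allpairsPdep => d [v []]; rewrite mem_iota => /andP[h1 h2] hv -> /=; rewrite orbF -negb_and.
  have h3 : d.+1 < N by rewrite /N; lia.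
  rewrite !tab0 //; last exact: ltnW.
  apply/negP => /andP[/eqP/ccode_inj/tape0_inj e /eqP e']; move: hv; rewrite -e' dis1.
  have Td : T <= d by lia.
  move: e; rewrite !input_cat // ?leqW // ltnNge h1 /=; case: ifP => // n _.
  by rewrite ifF ?ifF ?eqxx //; lia.
- case/flattenP => _ /mapP[t ht ->] /allpairsPdep[d [v [hd hv ->]]] /=; rewrite orbF.
  move: hd; rewrite mem_iota => hd.
  rewrite !tabE /N; try lia.
  rewrite -!negb_and; apply/negP => /and5P[/eqP e1 /eqP e2 /eqP e3 /eqP e4 /eqP e5].
  case/mapP: hv => v'; rewrite mem_filter => /andP[/eqP h _] ev; apply: h.
  move: e1 e2 e3 e4 e5; rewrite ev /= => /ccode_inj <- /ccode_inj <- /ccode_inj <- /ccode_inj <- /ccode_inj <-.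
  by apply: col_step; lia.
case/mapP => v hv -> /=; rewrite orbF tabE; last by rewrite /N; lia.
apply: contraL hv => /eqP <-; rewrite mem_ccodes negbK tnth_mktuple /cell leqnn subnn nth0.
exact: acc.
Qed.

Lemma tableau_lt c w : c \in tableau -> w \in c -> w.1 < T.+1 * N /\ w.2 < #|column|.
Proof.
have big t d : t <= T -> d < N -> t * N + d < T.+1 * N.
  by move=> ht hd; apply: leq_trans (_ : t.+1 * N <= _); rewrite ?leq_mul2r ?ltnS ?ht ?orbT // mulSn addnC ltn_add2r.
have big0 d : d < N -> d < T.+1 * N by move=> h; have := big 0 d isT h.
have dl j v : v \in nth [::] disc j -> v < #|column|.
  by case: j => [|[|[|[|j]]]] /=; rewrite ?nth_nil // => /ccodes_lt.
rewrite !mem_cat => /or4P[].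
- case/allpairsPdep => d [v [hd hv ->]]; rewrite mem_iota0 in hd; rewrite inE => /eqP -> /=.
  by split; [apply: big0|apply: dl hv].
- case/allpairsPdep => d [v []]; rewrite mem_iota => /andP[h1 h2] hv ->; rewrite !inE => /orP[]/eqP -> /=.
    by split; [apply: big0; rewrite /N; lia|apply: ccode_lt].
  by split; [apply: big0; rewrite /N; lia|apply: dl hv].
- case/flattenP => _ /mapP[t ht ->] /allpairsPdep[d [v [hd hv ->]]].
  case/mapP: hv => v' _ ->; rewrite mem_iota0 in ht; rewrite mem_iota in hd.
  rewrite !inE => /or4P[/eqP->|/eqP->|/eqP->|/orP[]/eqP->] /=; (split; last exact: ccode_lt);
    by apply: big; rewrite /N; lia.
case/mapP => v /ccodes_lt hv ->; rewrite inE => /eqP -> /=; split=> //; apply: big => //; rewrite /N; lia.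
Qed.

Section complete.
Variable f : nat -> nat.
Hypothesis fK : forall i, i < T.+1 * N -> f i < #|column|.
Hypothesis fC : forall c, c \in tableau -> has (fun w : wire => f w.1 != w.2) c.

Lemma f_init d : d < N -> f d \notin nth [::] disc (nth 0 init_classes d).
Proof.
move=> hd; apply/negP => h; have := fC (c := [:: (d, f d)]); rewrite /= eqxx /= => H; apply: notF; apply: H.
rewrite mem_cat; apply/orP; left; apply/allpairsPdep; exists d, (f d); split=> //.
by rewrite mem_iota0.
Qed.

Lemma f_blank d : T + size w0 <= d -> d.+1 < N -> f d = ccode (tape0 None) -> f d.+1 = ccode (tape0 None).
Proof.
move=> h1 h2 e; apply/eqP; apply: contraT => ne.
have [v ev] : exists v, f d.+1 = ccode v.
  by apply: ccode_surj; apply: fK; apply: leq_trans h2 _; rewrite mulSn leq_addr.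
have := fC (c := [:: (d, ccode (tape0 None)); (d.+1, f d.+1)]); rewrite /= e !eqxx /= => H; apply: H.
rewrite !mem_cat; apply/orP; right; apply/orP; left; apply/allpairsPdep; exists d, (f d.+1); split=> //.
  by rewrite mem_iota; move: h2; rewrite /N; lia.
by rewrite ev dis1; apply: contraNneq ne => <-; rewrite ev.
Qed.

Lemma f_init_code d : d < N -> exists v, f d = ccode v.
Proof. by move=> h; apply: ccode_surj; apply: fK; apply: leq_trans h _; rewrite mulSn leq_addr. Qed.

Definition blankat k := f (T + size w0 + k) == ccode (tape0 None).
(** The length of the certificate in the first row; without a blank among the free cells, [find]
    returns the maximal length [Q]. *)
Definition wsize := find blankat (iota 0 Q).
Definition witness : seq bool :=
  mkseq (fun k => f (T + size w0 + k) == ccode (tape0 (Some (inl true)))) wsize.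

Lemma wsize_le : wsize <= Q.
Proof. by rewrite /wsize -[X in _ <= X](size_iota 0) find_size. Qed.

Lemma f_first_row d : d < N -> f d = ccode (tape0 (input (w0 ++ witness) d)).
Proof.
move=> hd; have hw := wsize_le.
have [v ev] := f_init_code hd; have := f_init hd; rewrite init_classesE ev.
case: ltnP => h1; first by rewrite /= dis1 negbK /input leqNgt h1 => /eqP ->.
rewrite input_cat // ?size_mkseq //; case: ltnP => h2.
  by case: (nth false w0 _); rewrite /= dis1 negbK => /eqP ->.
(* The clauses against a symbol after a blank propagate the first blank through all later free
   cells. *)
have blank k : wsize <= k -> k < Q -> blankat k.
  elim: k => [|k IH] hk kQ.
    move: hk; rewrite leqn0 => /eqP e; have : has blankat (iota 0 Q).
      by rewrite has_find size_iota -/wsize e.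
    by move/(nth_find 0); rewrite -/wsize e nth_iota.
  move: hk; rewrite leq_eqVlt => /orP[/eqP e|hk].
    have hs : has blankat (iota 0 Q) by rewrite has_find size_iota -/wsize e.
    by have := nth_find 0 hs; rewrite -/wsize e nth_iota.
  have /eqP := IH hk (ltnW kQ); rewrite /blankat addnS => /f_blank -> //; rewrite /N; lia.
case: (ltnP d (T + size w0 + Q)) => h3; last first.
  have -> : d < T + size w0 + Q + N by rewrite ltn_addl.
  rewrite /= dis1 negbK => /eqP ->; by rewrite ifF //; lia.
rewrite /= mem_ccodes /= negbK !inE => hv.
have ed : d = T + size w0 + (d - T - size w0) by lia.
case: ifP => h4.
  rewrite nth_mkseq; last by lia.
  rewrite -ed ev.
  have nb : v != tape0 None.
    have hk : d - T - size w0 < wsize by lia.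
    have := before_find 0 hk; rewrite nth_iota ?(leq_trans hk) // /blankat add0n -ed ev => /negbT.
    by apply: contraNneq => ->.
  case/or3P: hv nb => /eqP -> //; rewrite ?eqxx //.
  by move=> _; case: eqP => // /ccode_inj/tape0_inj.
by have := blank (d - T - size w0); rewrite /blankat -ed ev => /(_ _ _)/eqP -> //; lia.
Qed.

(** The clauses leave the entries at both ends of later rows unconstrained, so row [t] is determined
    only at distance [t] from the ends. In row [T] just the column [T] is left, which is the one
    tested for acceptance. *)
Lemma f_rows t d : t <= T -> t <= d -> d + t < N ->
  f (t * N + d) = ccode (col (iter t (@step M) (init M (w0 ++ witness))) d).
Proof.
elim: t d => [|t IH] d ht td hd; first by rewrite mul0n add0n /= col_init f_first_row //; lia.
have d0 : 0 < d by lia.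
rewrite /= col_step // -/(iter _ _ _); set c := iter t _ _.
have [v ev] : exists v, f (t.+1 * N + d) = ccode v.
  apply: ccode_surj; apply: fK; apply: leq_trans (_ : t.+2 * N <= _); last by rewrite leq_mul2r ltnS ht orbT.
  by rewrite [X in _ < X]mulSn addnC ltn_add2r; lia.
rewrite ev; congr ccode; apply/eqP; apply: contraT => ne.
have := fC (c := [:: (t * N + T, ccode (col c T)); (t * N + d.-1, ccode (col c d.-1)); (t * N + d, ccode (col c d));
              (t * N + d.+1, ccode (col c d.+1)); (t.+1 * N + d, ccode v)]).
rewrite /= ev !IH ?eqxx //=; try (rewrite /N in hd *; lia).
apply; rewrite !mem_cat; apply/orP; right; apply/orP; right; apply/orP; left.
apply/flattenP; eexists; first by apply/mapP; exists t => //; rewrite mem_iota0.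
apply/allpairsPdep; exists d, ((ccode (col c T), ccode (col c d.-1)), (ccode (col c d), (ccode (col c d.+1), ccode v))).
split=> //; first by rewrite mem_iota; rewrite /N in hd; lia.
by apply/mapP; exists ((col c T, col c d.-1), (col c d, (col c d.+1, v))); rewrite // mem_filter mem_enum ne.
Qed.

Lemma tableau_complete : size witness <= Q /\ accepts (w0 ++ witness).
Proof.
rewrite size_mkseq wsize_le; split=> //; rewrite /accepts; set c := iter T _ _.
apply: contraT => h; have := fC (c := [:: (T * N + T, ccode (col c T))]).
rewrite /= f_rows ?eqxx //=; last by rewrite /N; lia.
apply; rewrite !mem_cat; do 3 (apply/orP; right).
by apply: (map_f (fun v => [:: (T * N + T, v)])); rewrite mem_ccodes tnth_mktuple /cell leqnn subnn nth0.
Qed.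
End complete.

Theorem tableau_correct : choice_sat (net_of (T.+1 * N) #|column| tableau) <->
  exists2 y, size y <= Q & accepts (w0 ++ y).
Proof.
rewrite net_of_sat; split=> [[f fK fC]|[y hy acc]].
  by have [h1 h2] := tableau_complete fK fC; exists (witness f).
exists (tab (w0 ++ y)); last exact: tableau_sound.
by move=> i _; apply: ccode_lt.
Qed.
End tableau.

(** * The reduction *)

Definition bval (u : seq bool) : nat := foldr (fun (b : bool) n => b + n.*2) 0 u.

Lemma bval_binary n : bval (binary n) = n.
Proof.
have h : n < 2 ^ up_log 2 n.+1 by exact: up_logP.
rewrite /binary; move: (up_log 2 _) h => k.
elim: k n => [|k IH] n; first by rewrite ltnS leqn0 => /eqP ->.
move=> h; rewrite /mkseq /= expn0 divn1 -[1]/(1 + 0) iotaDl -map_comp.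
rewrite (eq_map (g := fun i => odd (n./2 %/ 2 ^ i))); last first.
  by move=> i /=; rewrite add1n expnS divnMA divn2.
rewrite -/(mkseq _ k) -/(bval _) IH ?odd_double_half //.
by rewrite ltn_half_double -mul2n -expnS.
Qed.

Lemma binary_inj : injective binary.
Proof. exact: can_inj bval_binary. Qed.

(** State of the parser: the finished words and the current one, all in reverse, and whether the
    next bit is data rather than a continuation flag. *)
Definition words_step (st : seq (seq bool) * (seq bool * bool)) (b : bool) :=
  if st.2.2 then (st.1, (b :: st.2.1, false))
  else if b then (st.1, (st.2.1, true)) else (st.2.1 :: st.1, ([::], false)).

Definition words (w : seq bool) : seq (seq bool) :=
  rev [seq rev u | u <- (foldl words_step ([::], ([::], false)) w).1].

Lemma words_delim acc u : foldl words_step (acc, ([::], false)) (delim u) = (rev u :: acc, ([::], false)).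
Proof.
suff h v : foldl words_step (acc, (v, false)) (delim u) = ((rev u ++ v) :: acc, ([::], false)).
  by rewrite h cats0.
by rewrite /delim; elim: u v => //= b u IH v; rewrite -/(flatten _) IH rev_cons cat_rcons.
Qed.

Lemma words_enc (us : seq (seq bool)) : words (flatten [seq delim u | u <- us]) = us.
Proof.
rewrite /words; suff -> : forall acc, foldl words_step (acc, ([::], false)) (flatten [seq delim u | u <- us]) =
    (catrev [seq rev u | u <- us] acc, ([::], false)).
  rewrite /= catrevE cats0 map_rev revK -map_comp -[RHS]map_id.
  by apply: eq_map => u /=; rewrite revK.
by elim: us => //= u us IH acc; rewrite foldl_cat words_delim IH.
Qed.

Lemma words_scores s : words (enc_scores s) = [seq binary a | a <- s].
Proof. by rewrite -[RHS]words_enc -map_comp. Qed.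

(** Scores are compared as binary words: decoded into [nat] they would be unary numbers of possibly
    exponential size. *)
Definition bits_eq (u v : seq bool) :=
  (size u == size v) && all (fun i => nth false u i == nth false v i) (iota 0 (size u)).

Lemma bits_eqE u v : bits_eq u v = (u == v).
Proof.
apply/andP/eqP => [[/eqP e /allP h]|->]; last by split=> //; apply/allP => i _.
by apply: (eq_from_nth (x0 := false)) => // i hi; apply/eqP/h; rewrite mem_iota0.
Qed.

(** Neighbouring words that differ mark a drop, since [binary] is injective and the vector does not
    increase. *)
Definition drop_list (ws : seq (seq bool)) : seq nat :=
  [seq i <- iota 0 (size ws).-1 | ~~ bits_eq (nth [::] ws i) (nth [::] ws i.+1)].

Definition first_drop ws := nth 0 (drop_list ws) 0.
Definition two_drops ws := 1 < size (drop_list ws).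
Definition last_drop ws := if two_drops ws then nth 0 (drop_list ws) 1 else first_drop ws.

Section find_drops.
Variables (r : scoring_rule) (m : nat).
Let s : seq nat := r m.
Hypothesis hm : [/\ s <> nseq m 0, s <> 1 :: nseq (m - 1) 0 & s <> rcons (nseq (m - 1) 1) 0].
Let ws := words (enc_scores s).

Lemma drop_listE : drop_list ws = [seq i <- iota 0 m.-1 | nth 0 s i.+1 < nth 0 s i].
Proof.
have sz : size s = m by rewrite size_tuple.
rewrite /drop_list /ws words_scores size_map sz; apply: eq_in_filter => i; rewrite mem_iota0 => hi.
rewrite bits_eqE !(nth_map 0) ?sz; try lia.
rewrite (inj_eq binary_inj) ltn_neqAle eq_sym; case: eqP => //= _.
have := svec_noninc r m => /(sorted_leq_nth (rev_trans leq_trans) leqnn 0)/(_ i i.+1).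
by rewrite !inE sz => ->; lia.
Qed.

Lemma svec_mono i j : i <= j -> j < m -> nth 0 s j <= nth 0 s i.
Proof.
move=> ij jm; have sz : size s = m by rewrite size_tuple.
have := svec_noninc r m => /(sorted_leq_nth (rev_trans leq_trans) leqnn 0)/(_ i j).
by rewrite !inE sz => ->; lia.
Qed.

Lemma no_drop_const i j : i <= j -> j < m -> (forall k, i <= k -> k < j -> k \notin drop_list ws) ->
  nth 0 s j = nth 0 s i.
Proof.
move=> ij jm h; elim: j ij jm h => [|j IH]; first by rewrite leqn0 => /eqP ->.
rewrite leq_eqVlt => /orP[/eqP <- //|ij] jm h.
rewrite -IH //; [|lia|by move=> k ik kj; apply: h => //; lia].
have := h j ij (ltnSn j); rewrite drop_listE mem_filter mem_iota0 (_ : j < m.-1) ?andbT; last lia.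
by rewrite -leqNgt => h1; apply/eqP; rewrite eqn_leq h1 svec_mono.
Qed.

(** Without a drop the vector would be constantly zero. A single drop means ones followed by zeros,
    and the two other excluded shapes are those with the drop at an end. Otherwise the first two
    drops serve, no drop lying between them. *)
Lemma drops_found : drops s m (two_drops ws) (first_drop ws) (last_drop ws).
Proof.
have [h0 h1 h2] := hm; have sz : size s = m by rewrite size_tuple.
have m0 : 0 < m by case: (m) s sz h0 => // s' /size0nil ->.
have s_last : nth 0 s m.-1 = 0 by rewrite -{1}sz nth_last; apply: svec_last.
have mem i : i \in drop_list ws = (nth 0 s i.+1 < nth 0 s i) && (i.+1 < m).
  by rewrite drop_listE mem_filter mem_iota0; congr (_ && _); lia.
have srt : sorted ltn (drop_list ws) by apply: sorted_filter (iota_ltn_sorted 0 _); apply: ltn_trans.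
have c_eq := no_drop_const.
rewrite /last_drop /two_drops /first_drop.
case e : (drop_list ws) mem srt c_eq => [|a [|b l]] mem srt c_eq /=.
- case: h0; apply: (eq_from_nth (x0 := 0)); rewrite ?size_nseq // => i; rewrite sz => hi.
  by rewrite nth_nseq hi -[RHS]s_last; symmetry; apply: c_eq => //; [lia|lia].
- have /andP[d1 am] : (nth 0 s a.+1 < nth 0 s a) && (a.+1 < m) by rewrite -mem mem_head.
  have lo i : i <= a -> nth 0 s i = nth 0 s a.
    by move=> ia; symmetry; apply: c_eq => // [|k _ ka]; [lia|rewrite inE; lia].
  have hi i : a < i -> i < m -> nth 0 s i = 0.
    move=> ai im; rewrite -[RHS]s_last; symmetry; apply: c_eq => // [||k ka _]; try lia.
    by rewrite inE; lia.
  (* By normalization: every entry is either this value or zero, so a value above 1 would divide all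
     of them and force the zero vector. *)
  have one : nth 0 s a = 1.
    have z : nth 0 s a.+1 = 0 by rewrite hi.
    apply/eqP; rewrite eqn_leq (leq_ltn_trans (leq0n _) d1) andbT.
    rewrite leqNgt; apply/negP => big; apply: h0; apply: (svec_normal big).
    apply/(all_nthP 0) => i; rewrite -/s sz => im.
    by case: (leqP i a) => ia; [rewrite (lo i)|rewrite (hi i) // dvdn0].
  have shape : s = nseq a.+1 1 ++ nseq (m - a.+1) 0.
    apply: (eq_from_nth (x0 := 0)); first by rewrite size_cat !size_nseq sz; lia.
    move=> i; rewrite sz => im; rewrite nth_cat size_nseq !nth_nseq.
    by case: (ltnP i a.+1) => ia; [rewrite lo ?one|rewrite hi //; case: ifP].
  have a0 : 0 < a by case: (a) shape h1 => // ->.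
  have a2 : a.+2 < m.
    rewrite ltn_neqAle am andbT; apply/eqP => em; case: h2; rewrite shape -em subn1 /=.
    by rewrite (_ : a.+2 - a.+1 = 1) ?subSnn // -cats1.
  split=> //; split=> //; split=> //; first by apply: lo; lia.
  by rewrite !hi //; lia.
have /andP[d1 am] : (nth 0 s a.+1 < nth 0 s a) && (a.+1 < m) by rewrite -mem mem_head.
have /andP[d2 bm] : (nth 0 s b.+1 < nth 0 s b) && (b.+1 < m) by rewrite -mem !inE eqxx orbT.
have /andP[ab pl] : (a < b) && path ltn b l by [].
split=> //; split=> // j aj jb; apply: c_eq; [lia|lia|].
move=> k ak kj; rewrite !inE !negb_or; apply/and3P; split; try lia.
apply/negP => kl; have := order_path_min ltn_trans pl => /allP/(_ _ kl); lia.
Qed.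
End find_drops.

(** The flags of [delim u] stand at the even positions, and the first false one ends the word. *)
Definition dlen (w : seq bool) := find (fun i => ~~ nth false w (i + i)) (iota 0 (size w)).
Definition dword w := [seq nth false w (i + i).+1 | i <- iota 0 (dlen w)].
Definition drest w := drop (dlen w + dlen w).+1 w.

Lemma size_delim u : size (delim u) = (size u + size u).+1.
Proof. by rewrite /delim; elim: u => //= b u IH; rewrite -/(flatten _) IH; lia. Qed.

Lemma nth_delim u y i : i <= size u -> nth false (delim u ++ y) (i + i) = (i < size u).
Proof.
rewrite /delim; elim: u i => [|b u IH] [|i] //= h.
by rewrite addnS /= -/(flatten _) IH.
Qed.

Lemma nth_delim1 u y i : i < size u -> nth false (delim u ++ y) (i + i).+1 = nth false u i.
Proof.
rewrite /delim; elim: u i => [|b u IH] [|i] //= h.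
by rewrite addnS /= -/(flatten _) IH.
Qed.

Lemma dlen_delim u y : dlen (delim u ++ y) = size u.
Proof.
rewrite /dlen; set P := fun i => _; set S := size _.
have hS : size u < S by rewrite /S size_cat size_delim; lia.
have hP i : i < size u -> P i = false by move=> h; rewrite /P (nth_delim _ (ltnW h)) h.
have hu : P (size u) by rewrite /P nth_delim // ltnn.
rewrite -(subnKC hS) addSn -addnS iotaD find_cat add0n.
rewrite (_ : has P (iota 0 (size u)) = false); first by rewrite size_iota /= hu addn0.
by apply/hasP => -[i]; rewrite mem_iota0 => /hP ->.
Qed.

Lemma dword_delim u y : dword (delim u ++ y) = u.
Proof.
rewrite /dword dlen_delim; apply: (eq_from_nth (x0 := false)); rewrite size_map size_iota // => i hi.
by rewrite (nth_map 0) ?size_iota // nth_iota // nth_delim1.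
Qed.

Lemma drest_delim u y : drest (delim u ++ y) = y.
Proof. by rewrite /drest dlen_delim -size_delim drop_size_cat. Qed.

(** * Time bounds for the ingredients of the reduction *)

Lemma ptime_find {G A : Type} {eG : Enc G} {eA : Enc A} (x0 : A) (s : G -> seq A) (p : G -> A -> bool) : ptime s ->
  ptime (fun x : G * A => p x.1 x.2) -> ptime (fun g => find (p g) (s g)).
Proof.
move=> hs hp; apply: (ptime_ext (f := fun g => head (size (s g)) [seq i <- iota 0 (size (s g)) | p g (nth x0 (s g) i)])).
  by pt; apply: (ptime_comp (f := fun x : G * nat => (x.1, nth x0 (s x.1) x.2)) hp); pt.
move=> g; elim: (s g) => //= a l IH; case: (p g a) => //=.
rewrite -[1]/(1 + 0) iotaDl filter_map /= -IH.
by case: filter.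
Qed.

Lemma ptime_words {G : Type} {eG : Enc G} (w : G -> seq bool) : ptime w -> ptime (fun g => words (w g)).
Proof.
move=> hw; rewrite /words; apply: ptime_rev; apply: ptime_map; last by pt.
apply: ptime_fst'; apply: ptime_foldl; [exact: hw|exact: ptime_const|rewrite /words_step; pt|].
have [k hk] := ptime_size hw; have [l hl] : poly_bounded (fun n => 6 * bound k n + 6) by poly_bound.
exists l => g l1 l2 e; apply: leq_trans (hl _).
have one st b : csize (words_step st b) <= 5 + csize st.
  case: st => acc [cur fl]; rewrite /words_step /=.
  case: fl; last case: b; rewrite !csize_prod ?csize_cons.
  + by case: b; rewrite /csize /word_of /=; move: (size _) (size _); lia.
  + by rewrite /csize /word_of /=; move: (size _) (size _); lia.
  by rewrite /csize /word_of /=; move: (size _) (size _); lia.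
have aux : forall u st, csize (foldl words_step st u) <= 5 * size u + csize st.
  elim=> [|b u IH] st /=; first by rewrite muln0.
  by have := IH (words_step st b); have := one st b; move: (csize _) (csize _) (csize _); lia.
apply: leq_trans (aux _ _) _.
have h1 : size l1 <= bound k (csize g).
  by apply: leq_trans (hk g); rewrite e; apply: leq_trans (ltnW (size_tsz _)); rewrite size_cat leq_addr.
have h2 : csize ([::] : seq (seq bool), ([::] : seq bool, false)) <= 6 by [].
apply: leq_trans (leq_add (leq_mul (leqnn 5) h1) h2) _.
by move: (bound _ _) => x; clear; lia.
Qed.

Lemma ptime_horner {G : Type} {eG : Enc G} (p : {poly nat}) (n : G -> nat) : ptime n -> ptime (fun g => p.[n g]%R).
Proof.
move=> hn; elim/poly_ind: p => [|p c IH].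
  by apply: (ptime_ext (f := fun _ => 0)); [exact: ptime_const|move=> g; rewrite horner0].
apply: (ptime_ext (f := fun g => p.[n g]%R * n g + c)); first by pt.
by move=> g; rewrite hornerD hornerC hornerM hornerX.
Qed.

Section numbers.
Context {G : Type} {eG : Enc G}.

Lemma ptime_mem (x : G -> nat) (s : G -> seq nat) : ptime x -> ptime s -> ptime (fun g => x g \in s g).
Proof.
move=> hx hs; apply: (ptime_ext (f := fun g => has (fun y => y == x g) (s g))); first by pt.
by move=> g; elim: (s g) => //= a l IH; rewrite inE eq_sym IH.
Qed.

Lemma ptime_pred (n : G -> nat) : ptime n -> ptime (fun g => (n g).-1).
Proof. by move=> hn; apply: (ptime_ext (f := fun g => n g - 1)); [pt|move=> g; rewrite subn1]. Qed.

Lemma ptime_index (x : G -> nat) (s : G -> seq nat) : ptime x -> ptime s -> ptime (fun g => index (x g) (s g)).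
Proof. by move=> hx hs; apply: (ptime_find 0 (s := s) (p := fun g y => y == x g)) => //; pt. Qed.
End numbers.

Ltac pt_seq := lazymatch goal with
  | |- ptime (fun g => @index Datatypes_nat__canonical__eqtype_Equality (@?x g) (@?s g)) => apply: (ptime_index (x := x) (s := s))
  | |- ptime (fun g => in_mem (@?x g) (mem (@?s g))) => apply: (ptime_mem (x := x) (s := s))
  | |- ptime (fun g => (@?n g).-1) => apply: (ptime_pred (n := n))
  | _ => pt_base
  end.
Ltac pt_hook ::= pt_seq.

Global Instance enc_net : Enc network := fun I => enc (nv I, (nk I, (nc I, occ I))).

Section network.
Context {G : Type} {eG : Enc G}.

Lemma ptime_Network (n k c : G -> nat) (o : G -> seq occurrence) : ptime n -> ptime k -> ptime c -> ptime o ->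
  ptime (fun g => Network (n g) (k g) (c g) (o g)).
Proof.
move=> h1 h2 h3 h4; apply: (ptime_recode (f := fun g => (n g, (k g, (c g, o g))))) => //.
by pt.
Qed.

Variable I : G -> network.
Hypothesis hI : ptime I.

Lemma ptime_fields : ptime (fun g => (nv (I g), (nk (I g), (nc (I g), occ (I g))))).
Proof. exact: (ptime_recode hI). Qed.
Lemma ptime_nv : ptime (fun g => nv (I g)).
Proof. exact: ptime_fst' ptime_fields. Qed.
Lemma ptime_nk : ptime (fun g => nk (I g)).
Proof. exact: ptime_fst' (ptime_snd' ptime_fields). Qed.
Lemma ptime_nc : ptime (fun g => nc (I g)).
Proof. exact: ptime_fst' (ptime_snd' (ptime_snd' ptime_fields)). Qed.
Lemma ptime_occ : ptime (fun g => occ (I g)).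
Proof. exact: ptime_snd' (ptime_snd' (ptime_snd' ptime_fields)). Qed.
Lemma ptime_nocc : ptime (fun g => nocc (I g)).
Proof. exact: ptime_size_ ptime_occ. Qed.
End network.

Ltac pt_net := lazymatch goal with
  | |- ptime (fun g => nv (@?I g)) => apply: (ptime_nv (I := I))
  | |- ptime (fun g => nk (@?I g)) => apply: (ptime_nk (I := I))
  | |- ptime (fun g => nc (@?I g)) => apply: (ptime_nc (I := I))
  | |- ptime (fun g => occ (@?I g)) => apply: (ptime_occ (I := I))
  | |- ptime (fun g => nocc (@?I g)) => apply: (ptime_nocc (I := I))
  | _ => pt_seq
  end.
Ltac pt_hook ::= pt_net.

Section codes.
Context {G : Type} {eG : Enc G}.
Variable I : G -> network.
Hypothesis hI : ptime I.

Lemma ptime_lit (k : G -> nat) : ptime k -> ptime (fun g => lit (I g) (k g)).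
Proof. by move=> hk; rewrite /lit; pt. Qed.
Lemma ptime_cla (k : G -> nat) : ptime k -> ptime (fun g => cla (I g) (k g)).
Proof. by move=> hk; rewrite /cla; pt. Qed.
Lemma ptime_cS (k : G -> nat) : ptime k -> ptime (fun g => cS (k g)).
Proof. by move=> hk; rewrite /cS; pt. Qed.
Lemma ptime_cS' (k : G -> nat) : ptime k -> ptime (fun g => cS' (I g) (k g)).
Proof. by move=> hk; rewrite /cS'; pt. Qed.
Lemma ptime_cC (k : G -> nat) : ptime k -> ptime (fun g => cC (I g) (k g)).
Proof. by move=> hk; rewrite /cC; pt. Qed.
Lemma ptime_ncodes : ptime (fun g => ncodes (I g)).
Proof. by rewrite /ncodes; pt. Qed.

Lemma ptime_cND (w : G -> wire) (k : G -> nat) : ptime w -> ptime k -> ptime (fun g => cND (I g) (w g) (k g)).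
Proof.
move=> hw hk; rewrite /cND /cN; pt; exact: ptime_cS (ptime_fst' hw).
Qed.

Lemma ptime_cX (b : G -> bool) (k : G -> nat) : ptime b -> ptime k -> ptime (fun g => cX (I g) (b g) (k g)).
Proof.
move=> hb hk; apply: ptime_if hb _ (ptime_cC hk).
by apply: ptime_cND; [exact: ptime_lit|pt].
Qed.

Lemma ptime_crossing (t : G -> wire * nat) : ptime t -> ptime (fun g => crossing (I g) (t g)).
Proof.
move=> ht; have hl := ptime_lit (ptime_snd' ht).
apply: (ptime_ext (f := fun g => ((t g).2 < nocc (I g)) &&
   (((lit (I g) (t g).2).1 == (t g).1.1) && ((lit (I g) (t g).2).2 == (t g).1.2)))); first by pt.
by move=> g; rewrite /crossing -xpair_eqE -!surjective_pairing.
Qed.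

Lemma ptime_arcs : ptime (fun g => arcs (I g)).
Proof.
apply: (ptime_ext (f := fun g => flatten [seq [seq (w, k) | k <- iota 0 (nocc (I g)).+1] |
  w <- flatten [seq [seq (i, v) | v <- iota 0 (nk (I g))] | i <- iota 0 (nv (I g))]])) => //.
by pt.
Qed.

Lemma ptime_descs : ptime (fun g => descs (I g)).
Proof. by have ha := ptime_arcs; rewrite /descs; pt. Qed.
End codes.

Section votes.
Context {G : Type} {eG : Enc G}.
Variable m : G -> nat.
Hypothesis hm : ptime m.

Lemma ptime_others (w : G -> seq nat) : ptime w -> ptime (fun g => others (m g) (w g)).
Proof. by move=> hw; rewrite /others; pt. Qed.

Lemma ptime_arc_group (h u u' : G -> nat) : ptime h -> ptime u -> ptime u' ->
  ptime (fun g => arc_group (m g) (h g) (u g) (u' g)).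
Proof.
move=> hh hu hu'; rewrite /arc_group.
have ho : ptime (fun g => others (m g) [:: u g; u' g]) by apply: ptime_others; pt.
by pt.
Qed.

Lemma ptime_setup_group (h u u' : G -> nat) : ptime h -> ptime u -> ptime u' ->
  ptime (fun g => setup_group (m g) (h g) (u g) (u' g)).
Proof.
move=> hh hu hu'; rewrite /setup_group.
have ho : ptime (fun g => others (m g) [:: u g; u' g]) by apply: ptime_others; pt.
by pt.
Qed.

Lemma ptime_merged_group (h h' a x b : G -> nat) : ptime h -> ptime h' -> ptime a -> ptime x -> ptime b ->
  ptime (fun g => merged_group (m g) (h g) (h' g) (a g) (x g) (b g)).
Proof.
move=> hh hh' ha hx hb; rewrite /merged_group.
have ho : ptime (fun g => others (m g) [:: a g; x g; b g]) by apply: ptime_others; pt.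
by pt.
Qed.

Lemma ptime_split_group (h a b c d : G -> nat) : ptime h -> ptime a -> ptime b -> ptime c -> ptime d ->
  ptime (fun g => split_group (m g) (h g) (a g) (b g) (c g) (d g)).
Proof.
move=> hh ha hb hc hd; rewrite /split_group.
have ho : ptime (fun g => others (m g) [:: a g; b g; c g; d g]) by apply: ptime_others; pt.
by pt.
Qed.

Lemma ptime_grp (I : G -> network) (mg : G -> bool) (hp hq : G -> nat) (d : G -> desc) :
  ptime I -> ptime mg -> ptime hp -> ptime hq -> ptime d ->
  ptime (fun g => grp (I g) (m g) (mg g) (hp g) (hq g) (d g)).
Proof.
move=> hI hmg hhp hhq hd.
have d1 := ptime_snd' hd; have w1 := ptime_fst' d1; have k1 := ptime_snd' d1.
have k2 : ptime (fun g => (d g).2.2.+1) by pt.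
have wx : ptime (fun g => (d g).2.1.1) by pt.
have s1 := ptime_cS wx; have s2 := ptime_cS' hI wx; have s3 := ptime_cS' hI (ptime_cla hI k1).
have n1 := ptime_cND hI w1 k1; have n2 := ptime_cND hI w1 k2; have c1 := ptime_cC hI k1; have x1 := ptime_cX hI hmg k1.
have cr := ptime_crossing hI d1.
have tp : ptime (fun _ : G => cTp) by exact: ptime_const.
have tq : ptime (fun _ : G => cTq) by exact: ptime_const.
apply: (ptime_ext (f := fun g => if (d g).1 == 0 then setup_group (m g) (hp g) (cS (d g).2.1.1) cTp
  else if (d g).1 == 1 then setup_group (m g) (hq g) (cS' (I g) (d g).2.1.1) cTq
  else if (d g).1 == 2 then
    if crossing (I g) (d g).2 then
      if mg g then merged_group (m g) (hp g) (hq g) (cND (I g) (d g).2.1 (d g).2.2) (cND (I g) (d g).2.1 (d g).2.2.+1) cTq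
      else split_group (m g) (hp g) (cND (I g) (d g).2.1 (d g).2.2) cTq (cC (I g) (d g).2.2) (cND (I g) (d g).2.1 (d g).2.2.+1)
    else arc_group (m g) (hp g) (cND (I g) (d g).2.1 (d g).2.2) (cND (I g) (d g).2.1 (d g).2.2.+1)
  else arc_group (m g) (hq g) (cS' (I g) (cla (I g) (d g).2.2)) (cX (I g) (mg g) (d g).2.2))); last first.
  by move=> g; rewrite /grp; case: (d g) => t [w k].
apply: ptime_if; [by pt|exact: ptime_setup_group|].
apply: ptime_if; [by pt|exact: ptime_setup_group|].
apply: ptime_if; [by pt| |exact: ptime_arc_group].
apply: ptime_if; [exact: cr| |exact: ptime_arc_group].
by apply: ptime_if; [exact: hmg|exact: ptime_merged_group|exact: ptime_split_group].
Qed.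

Lemma ptime_vless (V : G -> vspec) (a b : G -> nat) : ptime V -> ptime a -> ptime b ->
  ptime (fun g => vless (V g) (a g) (b g)).
Proof. by move=> hV ha hb; rewrite /vless /vlo /vhi; pt. Qed.

Lemma ptime_gvote (x : G -> group) (k : G -> nat) : ptime x -> ptime k -> ptime (fun g => gvote (x g) (k g)).
Proof. by move=> hx hk; rewrite /gvote /gfirst /gbase; pt. Qed.
End votes.

Lemma ptime_delim {G : Type} {eG : Enc G} (w : G -> seq bool) : ptime w -> ptime (fun g => delim (w g)).
Proof. by move=> hw; rewrite /delim; pt. Qed.

Section tableau.
Context {G : Type} {eG : Enc G}.
Variables (M : machine) (w0 : G -> seq bool) (Q T : G -> nat).
Hypothesis hw : ptime w0.
Hypothesis hQ : ptime Q.
Hypothesis hT : ptime T.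

(** As the machine is fixed, the tables of the four sides are constants, and only the choice among
    them is computed. *)
Lemma ptime_combos : ptime (fun x : nat * nat => combos M (side x.1 x.2)).
Proof.
apply: (ptime_ext (f := fun x : nat * nat => nth [::] [:: combos M 0; combos M 1; combos M 2; combos M 3]
   (if x.2 == x.1.+1 then 0 else if x.2 == x.1 then 1 else if x.2.+1 == x.1 then 2 else 3))); first by pt.
by case=> t d; rewrite /side /=; do 3 case: eqP => // _.
Qed.

Lemma ptime_init_classes : ptime (fun g => init_classes (w0 g) (Q g) (T g)).
Proof.
apply: (ptime_ext (f := fun g => nseq (T g) 2 ++ ([seq if b then 1 else 0 | b <- w0 g] ++
  (nseq (Q g) 3 ++ nseq (T g + (T g).+1) 2)))); first by pt.
by move=> g; congr (_ ++ (_ ++ _)); apply: eq_map; case.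
Qed.

Lemma ptime_tableau : ptime (fun g => tableau M (w0 g) (Q g) (T g)).
Proof.
pose IC g := init_classes (w0 g) (Q g) (T g); have hr : ptime IC := ptime_init_classes.
pose CB x := combos M (side x.1 x.2); have hc : ptime CB := ptime_combos.
apply: (@ptime_ext G (seq (seq wire)) _ _ (fun g =>
  flatten [seq [seq [:: (d, v)] | v <- nth [::] (disc M) (nth 0 (IC g) d)] |
    d <- iota 0 (T g + (T g).+1)] ++
  (flatten [seq [seq [:: (d, @ccode M (tape0 None)); (d.+1, v)] | v <- nth [::] (disc M) 2] |
    d <- iota (T g + size (w0 g)) (T g - size (w0 g))] ++
  (flatten [seq flatten [seq [seq [:: (t * (T g + (T g).+1) + T g, v.1.1); (t * (T g + (T g).+1) + (d - 1), v.1.2);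
       (t * (T g + (T g).+1) + d, v.2.1); (t * (T g + (T g).+1) + d.+1, v.2.2.1);
       (t.+1 * (T g + (T g).+1) + d, v.2.2.2)] |
       v <- CB (T g, d)] | d <- iota 1 (T g + (T g - 1))] | t <- iota 0 (T g)] ++
  [seq [:: (T g * (T g + (T g).+1) + T g, v)] |
    v <- ccodes (fun v : column M => tnth v.2 ord0 != Some (inl true))])))); last first.
  move=> g; rewrite /tableau subn1; congr (_ ++ (_ ++ (flatten _ ++ _))).
  apply: eq_map => t; congr flatten; apply: eq_map => d; apply: eq_map => v; by rewrite subn1.
(* With the bodies hidden, [pt] falls back on the hypotheses about [IC] and [CB] instead of taking
   them apart. *)
clearbody IC CB; pt.
Qed.
End tableau.

Lemma size_blocks (T : Type) (F : T -> seq bool) k (s : seq T) : (forall t, size (F t) = k) ->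
  size (flatten [seq F t | t <- s]) = size s * k.
Proof. by move=> h; elim: s => //= t s IH; rewrite size_cat h IH mulSn. Qed.

Lemma nth_blocks (T : Type) (x0 : T) (F : T -> seq bool) k (s : seq T) i j :
  (forall t, size (F t) = k) -> i < size s -> j < k ->
  nth false (flatten [seq F t | t <- s]) (i * k + j) = nth false (F (nth x0 s i)) j.
Proof.
move=> h; elim: s i => [|t s IH] [|i] //= hi hj; rewrite nth_cat h ?hj //.
by rewrite mulSn -addnA ltnNge leq_addr /= addKn IH.
Qed.

Definition vote_bits (I : pw_instance) : seq bool :=
  flatten [seq flatten [seq [seq votes i a b | b <- enum 'I_(ncand I)] | a <- enum 'I_(ncand I)]
          | i <- enum 'I_(nvotes I)].

Definition vote_bit (m : nat) (bits : seq bool) i a b := nth false bits (i * (m * m) + (a * m + b)).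

Lemma size_vote_bits I : size (vote_bits I) = nvotes I * (ncand I * ncand I).
Proof.
rewrite (@size_blocks _ _ (ncand I * ncand I)) ?size_enum_ord // => i.
rewrite (@size_blocks _ _ (ncand I)) ?size_enum_ord // => a.
by rewrite size_map size_enum_ord.
Qed.

Lemma nth_enum_self n (i : 'I_n) : nth i (enum 'I_n) i = i.
Proof. by apply: val_inj; rewrite /= nth_enum_ord. Qed.

Lemma vote_bitE I (i : 'I_(nvotes I)) (a b : 'I_(ncand I)) :
  vote_bit (ncand I) (vote_bits I) i a b = votes i a b.
Proof.
have s2 (a' : 'I_(ncand I)) i' : size [seq @votes I i' a' b | b <- enum 'I_(ncand I)] = ncand I.
  by rewrite size_map size_enum_ord.
rewrite /vote_bit (@nth_blocks _ i _ (ncand I * ncand I)) ?size_enum_ord //; last first.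
  apply: leq_trans (_ : a.+1 * ncand I <= _); last by rewrite leq_mul2r ltn_ord orbT.
  by rewrite mulSn addnC ltn_add2r.
- by move=> i'; rewrite (@size_blocks _ _ (ncand I)) ?size_enum_ord.
by rewrite (@nth_blocks _ a _ (ncand I)) ?size_enum_ord // (nth_map b) ?size_enum_ord // !nth_enum_self.
Qed.

(* [possible_winner], read off the code of the instance. *)
Definition winnable (r : scoring_rule) (m n c : nat) (bits : seq bool) : Prop :=
  exists P : 'I_n -> rel 'I_m,
    (forall i, linear_vote (P i) /\ forall a b : 'I_m, vote_bit m bits i a b -> P i a b) /\
    forall a c' : 'I_m, c' = c :> nat -> total_score (r m) P a <= total_score (r m) P c'.

Lemma winnableE r I : possible_winner r I <-> winnable r (ncand I) (nvotes I) (cand I) (vote_bits I).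
Proof.
split=> -[P [h1 h2]]; exists P; split.
- move=> i; have [l s] := h1 i; split=> // a b; rewrite vote_bitE; exact: s.
- by move=> a c' /val_inj ->.
- move=> i; have [l s] := h1 i; split=> // a b h; by apply: s; rewrite vote_bitE.
by move=> a; apply: h2.
Qed.

Lemma enc_instanceE I : enc_instance I =
  delim (unary (ncand I)) ++ (delim (unary (cand I)) ++ vote_bits I).
Proof. by []. Qed.

(** [PossibleWinner] asks for some instance with the given code, so the code must determine the
    answer. The detour through [winnable] avoids an equality of dependent records. *)
Lemma enc_instance_inj r I J : enc_instance I = enc_instance J ->
  possible_winner r I -> possible_winner r J.
Proof.
rewrite !winnableE !enc_instanceE => e.
have em : ncand I = ncand J.
  by have := congr1 (size \o dword) e; rewrite /= !dword_delim !size_nseq.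
have := congr1 drest e; rewrite !drest_delim => {}e.
have ec : cand I = cand J :> nat.
  by have := congr1 (size \o dword) e; rewrite /= !dword_delim !size_nseq.
have := congr1 drest e; rewrite !drest_delim => {}e.
have en : nvotes I = nvotes J.
  have := congr1 size e; rewrite !size_vote_bits em => /eqP; rewrite eqn_mul2r => /orP[|/eqP//].
  by rewrite muln_eq0 orbb -leqn0 leqNgt (leq_ltn_trans (leq0n (cand J))).
by rewrite ec e en em.
Qed.

Section drop_finder.
Context {G : Type} {eG : Enc G}.
Variable ws : G -> seq (seq bool).
Hypothesis hws : ptime ws.

Lemma ptime_bits_eq (u v : G -> seq bool) : ptime u -> ptime v -> ptime (fun g => bits_eq (u g) (v g)).
Proof. by move=> hu hv; rewrite /bits_eq; pt. Qed.
End drop_finder.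

Lemma ptime_drop_list : ptime drop_list.
Proof.
have hb : ptime (fun x : seq bool * seq bool => bits_eq x.1 x.2) by apply: ptime_bits_eq; pt.
rewrite /drop_list; pose B x := bits_eq x.1 x.2; have hB : ptime B := hb.
apply: (ptime_ext (f := fun ws : seq (seq bool) =>
   [seq i <- iota 0 (size ws).-1 | ~~ B (nth [::] ws i, nth [::] ws i.+1)])) => //.
by clearbody B; pt.
Qed.

Section drops.
Context {G : Type} {eG : Enc G}.
Variable ws : G -> seq (seq bool).
Hypothesis hws : ptime ws.
Lemma ptime_two_drops : ptime (fun g => two_drops (ws g)).
Proof. by have h := ptime_drop_list; rewrite /two_drops; pt. Qed.
Lemma ptime_first_drop : ptime (fun g => first_drop (ws g)).
Proof. by have h := ptime_drop_list; rewrite /first_drop; pt. Qed.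
Lemma ptime_last_drop : ptime (fun g => last_drop (ws g)).
Proof. by have h := ptime_drop_list; rewrite /last_drop /two_drops /first_drop; pt. Qed.
End drops.

Definition vote_block m (V : vspec) := flatten [seq [seq vless V a b | b <- iota 0 m] | a <- iota 0 m].

(** Rewrites enumerations of ordinals, and votes indexed by quotient and remainder, as nested lists
    over [iota], the form in which a program produces them. *)
Lemma pw_inst_enc r I (wf : wf_net I) M mg hp hq (hm : ncodes I <= M.+1) :
  enc_instance (pw_inst r wf mg hp hq hm) = delim (unary M.+1) ++ (delim (unary 0) ++
   flatten [seq vote_block M.+1 V | V <-
     flatten [seq [seq gvote (grp I M.+1 mg hp hq d) k | k <- iota 0 M.+1] | d <- descs I]]).
Proof.
rewrite enc_instanceE; congr (_ ++ (_ ++ _)); rewrite /vote_bits; cbn [ncand nvotes votes pw_inst].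
set m := M.+1; set D := descs I.
pose W i := pw_vote I M mg hp hq i.
rewrite [X in _ = flatten X](_ : _ = [seq vote_block m V | V <- [seq W i | i <- iota 0 (size D * m)]]); last first.
  congr map; rewrite iota_blocks map_flatten -map_comp.
  rewrite -[X in [seq _ | d <- X]](mkseq_nth (0, ((0, 0), 0))) /mkseq -map_comp.
  congr flatten; apply/eq_in_map => j; rewrite mem_iota0 => hj; rewrite /comp -[RHS]map_comp.
  apply/eq_in_map => k; rewrite mem_iota0 /comp /W /pw_vote -/D => hk.
  by rewrite divnMDl // divn_small // addn0 modnMDl modn_small.
have it (T : Type) (F : nat -> T) n : [seq F (nat_of_ord i) | i <- enum 'I_n] = [seq F i | i <- iota 0 n].
  by rewrite -val_enum_ord -map_comp.
rewrite -map_comp -it; congr flatten; apply: eq_map => i.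
rewrite /vote_block /comp -it; congr flatten; apply: eq_map => a; by rewrite -it.
Qed.

Section reduction.
Variables (M : machine) (p q : {poly nat}) (z : nat).

Definition certsize (x : seq bool) : nat := q.[size x]%R.
Definition insize x := size (delim x) + certsize x.
(** The second summand is the time granted to the verifier on the longest certificates; the first
    makes the tableau wide enough for its input. *)
Definition horizon x : nat := insize x + p.[insize x]%R.
Definition clauses x := tableau M (delim x) (certsize x) (horizon x).
Definition netx x := net_of ((horizon x).+1 * (horizon x + (horizon x).+1)) #|column M| (clauses x).
(** Large enough for all candidates of the flow and beyond [z]; the surplus candidates only fill
    positions. The outer successor matches the form [M.+1] in [pw_inst]. *)
Definition msize x := (ncodes (netx x) + z + 2).+1.

Definition vote_list x sc : seq vspec :=
  flatten [seq [seq gvote (grp (netx x) (msize x) (two_drops (words sc)) (first_drop (words sc))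
      (last_drop (words sc)) d) k | k <- iota 0 (msize x)] | d <- descs (netx x)].

(** The second component is the encoded score vector, which the machine of the scoring rule supplies
    between the two programs. *)
Definition reduction (xs : seq bool * seq bool) : seq bool :=
  delim (unary (msize xs.1)) ++ delim (unary 0) ++
  flatten [seq vote_block (msize xs.1) V | V <- vote_list xs.1 xs.2].

Lemma ptime_certsize : ptime certsize.
Proof. by apply: (ptime_horner q (n := fun x => size x)); pt. Qed.
Lemma ptime_insize : ptime insize.
Proof. by have h := ptime_certsize; have h' := ptime_delim (ptime_id (A := seq bool)); rewrite /insize; pt. Qed.
Lemma ptime_horizon : ptime horizon.
Proof. by have h := ptime_insize; have h' := ptime_horner p h; rewrite /horizon; pt. Qed.
Lemma ptime_clauses : ptime clauses.
Proof. exact: (@ptime_tableau _ _ M delim _ _ (ptime_delim (ptime_id (A := seq bool))) ptime_certsize ptime_horizon). Qed.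

Lemma ptime_netx : ptime netx.
Proof.
have h := ptime_clauses; have hh := ptime_horizon.
by apply: ptime_Network; pt.
Qed.

Lemma ptime_msize : ptime msize.
Proof. by have h := ptime_ncodes ptime_netx; rewrite /msize; pt. Qed.

Lemma ptime_vote_list : ptime (fun xs : seq bool * seq bool => vote_list xs.1 xs.2).
Proof.
have hw : ptime (fun y : (seq bool * seq bool) * desc => words y.1.2) by apply: ptime_words; pt.
have hg : ptime (fun y : (seq bool * seq bool) * desc =>
    grp (netx y.1.1) (msize y.1.1) (two_drops (words y.1.2)) (first_drop (words y.1.2))
      (last_drop (words y.1.2)) y.2).
  apply: ptime_grp.
  + by have h := ptime_msize; pt.
  + by have h := ptime_netx; pt.
  + exact: ptime_two_drops.
  + exact: ptime_first_drop.
  + exact: ptime_last_drop.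
  + by pt.
have hd := ptime_descs ptime_netx; have hm := ptime_msize.
have hv : ptime (fun y : group * nat => gvote y.1 y.2) by apply: ptime_gvote; pt.
pose V y := gvote y.1 y.2; have hV : ptime V := hv.
pose GR (y : (seq bool * seq bool) * desc) := grp (netx y.1.1) (msize y.1.1) (two_drops (words y.1.2))
  (first_drop (words y.1.2)) (last_drop (words y.1.2)) y.2; have hGR : ptime GR := hg.
pose D x := descs (netx x); have hD : ptime D := hd.
apply: (ptime_ext (f := fun xs : seq bool * seq bool =>
  flatten [seq [seq V (GR (xs, d), k) | k <- iota 0 (msize xs.1)] | d <- D xs.1])) => //.
by clearbody V GR D; pt.
Qed.

Lemma ptime_reduction : ptime reduction.
Proof.
have hl : ptime (fun y : vspec * (nat * nat) => vless y.1 y.2.1 y.2.2) by apply: ptime_vless; pt.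
pose VL y := vless y.1 y.2.1 y.2.2; have hVL : ptime VL := hl.
have hm := ptime_msize; pose V (xs : seq bool * seq bool) := vote_list xs.1 xs.2; have hV : ptime V := ptime_vote_list.
have hu : ptime (fun xs : seq bool * seq bool => unary (msize xs.1)) by rewrite /unary; pt.
have hdu := ptime_delim hu.
apply: (ptime_ext (f := fun xs : seq bool * seq bool =>
  delim (unary (msize xs.1)) ++ delim (unary 0) ++
  flatten [seq flatten [seq [seq VL (v, (a, b)) | b <- iota 0 (msize xs.1)] | a <- iota 0 (msize xs.1)] |
     v <- V xs])) => //.
by clearbody V VL; pt.
Qed.

Section correct.
Variable r : scoring_rule.
Hypothesis hz : forall m : nat, z < m ->
   [/\ (svec r m : seq nat) <> nseq m 0,
       (svec r m : seq nat) <> 1 :: nseq (m - 1) 0 &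
       (svec r m : seq nat) <> rcons (nseq (m - 1) 1) 0].
Variable x : seq bool.
Let ws := words (enc_scores (r (msize x))).

Lemma net_wf : wf_net (netx x).
Proof.
apply: net_of_wf => c w; apply: tableau_lt.
by rewrite /horizon /insize leq_addr.
Qed.

Lemma drops_ok : drops (r (msize x)) (msize x) (two_drops ws) (first_drop ws) (last_drop ws).
Proof. by apply: drops_found; apply: hz; rewrite /msize; lia. Qed.

Lemma codes_fit : ncodes (netx x) <= msize x.
Proof. by rewrite /msize; lia. Qed.

Definition instance : pw_instance := pw_inst r net_wf (two_drops ws) (first_drop ws) (last_drop ws) codes_fit.

Lemma reduction_enc : reduction (x, enc_scores (r (msize x))) = enc_instance instance.
Proof. by rewrite /instance pw_inst_enc. Qed.

Lemma reduction_correct :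
  (exists2 y, size y <= certsize x & accepts M (horizon x) (delim x ++ y)) <->
  PossibleWinner r (reduction (x, enc_scores (r (msize x)))).
Proof.
have fit : size (delim x) + certsize x <= horizon x by rewrite /horizon /insize leq_addr.
have t := tableau_correct M fit; have c := pw_choice net_wf drops_ok codes_fit.
rewrite reduction_enc; split=> [/t/c h|[J e h]]; first by exists instance.
by apply/t/c; apply: enc_instance_inj h.
Qed.
End correct.
End reduction.

Lemma accepts_output (M : machine) (w : seq bool) t T b :
  outputs_within M w t (enc_bool b) -> t <= T -> accepts M T w = b.
Proof.
move=> h le; have [_] := outputs_within_mono h le; rewrite /accepts /output /scan.
by case: (tnth _ _).2 => [|[[[]|]|] l] //= -[<-].
Qed.

Theorem PossibleWinner_hard (r : scoring_rule) z :
  (forall m : nat, z < m ->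
   [/\ (svec r m : seq nat) <> nseq m 0,
       (svec r m : seq nat) <> 1 :: nseq (m - 1) 0 &
       (svec r m : seq nat) <> rcons (nseq (m - 1) 1) 0]) ->
  NP_hard (PossibleWinner r).
Proof.
move=> hz L [V [q [[M [p hM]] hV]]].
exists (fun w => reduction M p q z (w, enc_scores (r (msize M p q z w)))).
  exact: (polytime_ptime (svec_polytime r) (ptime_msize M p q z) (ptime_reduction M p q z)).
move=> x; rewrite hV -(reduction_correct M p q hz).
(* The time bound [p] is monotone, so one horizon serves all certificates of admissible length. *)
have acc y : size y <= certsize q x -> accepts M (horizon p q x) (delim x ++ y) = V (x, y).
  move=> hy; apply: accepts_output (hM (x, y)) _; rewrite /horizon.
  apply: leq_trans (leq_addl _ _); apply: horner_mono.
  by rewrite /enc_pair size_cat leq_add2l.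
by split=> -[y hy]; [rewrite -acc//|rewrite acc//] => h; exists y.
Qed.

(** * Membership in NP *)

Definition dval (l : seq nat) := foldr (fun c v => c + v.*2) 0 l.

(* Compares two numbers given by lists of pairs of binary digits (least
   significant first), where digits at most [n] are admitted: [u - n] is the
   halved excess of the second number over the first one so far. *)
Definition carry n u (cd : nat * nat) := (u + n + cd.2 - cd.1)./2.
Definition compare n (l : seq (nat * nat)) := n <= foldl (carry n) n l.

(** Digits of the first number are at most [n], so the subtraction in [carry] is never truncated.
    The remaining digits count double, hence rounding down the half does not affect the
    inequality. *)
Lemma compareE n (l : seq (nat * nat)) : all (fun cd => cd.1 <= n) l ->
  compare n l = (dval [seq cd.1 | cd <- l] <= dval [seq cd.2 | cd <- l]).
Proof.
rewrite /compare => h.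
suff -> : forall u, (n <= foldl (carry n) u l) =
    (dval [seq cd.1 | cd <- l] + n <= dval [seq cd.2 | cd <- l] + u) by rewrite leq_add2r.
elim: l h => //= -[c d] l IH /andP[/= hc /IH {}IH] u; rewrite IH /carry /=.
move: (dval _) (dval _) => X Y; have := odd_double_half (u + n + d - c).
move: (_./2) => Z; case: odd; lia.
Qed.

Lemma ptime_half {G : Type} {eG : Enc G} (n : G -> nat) : ptime n -> ptime (fun g => (n g)./2).
Proof.
move=> hn; apply: (ptime_ext (f := fun g => size [seq i <- iota 0 (n g) | i.+1 + i.+1 <= n g])); first by pt.
move=> g; rewrite size_filter; move: (n g) => k.
rewrite (eq_count (a2 := fun i => i < k./2)); last by move=> i; rewrite addnn geq_half_double.
have hk : k./2 <= k by rewrite leq_half_double -addnn; lia.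
rewrite -{2}(subnKC hk) iotaD count_cat add0n (@eq_in_count _ _ xpredT) ?count_predT ?size_iota; last first.
  by move=> i; rewrite mem_iota0.
rewrite (@eq_in_count _ _ pred0) ?count_pred0 ?addn0 // => i; rewrite mem_iota => /andP[h _].
by rewrite ltnNge h.
Qed.

Lemma ptime_compare {G : Type} {eG : Enc G} (n : G -> nat) (l : G -> seq (nat * nat)) :
  ptime n -> ptime l -> ptime (fun g => compare (n g) (l g)).
Proof.
move=> hn hl; apply: (ptime_leq (m := n)) => //.
apply: ptime_foldl; [exact: hl|exact: hn|by apply: ptime_half; pt|].
have [k hk] := ptime_size hn; have [k' hk'] := ptime_size hl.
have [j hj] : poly_bounded (fun x => (bound k x + (bound k' x * bound k x + bound k' x)) + (bound k x + (bound k' x * bound k x + bound k' x)) + 1) by poly_bound.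
exists j => g l1 l2 e; apply: leq_trans (hj _); rewrite csize_nat -addnn addn1 ltnS.
have hN : n g <= bound k (csize g) by apply: leq_trans (hk g); rewrite csize_nat -addnn; lia.
have aux : forall l3 u, foldl (carry (n g)) u l3 <= u + (size l3 * n g + csize l3).
  elim=> [|[c d] l3 IH] u /=; first by rewrite leq_addr.
  apply: leq_trans (IH _) _; rewrite csize_cons csize_prod !csize_nat.
  have : carry (n g) u (c, d) <= u + n g + d by rewrite /carry /= leq_half_double -addnn; lia.
  rewrite mulSn -!addnn; move: (carry _ _ _) (size _ * _) (csize _); lia.
have h1 : size l1 <= bound k' (csize g).
  by apply: leq_trans (hk' g); rewrite e; apply: leq_trans (ltnW (size_tsz _)); rewrite size_cat leq_addr.
have h2 : csize l1 <= bound k' (csize g).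
  apply: leq_trans (hk' g); rewrite e -(leq_add2r 1) csize_cat leq_add2l.
  exact: leq_ltn_trans (size_tsz _).
have h3 := leq_mul h1 hN; have h4 := aux l1 (n g).
have h5 : foldl (carry (n g)) (n g) l1 <= bound k (csize g) + (bound k' (csize g) * bound k (csize g) + bound k' (csize g)).
  by apply: leq_trans h4 _; rewrite !leq_add.
exact: leq_add.
Qed.

Lemma dval_add (F F' : nat -> nat) s :
  dval [seq F j + F' j | j <- s] = dval [seq F j | j <- s] + dval [seq F' j | j <- s].
Proof. by elim: s => //= a s ->; rewrite doubleD addnACA. Qed.

Lemma dval_bits u W : size u <= W -> dval [seq nat_of_bool (nth false u j) | j <- iota 0 W] = bval u.
Proof.
elim: u W => [|b u IH] W h.
  by under eq_map do rewrite nth_nil; elim: (iota 0 W) => //= a s ->.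
case: W h => // W h; rewrite [bval _]/= -(IH W) // -/(bval u).
rewrite [iota 0 W.+1](_ : _ = 0 :: [seq 1 + j | j <- iota 0 W]); last by rewrite -iotaDl.
by rewrite /= -map_comp.
Qed.

(** A digit of a total before any carry: the number of votes whose score has bit [j]. It is at most
    the number of votes, as [compareE] demands. *)
Definition digit (ws : seq (seq bool)) (ps : seq nat) j := size [seq p <- ps | nth false (nth [::] ws p) j].

Lemma dval_digits ws W ps : all (fun w => size w <= W) ws ->
  dval [seq digit ws ps j | j <- iota 0 W] = \sum_(p <- ps) bval (nth [::] ws p).
Proof.
move=> hW; elim: ps => [|p ps IH].
  by rewrite big_nil /digit /=; elim: (iota 0 W) => //= a s ->.
rewrite big_cons -IH -(@dval_bits _ W); last first.
  by case: (ltnP p (size ws)) => h; [exact: (all_nthP [::] hW)|rewrite nth_default].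
rewrite -dval_add; congr dval; apply: eq_map => j; rewrite /digit /=.
by case: (nth false _ j).
Qed.

Definition trans_ok m (v : nat -> nat -> bool) :=
  all (fun a => all (fun b => all (fun c => v a b ==> (v b c ==> v a c)) (iota 0 m)) (iota 0 m)) (iota 0 m).
Definition anti_ok m (v : nat -> nat -> bool) :=
  all (fun a => all (fun b => v a b ==> (v b a ==> (a == b))) (iota 0 m)) (iota 0 m).
Definition total_ok m (v : nat -> nat -> bool) :=
  all (fun a => all (fun b => v a b || v b a) (iota 0 m)) (iota 0 m).
Definition sub_ok m (u v : nat -> nat -> bool) :=
  all (fun a => all (fun b => u a b ==> v a b) (iota 0 m)) (iota 0 m).

Definition posn m (v : nat -> nat -> bool) a := size [seq b <- iota 0 m | v b a && (b != a)].

Lemma all_ord (m : nat) (p : nat -> bool) : reflect (forall a : 'I_m, p a) (all p (iota 0 m)).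
Proof.
apply: (iffP allP) => h a; first by apply: h; rewrite mem_iota0.
by rewrite mem_iota0 => am; apply: (h (Ordinal am)).
Qed.

Section ordinals.
Variables (m : nat) (v : nat -> nat -> bool).
Let R : rel 'I_m := fun a b => v a b.

Lemma transP : reflect (transitive R) (trans_ok m v).
Proof.
apply: (iffP (all_ord m _)) => [h b a c ab bc|h a].
  by have /all_ord/(_ b)/all_ord/(_ c) := h a; move: ab bc; rewrite /R => -> ->.
apply/all_ord => b; apply/all_ord => c; apply/implyP => ab; apply/implyP; exact: h.
Qed.

Lemma antiP : reflect (antisymmetric R) (anti_ok m v).
Proof.
apply: (iffP (all_ord m _)) => [h a b /andP[]|h a].
  have /all_ord/(_ b) := h a; rewrite /R => /implyP/[apply]/implyP/[apply] /eqP; exact: val_inj.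
by apply/all_ord => b; apply/implyP => ab; apply/implyP => ba; rewrite (h a b) // /R ab.
Qed.

Lemma totalP : reflect (total R) (total_ok m v).
Proof.
apply: (iffP (all_ord m _)) => [h a b|h a]; first by have /all_ord := h a; apply.
by apply/all_ord => b; apply: h.
Qed.

Lemma position_posn a : position R a = posn m v a.
Proof.
rewrite /position /posn cardsE cardE !size_filter -[iota 0 m]val_enum_ord count_map enumT.
by apply: eq_count => b; rewrite /= ?inE.
Qed.
End ordinals.

Definition score_digits m n (w : nat -> nat -> nat -> bool) ws a j :=
  digit ws [seq posn m (w i) a | i <- iota 0 n] j.

(** The joint length of all score words serves as a bound for the number of binary places. *)
Definition beats m n (w : nat -> nat -> nat -> bool) ws c a :=
  compare n [seq (score_digits m n w ws a j, score_digits m n w ws c j) | j <- iota 0 (size (flatten ws))].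

Lemma beatsE m n (w : nat -> nat -> nat -> bool) s (c a : 'I_m) :
  beats m n w [seq binary k | k <- s] c a =
  (total_score s (fun (i : 'I_n) (a b : 'I_m) => w i a b) a <=
   total_score s (fun (i : 'I_n) (a b : 'I_m) => w i a b) c).
Proof.
set ws := map _ _.
have hW : all (fun u => size u <= size (flatten ws)) ws.
  by elim: (ws) => //= u us IH; rewrite size_cat leq_addr; apply: sub_all IH => t /= h; rewrite (leq_trans h) ?leq_addl.
have sc (b : 'I_m) : total_score s (fun (i : 'I_n) (a b : 'I_m) => w i a b) b =
    dval [seq score_digits m n w ws b j | j <- iota 0 (size (flatten ws))].
  rewrite dval_digits // big_map /total_score -[X in iota 0 X]subn0 -/(index_iota _ _) big_mkord.
  apply: eq_bigr => i _; rewrite position_posn; move: (posn _ _ _) => k.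
  case: (ltnP k (size s)) => h; first by rewrite (nth_map 0) // bval_binary.
  by rewrite !nth_default // size_map.
rewrite /beats compareE -?map_comp ?sc //.
apply/allP => x /mapP[j _ ->] /=; rewrite /score_digits /digit size_filter.
by apply: leq_trans (count_size _ _) _; rewrite size_map size_iota.
Qed.

Definition verify m n c bits y ws :=
  [&& c < m,
      all (fun i => trans_ok m (vote_bit m bits i) && anti_ok m (vote_bit m bits i)) (iota 0 n),
      all (fun i => [&& total_ok m (vote_bit m y i), trans_ok m (vote_bit m y i), anti_ok m (vote_bit m y i) &
        sub_ok m (vote_bit m bits i) (vote_bit m y i)]) (iota 0 n) &
      all (beats m n (vote_bit m y) ws c) (iota 0 m)].

Definition count_votes m (bits : seq bool) :=
  find (fun k => k * (m * m) == size bits) (iota 0 (size bits).+1).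

(** Decoding never fails, so malformed words are rejected by encoding the decoded parts again and
    comparing with [x], and by checking that the bits divide evenly into votes. *)
Definition verifier (x y : seq bool) ws :=
  let m := size (dword x) in let c := size (dword (drest x)) in
  let bits := drest (drest x) in let n := count_votes m bits in
  [&& bits_eq x (delim (unary m) ++ (delim (unary c) ++ bits)), n * (m * m) == size bits &
      verify m n c bits y ws].

Lemma bits_of m n (bits : seq bool) (hp : forall i : 'I_n, partial_vote (fun a b : 'I_m => vote_bit m bits i a b))
  (c : 'I_m) : size bits = n * (m * m) -> vote_bits (PWInstance hp c) = bits.
Proof.
move=> hs; set I := PWInstance hp c.
apply: (eq_from_nth (x0 := false)) => [|k]; rewrite size_vote_bits ?hs // => hk.
have m0 : 0 < m := leq_ltn_trans (leq0n c) (ltn_ord c).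
have mm : 0 < m * m by rewrite muln_gt0 m0.
have hi : k %/ (m * m) < n by rewrite ltn_divLR.
have ha : k %% (m * m) %/ m < m by rewrite ltn_divLR // ltn_mod.
have hb : k %% (m * m) %% m < m by rewrite ltn_mod.
have e : k = k %/ (m * m) * (m * m) + (k %% (m * m) %/ m * m + k %% (m * m) %% m) by rewrite -!divn_eq.
rewrite [X in nth _ _ X = _]e [X in _ = nth _ _ X]e.
exact: (@vote_bitE I (Ordinal hi) (Ordinal ha) (Ordinal hb)).
Qed.

Lemma count_votesE m n (bits : seq bool) : 0 < m -> size bits = n * (m * m) -> count_votes m bits = n.
Proof.
move=> m0 hs; have mm : 0 < m * m by rewrite muln_gt0 m0.
have hn : n < (size bits).+1 by rewrite ltnS hs leq_pmulr.
rewrite /count_votes; set P := fun k => _.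
have hP : has P (iota 0 (size bits).+1) by apply/hasP; exists n; rewrite ?mem_iota0 // /P hs.
have := nth_find 0 hP; rewrite nth_iota; last by rewrite -[X in _ < X](size_iota 0) -has_find.
by rewrite add0n /P hs eqn_pmul2r // => /eqP.
Qed.

Lemma verifier_sound (r : scoring_rule) x y : verifier x y [seq binary k | k <- r (size (dword x))] ->
  PossibleWinner r x.
Proof.
rewrite /verifier; set m := size (dword x); set c := size _; set bits := drest _; set n := count_votes _ _.
case/and3P=> /[!bits_eqE] /eqP ex /eqP hs /and4P[hc hb hy hw].
have hp (i : 'I_n) : partial_vote (fun a b : 'I_m => vote_bit m bits i a b).
  by have /all_ord/(_ i)/andP[h1 h2] := hb; split; [apply/transP|apply/antiP].
exists (PWInstance hp (Ordinal hc)).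
  by rewrite enc_instanceE bits_of.
exists (fun i a b => vote_bit m y i a b); split=> /=.
  move=> i; have /all_ord/(_ i)/and4P[h1 h2 h3 h4] := hy.
  split; first by split; [apply/totalP|apply/transP|apply/antiP].
  by move=> a b; have /all_ord/(_ a)/all_ord/(_ b)/implyP := h4.
by move=> a; have /all_ord/(_ a) := hw; rewrite (beatsE _ _ _ (Ordinal hc)).
Qed.

(** The completed votes are written in the format of the partial ones, so the certificate is no
    longer than the input. *)
Lemma verifier_complete (r : scoring_rule) x : PossibleWinner r x ->
  exists2 y, size y <= size x & verifier x y [seq binary k | k <- r (size (dword x))].
Proof.
case=> -[m n V hV c] /= ex [/= P [hP hw]].
have hPp i : partial_vote (P i) by have [[_ t a] _] := hP i.
pose J := @PWInstance m n P hPp c; pose I := @PWInstance m n V hV c.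
have hsI := size_vote_bits I; have hsJ := size_vote_bits J; rewrite /= in hsI hsJ.
exists (vote_bits J).
  by rewrite hsJ -hsI ex -/I enc_instanceE !size_cat addnA leq_addl.
have e1 : size (dword x) = m by rewrite ex enc_instanceE dword_delim size_nseq.
have e2 : drest x = delim (unary c) ++ vote_bits I by rewrite ex enc_instanceE drest_delim.
have m0 : 0 < m := leq_ltn_trans (leq0n c) (ltn_ord c).
rewrite /verifier e1 e2 dword_delim drest_delim size_nseq (count_votesE m0 hsI) bits_eqE hsI eqxx andTb.
apply/andP; split; first by apply/eqP.
have vI (i : 'I_n) : (fun a b : 'I_m => vote_bit m (vote_bits I) i a b) =2 V i by move=> a b; apply: (vote_bitE (I := I)).
have vJ (i : 'I_n) : (fun a b : 'I_m => vote_bit m (vote_bits J) i a b) =2 P i by move=> a b; apply: (vote_bitE (I := J)).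
apply/and4P; split; rewrite ?ltn_ord //.
- apply/all_ord => i; have [t a] := hV i; apply/andP; split.
    by apply/transP => b a' c'; rewrite !vI; apply: t.
  by apply/antiP => a' b'; rewrite !vI; apply: a.
- apply/all_ord => i; have [[t tr a] s] := hP i; apply/and4P; split.
  + by apply/totalP => a' b'; rewrite !vJ; apply: t.
  + by apply/transP => b a' c'; rewrite !vJ; apply: tr.
  + by apply/antiP => a' b'; rewrite !vJ; apply: a.
  by apply/all_ord => a'; apply/all_ord => b'; apply/implyP; rewrite (vI i a' b') (vJ i a' b'); apply: s.
apply/all_ord => a; rewrite beatsE.
have sc (b : 'I_m) : total_score (r m) (fun (i : 'I_n) (a b : 'I_m) => vote_bit m (vote_bits J) i a b) b = total_score (r m) P b.
  apply: eq_bigr => i _; congr nth; apply: eq_card => d; by rewrite !inE vJ.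
by rewrite !sc; apply: hw.
Qed.

Section checks.
Context {G : Type} {eG : Enc G}.
Variables (m n c : G -> nat) (bits y : G -> seq bool) (ws : G -> seq (seq bool)).
Hypothesis hm : ptime m.
Hypothesis hn : ptime n.
Hypothesis hc : ptime c.
Hypothesis hbits : ptime bits.
Hypothesis hy : ptime y.
Hypothesis hws : ptime ws.

Lemma ptime_trans_ok (i : G -> nat) : ptime i -> ptime (fun g => trans_ok (m g) (vote_bit (m g) (y g) (i g))).
Proof. by move=> hi; rewrite /trans_ok /vote_bit; pt. Qed.
Lemma ptime_anti_ok (i : G -> nat) : ptime i -> ptime (fun g => anti_ok (m g) (vote_bit (m g) (y g) (i g))).
Proof. by move=> hi; rewrite /anti_ok /vote_bit; pt. Qed.
Lemma ptime_total_ok (i : G -> nat) : ptime i -> ptime (fun g => total_ok (m g) (vote_bit (m g) (y g) (i g))).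
Proof. by move=> hi; rewrite /total_ok /vote_bit; pt. Qed.
Lemma ptime_sub_ok (i : G -> nat) : ptime i ->
  ptime (fun g => sub_ok (m g) (vote_bit (m g) (bits g) (i g)) (vote_bit (m g) (y g) (i g))).
Proof. by move=> hi; rewrite /sub_ok /vote_bit; pt. Qed.

Lemma ptime_positions (a : G -> nat) : ptime a ->
  ptime (fun g => [seq posn (m g) (vote_bit (m g) (y g) i) (a g) | i <- iota 0 (n g)]).
Proof. by move=> ha; rewrite /posn /vote_bit; pt. Qed.
End checks.

Section verify.
Context {G : Type} {eG : Enc G}.
Variables (m n c : G -> nat) (bits y : G -> seq bool) (ws : G -> seq (seq bool)).
Hypothesis hm : ptime m.
Hypothesis hn : ptime n.
Hypothesis hc : ptime c.
Hypothesis hbits : ptime bits.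
Hypothesis hy : ptime y.
Hypothesis hws : ptime ws.

Lemma ptime_beats (a : G -> nat) : ptime a -> ptime (fun g => beats (m g) (n g) (vote_bit (m g) (y g)) (ws g) (c g) (a g)).
Proof.
move=> ha; rewrite /beats /score_digits /digit; apply: ptime_compare => //.
pose PA g := [seq posn (m g) (vote_bit (m g) (y g) i) (a g) | i <- iota 0 (n g)].
pose PC g := [seq posn (m g) (vote_bit (m g) (y g) i) (c g) | i <- iota 0 (n g)].
have hA : ptime PA := ptime_positions hm hn hy ha.
have hC : ptime PC := ptime_positions hm hn hy hc.
apply: (ptime_ext (f := fun g => [seq (size [seq p <- PA g | nth false (nth [::] (ws g) p) j],
  size [seq p <- PC g | nth false (nth [::] (ws g) p) j]) | j <- iota 0 (size (flatten (ws g)))])) => //.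
by clearbody PA PC; pt.
Qed.
End verify.

Lemma ptime_verify {G : Type} {eG : Enc G} (m n c : G -> nat) (bits y : G -> seq bool) (ws : G -> seq (seq bool)) :
  ptime m -> ptime n -> ptime c -> ptime bits -> ptime y -> ptime ws ->
  ptime (fun g => verify (m g) (n g) (c g) (bits g) (y g) (ws g)).
Proof.
move=> hm hn hc hb hy hw; rewrite /verify.
apply: ptime_andb; first by pt.
apply: ptime_andb.
  apply: ptime_all; first by pt.
  by apply: ptime_andb; [apply: ptime_trans_ok; pt|apply: ptime_anti_ok; pt].
apply: ptime_andb; last by apply: ptime_all; [pt|apply: ptime_beats; pt].
apply: ptime_all; first by pt.
apply: ptime_andb; first by apply: ptime_total_ok; pt.
apply: ptime_andb; first by apply: ptime_trans_ok; pt.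
by apply: ptime_andb; [apply: ptime_anti_ok; pt|apply: ptime_sub_ok; pt].
Qed.

Lemma ptime_dlen : ptime dlen.
Proof.
rewrite /dlen; apply: (ptime_find 0 (s := fun w : seq bool => iota 0 (size w))
  (p := fun w i => ~~ nth false w (i + i))); by pt.
Qed.
Lemma ptime_dword : ptime dword.
Proof. by have h := ptime_dlen; rewrite /dword; pt. Qed.
Lemma ptime_drest : ptime drest.
Proof. by have h := ptime_dlen; rewrite /drest; pt. Qed.

Lemma ptime_count_votes {G : Type} {eG : Enc G} (m : G -> nat) (bits : G -> seq bool) :
  ptime m -> ptime bits -> ptime (fun g => count_votes (m g) (bits g)).
Proof.
move=> hm hb; apply: (ptime_find 0 (s := fun g => iota 0 (size (bits g)).+1)
  (p := fun g k => k * (m g * m g) == size (bits g))); by pt.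
Qed.

Lemma ptime_verifier {G : Type} {eG : Enc G} (x y : G -> seq bool) (ws : G -> seq (seq bool)) :
  ptime x -> ptime y -> ptime ws -> ptime (fun g => verifier (x g) (y g) (ws g)).
Proof.
move=> hx hy hw; rewrite /verifier.
have hd := ptime_dword; have hr := ptime_drest.
have hm : ptime (fun g => size (dword (x g))) by pt.
have hc : ptime (fun g => size (dword (drest (x g)))) by pt.
have hb : ptime (fun g => drest (drest (x g))) by pt.
have hn := ptime_count_votes hm hb.
apply: ptime_andb; last by apply: ptime_andb; [pt|exact: ptime_verify].
apply: ptime_bits_eq => //; apply: ptime_cat; first by apply: ptime_delim; rewrite /unary; pt.
by apply: ptime_cat => //; apply: ptime_delim; rewrite /unary; pt.
Qed.

Theorem PossibleWinner_NP (r : scoring_rule) : in_NP (PossibleWinner r).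
Proof.
pose V (xy : seq bool * seq bool) := verifier xy.1 xy.2 [seq binary k | k <- r (size (dword xy.1))].
exists V, 'X%R; split; last first.
  move=> x; split=> [h|[y _ hy]]; last exact: verifier_sound hy.
  by have [y hy hV] := verifier_complete h; exists y; rewrite ?hornerX.
(* The input is the code of a pair: one [dword] extracts the instance, the next one the unary number
   of its candidates, for which the score vector is then computed. *)
have hg : ptime (fun w => size (dword (dword w))) by have hd := ptime_dword; pt.
have hh : ptime (fun ws : seq bool * seq bool => [:: verifier (dword ws.1) (drest ws.1) (words ws.2)]).
  have hd := ptime_dword; have hr := ptime_drest; apply: ptime_cons; last by pt.
  by apply: ptime_verifier; [pt|pt|apply: ptime_words; pt].
have [M [p hM]] := polytime_ptime (svec_polytime r) hg hh.
exists M, p => xy; have := hM (enc_pair xy).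
by rewrite /enc_pair !dword_delim drest_delim words_scores.
Qed.

Theorem theorem5 (r : scoring_rule)
  (hr : exists z : nat, forall m : nat, z < m ->
     [/\ (svec r m : seq nat) <> nseq m 0,
         (svec r m : seq nat) <> 1 :: nseq (m - 1) 0,
         (svec r m : seq nat) <> rcons (nseq (m - 1) 1) 0
       & (svec r m : seq nat) <> 2 :: rcons (nseq (m - 2) 1) 0]) :
  NP_complete (PossibleWinner r).
Proof.
split; first exact: PossibleWinner_NP.
have [z hz] := hr; apply: (@PossibleWinner_hard r z) => m zm.
by have [] := hz m zm.
Qed.
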